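(* Let $0 \neq \phi \in L^2(\mathbb{R}^d)$, let $\Lambda \subseteq \mathbb{R}^d$ be a lattice and $S \in \mathrm{Sp}_{2d}(\mathbb{R})$. Let $\{c_\lambda\}_{\lambda\in\Lambda} \in \ell^2(\Lambda)$ be such that $f = \sum_{\lambda\in\Lambda} c_\lambda T_\lambda^S\phi$ converges in $L^2(\mathbb{R}^d)$, and put $f_\times = \sum_{\lambda\in\Lambda} \overline{c_\lambda} T_\lambda^S\phi$. Then: (1) If $\{c_\lambda \} \in c_{00}(\Lambda)$, then $f \nsim f_\times$ if and only if $\{ c_\lambda \} \in \ell^2_\mathcal{O}(\Lambda)$. (2) If there exist constants $0<A\le B<\infty$ such that $A \leq \mathfrak{p}_{\Lambda^*}[\mu(S)^{-1}\phi](t) \leq B$ for almost every $t \in \mathcal{P}(\Lambda^* )$, then $f \nsim f_\times$ if and only if $\{ c_\lambda \} \in \ell^2_\mathcal{O}(\Lambda)$.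
   Context: $T_\lambda h(t)=h(t-\lambda)$. $\mathrm{Sp}_{2d}(\mathbb{R})=\{S:S^T\mathcal{J}S=\mathcal{J}\}$, $\mathcal{J}=\begin{pmatrix}0&-I_d\\ I_d&0\end{pmatrix}$. $\mu(S)$ is the metaplectic operator associated to $S$ (unitary on $L^2(\mathbb{R}^d)$, determined up to sign), and $T_\lambda^S=\mu(S)T_\lambda\mu(S)^{-1}$. $f\sim h$ means $f=\nu h$ for some $\nu\in\mathbb{C}$ with $|\nu|=1$; $f\nsim h$ means this fails. $c_{00}(\Lambda)$ is the set of finitely supported sequences on $\Lambda$. $\ell^2_\mathcal{O}(\Lambda)=\{\{c_\lambda\}\in\ell^2(\Lambda):$ there is no $\alpha\in\mathbb{R}$ with $c_\lambda\in e^{i\alpha}\mathbb{R}$ for all $\lambda\in\Lambda\}$. For $\Lambda=M\mathbb{Z}^d$: $\Lambda^*=M^{-T}\mathbb{Z}^d$, $\mathcal{P}(\Lambda^* )=M^{-T}[0,1]^d$, and $\mathfrak{p}_{\Lambda^*}[\psi](t)=\sum_{\gamma\in\Lambda^*}|\mathcal{F}\psi(t+\gamma)|^2$ with $\mathcal{F}h(\omega)=\int h(t)e^{-2\pi i\omega\cdot t}dt$. *)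

(* Defs.v *)
From HB Require Import structures.
From mathcomp Require Import all_boot all_order all_algebra.
From mathcomp Require Import complex.
From mathcomp Require Import all_classical all_reals all_analysis.
Set Implicit Arguments. Unset Strict Implicit. Unset Printing Implicit Defensive.
Import Order.TTheory GRing.Theory Num.Theory.
Local Open Scope classical_set_scope.
Local Open Scope ring_scope.

Section Defs.
Variable R : realType.
Local Notation C := R[i].

(* points of R^d are row vectors; the measurable structure / Lebesgue
   integration is transported from d.-tuple R (product Borel sigma-algebra) *)
Definition tup2row (d : nat) (t : d.-tuple R) : 'rV[R]_d := \row_i tnth t i.

(* iterated Lebesgue integral of an extended-real function on R^n
   (for nonnegative measurable g this is the Lebesgue integral on R^n, by Tonelli) *)
Fixpoint Iint (n : nat) : (n.-tuple R -> \bar R) -> \bar R :=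
  match n return (n.-tuple R -> \bar R) -> \bar R with
  | 0 => fun g => g [tuple]
  | n'.+1 => fun g =>
      (\int[@lebesgue_measure R]_x Iint (fun t : n'.-tuple R => g (cons_tuple x t)))%E
  end.

Definition intRd (d : nat) (g : 'rV[R]_d -> \bar R) : \bar R :=
  Iint (fun t : d.-tuple R => g (tup2row t)).

Definition measRd (d : nat) (A : set 'rV[R]_d) : Prop :=
  measurable [set t : d.-tuple R | A (tup2row t)].

Definition nullRd (d : nat) (N : set 'rV[R]_d) : Prop :=
  exists N' : set 'rV[R]_d, [/\ measRd N', N `<=` N' &
    intRd (fun t => (\1_N' t)%:E) = 0%E].

Definition ae_on (d : nat) (D : set 'rV[R]_d) (P : 'rV[R]_d -> Prop) : Prop :=
  exists N, nullRd N /\ forall t, D t -> ~ N t -> P t.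

Definition ae (d : nat) (P : 'rV[R]_d -> Prop) : Prop := ae_on setT P.

Definition cabs2 (z : C) : R := complex.Re z ^+ 2 + complex.Im z ^+ 2.

Definition expi (theta : R) : C := Complex (cos theta) (sin theta).

Definition measC (d : nat) (f : 'rV[R]_d -> C) : Prop :=
  measurable_fun [set: d.-tuple R] (fun t => complex.Re (f (tup2row t))) /\
  measurable_fun [set: d.-tuple R] (fun t => complex.Im (f (tup2row t))).

Definition norm2sq (d : nat) (f : 'rV[R]_d -> C) : \bar R :=
  intRd (fun t => (cabs2 (f t))%:E).

Definition L2 (d : nat) (f : 'rV[R]_d -> C) : Prop :=
  measC f /\ (norm2sq f < +oo)%E.

Definition L1 (d : nat) (f : 'rV[R]_d -> C) : Prop :=
  measC f /\ (intRd (fun t => (Num.sqrt (cabs2 (f t)))%:E) < +oo)%E.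

Definition rintRd (d : nat) (g : 'rV[R]_d -> R) : R :=
  fine (intRd (fun t => (Num.max (g t) 0)%:E)) -
  fine (intRd (fun t => (Num.max (- g t) 0)%:E)).

Definition cintRd (d : nat) (g : 'rV[R]_d -> C) : C :=
  Complex (rintRd (fun t => complex.Re (g t))) (rintRd (fun t => complex.Im (g t))).

Definition aeeq (d : nat) (f g : 'rV[R]_d -> C) : Prop := ae (fun t => f t = g t).

Definition sim (d : nat) (f h : 'rV[R]_d -> C) : Prop :=
  exists nu : C, `|nu| = 1 /\ aeeq f (fun t => nu * h t).

Definition dot (d : nat) (x y : 'rV[R]_d) : R := (x *m y^T) 0 0.

Definition fourier1 (d : nat) (g : 'rV[R]_d -> C) : 'rV[R]_d -> C :=
  fun w => cintRd (fun t => g t * expi (- (2 * pi * dot w t))).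

Definition trunc (d : nat) (n : nat) (h : 'rV[R]_d -> C) : 'rV[R]_d -> C :=
  fun t => if `[< forall i, `|t 0 i| <= n%:R >] then h t else 0.

Definition is_fourierL2 (d : nat) (psi Psi : 'rV[R]_d -> C) : Prop :=
  L2 Psi /\
  forall eps : R, 0 < eps -> exists N : nat, forall n : nat, (N <= n)%N ->
    (norm2sq (fun w => (Psi w - fourier1 (trunc n psi) w)%R) < (eps%:E))%E.

Definition transl (d : nat) (x : 'rV[R]_d) (h : 'rV[R]_d -> C) : 'rV[R]_d -> C :=
  fun t => h (t - x).

(* symmetric time-frequency shift rho(x,xi) = e^{-pi i x.xi} M_xi T_x, z = (x, xi) *)
Definition rho (d : nat) (z : 'rV[R]_(d + d)) (h : 'rV[R]_d -> C) : 'rV[R]_d -> C :=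
  fun t => expi (- (pi * dot (lsubmx z) (rsubmx z))) *
           expi (2 * pi * dot (rsubmx z) t) * h (t - lsubmx z).

Definition Jmx (d : nat) : 'M[R]_(d + d) := block_mx 0 (- 1%:M) 1%:M 0.

Definition symplectic (d : nat) (S : 'M[R]_(d + d)) : Prop :=
  S^T *m Jmx d *m S = Jmx d.

(* action of S on phase space (z viewed as a column vector): S z *)
Definition sact (d : nat) (S : 'M[R]_(d + d)) (z : 'rV[R]_(d + d)) : 'rV[R]_(d + d) :=
  z *m S^T.

(* U is a metaplectic operator mu(S) associated to S, with inverse Uinv:
   a linear unitary operator on L^2(R^d) (acting on representatives,
   compatibly with a.e. equality) satisfying the intertwining relation
   mu(S) rho(z) mu(S)^{-1} = rho(S z).  This determines mu(S) up to a
   unimodular constant (Stone-von Neumann / Schur). *)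
Definition metaplectic (d : nat) (S : 'M[R]_(d + d))
    (U Uinv : ('rV[R]_d -> C) -> ('rV[R]_d -> C)) : Prop :=
  [/\ (forall h, L2 h -> L2 (U h) /\ L2 (Uinv h)),
      (forall h g, L2 h -> L2 g -> aeeq h g -> aeeq (U h) (U g) /\ aeeq (Uinv h) (Uinv g)),
      (forall (a : C) h g, L2 h -> L2 g ->
          aeeq (U (fun t => a * h t + g t)) (fun t => a * U h t + U g t)),
      (forall h, L2 h -> aeeq (Uinv (U h)) h /\ aeeq (U (Uinv h)) h) &
      ((forall h, L2 h -> norm2sq (U h) = norm2sq h) /\
       (forall z h, L2 h -> aeeq (U (rho z h)) (rho (sact S z) (U h))))].

Definition TS (d : nat) (U Uinv : ('rV[R]_d -> C) -> ('rV[R]_d -> C))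
    (lam : 'rV[R]_d) (h : 'rV[R]_d -> C) : 'rV[R]_d -> C :=
  U (transl lam (Uinv h)).

(* the lattice Lambda = M Z^d; its point indexed by k in Z^d is M k *)
Definition latpt (d : nat) (M : 'M[R]_d) (k : 'rV[int]_d) : 'rV[R]_d :=
  (map_mx intr k) *m M^T.

(* the dual lattice Lambda^* = M^{-T} Z^d; its point indexed by k is M^{-T} k *)
Definition duallatpt (d : nat) (M : 'M[R]_d) (k : 'rV[int]_d) : 'rV[R]_d :=
  (map_mx intr k) *m invmx M.

Definition dualcell (d : nat) (M : 'M[R]_d) : set 'rV[R]_d :=
  [set t | exists u : 'rV[R]_d, (forall i, 0 <= u 0 i <= 1) /\ t = u *m invmx M].

(* p_{Lambda^*}[psi](t) = sum_{gamma in Lambda^*} |F psi (t + gamma)|^2,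
   with Psi = F psi *)
Definition periodization (d : nat) (M : 'M[R]_d) (Psi : 'rV[R]_d -> C) (t : 'rV[R]_d)
  : \bar R :=
  (\esum_(k in [set: 'rV[int]_d]) (cabs2 (Psi (t + duallatpt M k)))%:E)%E.

Definition ell2 (d : nat) (c : 'rV[int]_d -> C) : Prop :=
  (\esum_(k in [set: 'rV[int]_d]) (cabs2 (c k))%:E < +oo)%E.

Definition c00 (d : nat) (c : 'rV[int]_d -> C) : Prop :=
  finite_set [set k | c k != 0].

Definition ell2O (d : nat) (c : 'rV[int]_d -> C) : Prop :=
  ell2 c /\ ~ (exists alpha : R, forall k, complex.Im (expi (- alpha) * c k) = 0).

Definition series_to (d : nat) (M : 'M[R]_d)
    (U Uinv : ('rV[R]_d -> C) -> ('rV[R]_d -> C)) (phi : 'rV[R]_d -> C)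
    (c : 'rV[int]_d -> C) (f : 'rV[R]_d -> C) : Prop :=
  L2 f /\
  forall eps : R, 0 < eps -> exists s0 : seq 'rV[int]_d, forall s : seq 'rV[int]_d,
    uniq s -> {subset s0 <= s} ->
    (norm2sq (fun t => (f t - \sum_(k <- s) c k * TS U Uinv (latpt M k) phi t)%R)
       < eps%:E)%E.

End Defs.

(* Main.v *)
(* Put psi = mu(S)^-1 phi and Psi = F psi.  As mu(S) is linear and isometric, a
   finite sum of b_k T_(Mk)^S phi has the same norm as the sum of b_k T_(Mk) psi,
   whose Fourier transform is m_b Psi, where m_b(w) is the sum of the
   b_k e^(-2 pi i w.Mk).  If f = nu f_x with |nu| = 1, the series with
   coefficients b = c - nu c^* vanishes.  When b has finite support, this gives
   m_b Psi = 0 almost everywhere; a nonzero trigonometric polynomial vanishes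
   only on a null set (its restriction to almost every line has countably many
   zeros), so b = 0 because psi is not null.  When the periodization lies between
   A and B, tiling space by the translates of the fundamental cell of the dual
   lattice turns |m_b Psi|^2 into the cell integral of |m_b|^2 times the
   periodization, which by orthogonality of the characters lies between constant
   multiples of the sum of the |b_k|^2; hence f_x converges and again b = 0.
   In both cases f ~ f_x if and only if c = nu c^* for some nu = e^(2 i alpha),
   that is, e^(-i alpha) c is real.

   The Plancherel identity is obtained on the line by damping with e^(-eps|w|),
   whose Fourier transform is the Poisson kernel, and using the continuity of
   translations in L^2; then in higher dimension one variable at a time. *)
Require Import Defs.
From HB Require Import structures.
From mathcomp Require Import all_boot all_order all_algebra.
From mathcomp Require Import complex.
From mathcomp Require Import all_classical all_reals all_analysis.
From mathcomp Require Import measurable_realfun ring lra.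
Import Order.TTheory GRing.Theory Num.Theory.
Local Open Scope classical_set_scope.
Local Open Scope ring_scope.
Import numFieldNormedType.Exports.
Set Implicit Arguments. Unset Strict Implicit. Unset Printing Implicit Defensive.

(** * Lebesgue measure on row vectors *)

(** Two choices shape the development. The statement speaks of iterated integrals over tuples,
    whereas Fubini, dominated convergence and completeness live on measure spaces; hence a measure
    [leb] on row vectors, built by the recursion of [Iint], on which all the analysis is done. Norms
    occur only squared and with values in the extended reals ([sqnorm], [sqint]), so that
    inequalities can be stated before finiteness is known; the triangle inequality then becomes |x +
    y|^2 <= 2 |x|^2 + 2 |y|^2, the source of the constants 4, 8 and 16 that divide the tolerances.

    Plancherel is reached without Fourier inversion: damping yields an exact identity with a
    nonnegative error term, [weighted_plancherel]. The exponential weight is chosen because its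
    transform is rational and the antiderivative of that transform is an arctangent, so that the
    mass and the tails of the kernel are explicit. *)

Section ProductMeasure.
Context {d1 d2 : measure_display} {T1 : measurableType d1} {T2 : measurableType d2}
  {R : realType}.
Variables (m1 : {sigma_finite_measure set T1 -> \bar R})
  (m2 : {sigma_finite_measure set T2 -> \bar R}).

(* The library's sigma-finite instance for [m1 \x m2] is masked by a later one
   that only applies to pairs of subprobabilities, hence this copy. *)
Definition prodm : set (T1 * T2) -> \bar R := (m1 \x m2)%E.
HB.instance Definition _ := Measure.copy prodm (m1 \x m2)%E.

Let prodm_sigma_finite : sigma_finite setT prodm.
Proof.
have /sigma_finiteP[F [TF ndF Foo]] := sigma_finiteT m1.
have /sigma_finiteP[G [TG ndG Goo]] := sigma_finiteT m2.
exists (fun n => F n `*` G n).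
  rewrite -setXTT TF TG; apply/seteqP; split=> -[x y] /=.
    move=> [[n _ Fnx] [k _ Gky]]; exists (maxn n k) => //; split => /=.
    - by move: x Fnx; exact/subsetPset/ndF/leq_maxl.
    - by move: y Gky; exact/subsetPset/ndG/leq_maxr.
  by move=> [n _ [/= ? ?]]; split; exists n.
move=> k; have [mF Fk] := Foo k; have [mG Gk] := Goo k.
split; first exact: measurableX.
by rewrite /prodm product_measure1E// lte_mul_pinfty// ge0_fin_numE.
Qed.
HB.instance Definition _ := Measure_isSigmaFinite.Build _ _ _ prodm prodm_sigma_finite.
End ProductMeasure.

Section Space.
Variable R : realType.
Local Notation vec d := ('rV[R]_d).

Definition row2tup (d : nat) (v : vec d) : d.-tuple R := [tuple v 0 i | i < d].

Lemma row2tupK d : cancel (@row2tup d) (@tup2row R d).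
Proof. by move=> v; apply/rowP => i; rewrite mxE tnth_mktuple. Qed.

Lemma tup2rowK d : cancel (@tup2row R d) (@row2tup d).
Proof. by move=> t; apply: eq_from_tnth => i; rewrite tnth_mktuple mxE. Qed.

Lemma measRd0 d : measRd (set0 : set (vec d)).
Proof. exact: measurable0. Qed.
Lemma measRdC d (A : set (vec d)) : measRd A -> measRd (~` A).
Proof. exact: measurableC. Qed.
Lemma measRd_bigcup d (F : (set (vec d))^nat) :
  (forall i, measRd (F i)) -> measRd (\bigcup_i F i).
Proof.
move=> mF; rewrite /measRd (_ : mkset _ = \bigcup_i [set t : d.-tuple R | F i (tup2row t)]) //.
exact: bigcupT_measurable.
Qed.

(** Taking [measRd] itself as the sigma-algebra makes measurability in [vec d] convertible with the
    predicate used in the statement. *)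
HB.instance Definition _ (d : nat) := @isMeasurable.Build default_measure_display
  (vec d) (@measRd R d) (@measRd0 d) (@measRdC d) (@measRd_bigcup d).

Lemma measurable_tup2row d : measurable_fun setT (@tup2row R d).
Proof. by move=> _ A mA; rewrite setTI. Qed.

Lemma measurable_row2tup d : measurable_fun setT (@row2tup d).
Proof.
move=> _ A mA; rewrite setTI; rewrite /measurable/= /measRd/=.
by rewrite (_ : mkset _ = A)//; apply/seteqP; split => t /=; rewrite tup2rowK.
Qed.

Lemma measurable_coord d (i : 'I_d) : measurable_fun setT (fun v : vec d => v 0 i).
Proof.
rewrite (_ : (fun v => _) = (fun t => tnth t i) \o @row2tup d).
  apply: measurableT_comp; [exact: measurable_tnth|exact: measurable_row2tup].
by apply/funext => v; rewrite /= tnth_mktuple.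
Qed.

Lemma measurable_to_vec d0 (T : measurableType d0) d (f : T -> vec d) :
  (forall i, measurable_fun setT (fun x => f x 0 i)) -> measurable_fun setT f.
Proof.
move=> mf; rewrite (_ : f = @tup2row R d \o (@row2tup d \o f)); last first.
  by apply/funext => v; rewrite /= row2tupK.
apply: measurableT_comp; first exact: measurable_tup2row.
apply/measurable_fun_tnthP => i; rewrite (_ : _ \o _ = (fun x => f x 0 i))//.
by apply/funext => v; rewrite /= tnth_mktuple.
Qed.

Lemma measurable_vecE d d0 (T : measurableType d0) (f : vec d -> T) :
  measurable_fun setT f <-> measurable_fun setT (f \o @tup2row R d).
Proof.
split=> mf; first by apply: measurableT_comp => //; exact: measurable_tup2row.
rewrite (_ : f = (f \o @tup2row R d) \o @row2tup d); last first.
  by apply/funext => v; rewrite /= row2tupK.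
by apply: measurableT_comp => //; exact: measurable_row2tup.
Qed.

(** The first coordinate is the one split off because [Iint] integrates over it outermost; every
    induction on the dimension goes through this bijection. *)
Definition consv d (p : measurableTypeR R * vec d) : vec d.+1 :=
  \row_i oapp (fun j => p.2 0 j) p.1 (unlift ord0 i).
Definition unconsv d (v : vec d.+1) : measurableTypeR R * vec d := (v 0 ord0, \row_j v 0 (lift ord0 j)).

Lemma consvK d : cancel (@consv d) (@unconsv d).
Proof.
case=> x v; rewrite /unconsv/= !mxE unlift_none/=; congr pair.
by apply/rowP => j; rewrite !mxE liftK.
Qed.

Lemma unconsvK d : cancel (@unconsv d) (@consv d).
Proof.
move=> v; apply/rowP => i; rewrite !mxE.
by case: unliftP => [j|] -> //=; rewrite mxE.
Qed.

Lemma consv_tuple d x (t : d.-tuple R) : tup2row (cons_tuple x t) = consv (x, tup2row t).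
Proof.
apply/rowP => i; rewrite !mxE/=; case: unliftP => [j|] -> //=.
  by rewrite mxE tnthS.

Qed.

Lemma measurable_consv d : measurable_fun setT (@consv d).
Proof.
apply: measurable_to_vec => i; under eq_fun do rewrite mxE.
case: unliftP => [j|] _ /=; last exact: measurable_fst.
by apply: (@measurableT_comp _ _ _ _ _ _ (fun v : vec d => v 0 j)) => //; exact: measurable_coord.
Qed.

Lemma measurable_unconsv d : measurable_fun setT (@unconsv d).
Proof.
apply/measurable_fun_pair; first exact: measurable_coord.
apply: measurable_to_vec => i; under eq_fun do rewrite mxE; exact: measurable_coord.
Qed.

Section pushconsv.
Variables (d : nat) (nu : {sigma_finite_measure set (vec d) -> \bar R}).
Definition pushconsv : set (vec d.+1) -> \bar R :=
  pushforward (@lebesgue_measure R \x nu)%E (@consv d).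
Let pm := measure_function_pushforward__canonical__measure_function_Measure
  (@lebesgue_measure R \x nu)%E (@measurable_consv d).
Let pushconsv0 : pushconsv set0 = 0%E.
Proof. exact: (@measure0 _ _ _ pm). Qed.
Let pushconsv_ge0 A : (0 <= pushconsv A)%E.
Proof. exact: (@measure_ge0 _ _ _ pm). Qed.
Let pushconsv_sigma_additive : semi_sigma_additive pushconsv.
Proof. exact: (@measure_semi_sigma_additive _ _ _ pm). Qed.
HB.instance Definition _ := isMeasure.Build _ _ _ pushconsv
  pushconsv0 pushconsv_ge0 pushconsv_sigma_additive.
Lemma pushconsv_sigma_finite : sigma_finite setT pushconsv.
Proof.
have /sigma_finiteP [F [FT ndF Foo]] :=
  sigma_finiteT (prodm (@lebesgue_measure R) nu).
exists (fun n => @unconsv d @^-1` F n).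
  by rewrite -preimage_bigcup -FT preimage_setT.
move=> n; have [mF Ffin] := Foo n; split.
  by rewrite -[X in measurable X]setTI; exact: measurable_unconsv.
rewrite /pushconsv /pushforward -comp_preimage.
rewrite (_ : unconsv (d:=d) \o _ = id) ?preimage_id//.
by apply/funext => x; exact: consvK.
Qed.
HB.instance Definition _ := Measure_isSigmaFinite.Build _ _ _ pushconsv pushconsv_sigma_finite.
End pushconsv.

(** Lebesgue measure on R^d. Following the recursion of [Iint] reduces [IintE] to one use of Tonelli
    per dimension; the unit mass in dimension 0 matches evaluation at the empty tuple. *)
Fixpoint leb (d : nat) : {sigma_finite_measure set (vec d) -> \bar R} :=
  match d with
  | 0 => \d_ (0 : vec 0)
  | d'.+1 => pushconsv (leb d')
  end.

Lemma integral_leb0 (f : vec 0 -> \bar R) : (\int[leb 0]_x f x)%E = f 0.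
Proof.
have mf : measurable_fun setT f.
  rewrite (_ : f = cst (f 0)); first exact: measurable_cst.
  by apply/funext => x; rewrite /cst; congr f; apply/rowP => -[].
by rewrite /= integral_dirac// diracT mul1e.
Qed.

Lemma ge0_integral_lebS d (f : vec d.+1 -> \bar R) :
  measurable_fun setT f -> (forall x, 0 <= f x)%E ->
  (\int[leb d.+1]_x f x = \int[@lebesgue_measure R]_x \int[leb d]_v f (consv (x, v)))%E.
Proof.
move=> mf f0.
rewrite [LHS](ge0_integral_pushforward (@measurable_consv d) (@lebesgue_measure R \x leb d)%E)//.
rewrite preimage_setT fubini_tonelli1//; last by move=> x; exact: f0.
by apply: measurableT_comp => //; exact: measurable_consv.
Qed.

Lemma IintE d (f : vec d -> \bar R) : measurable_fun setT f -> (forall x, 0 <= f x)%E ->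
  Iint (fun t => f (tup2row t)) = (\int[leb d]_x f x)%E.
Proof.
elim: d f => [|d IH] f mf f0.
  by rewrite integral_leb0/=; congr f; apply/rowP => -[].
rewrite ge0_integral_lebS//=; apply: eq_integral => x _.
under [in LHS]eq_fun do rewrite consv_tuple.
rewrite (IH (fun v => f (consv (x, v))))//.
apply: (measurableT_comp mf); apply: measurableT_comp; first exact: measurable_consv.
exact: measurable_pair1.
Qed.

Lemma measurable_shift1 (a : R) :
  measurable_fun setT (+%R^~ a : measurableTypeR R -> measurableTypeR R).
Proof.
suff mf : measurable_fun [set: measurableTypeR R] (fun x : measurableTypeR R => x + a : R).
  exact: mf.
exact: measurable_funD.
Qed.

Lemma lebesgue_measureD (a : R) (A : set R) : measurable A ->
  pushforward (@lebesgue_measure R) (+%R^~ a : _ -> measurableTypeR R) A = lebesgue_measure A.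
Proof.
move=> mA; apply/esym/lebesgue_measure_unique => //=.
  exact: measurable_shift1.
move=> _ _ [[x y]] _ <-; rewrite /pushforward (_ : _ @^-1` _ = `]x - a, y - a]%classic); last first.
  by apply/seteqP; split => z /=; rewrite !in_itv/= ltrBlDr lerBrDr.
rewrite !lebesgue_measure_itv/= !lte_fin ltrD2r; case: ifP => // _.
rewrite -!EFinD; congr EFin; ring.
Qed.

Lemma ge0_integral_shift1 (a : R) (f : measurableTypeR R -> \bar R) :
  measurable_fun setT f -> (forall x, 0 <= f x)%E ->
  (\int[@lebesgue_measure R]_x f (x + a)%R = \int[@lebesgue_measure R]_x f x)%E.
Proof.
move=> mf f0; have ma : measurable_fun setT (+%R^~ a : measurableTypeR R -> measurableTypeR R).
  exact: measurable_shift1.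
transitivity (\int[pushforward (@lebesgue_measure R)
    (+%R^~ a : measurableTypeR R -> measurableTypeR R)]_x f x)%E.
  by rewrite (ge0_integral_pushforward ma)//= preimage_setT.
by apply: eq_measure_integral => A mA _; exact: lebesgue_measureD.
Qed.

Lemma ge0_integral_opp1 (f : measurableTypeR R -> \bar R) :
  measurable_fun setT f -> (forall x, 0 <= f x)%E ->
  (\int[@lebesgue_measure R]_x f (- x)%R = \int[@lebesgue_measure R]_x f x)%E.
Proof.
move=> mf f0; have ma : measurable_fun setT (-%R : measurableTypeR R -> measurableTypeR R).
  suff mN : measurable_fun [set: measurableTypeR R] (fun x : measurableTypeR R => - x : R).
    exact: mN.
  exact: measurable_funN.
transitivity (\int[pushforward (@lebesgue_measure R)
    (-%R : measurableTypeR R -> measurableTypeR R)]_x f x)%E.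
  by rewrite (ge0_integral_pushforward ma)//= preimage_setT.
by apply: eq_measure_integral => A mA _; exact: lebesgue_measureN.
Qed.

Lemma measurable_addv d (a : vec d) : measurable_fun setT (+%R^~ a : vec d -> vec d).
Proof.
apply: measurable_to_vec => i; under eq_fun do rewrite mxE.
by apply: measurable_funD; [exact: measurable_coord|exact: measurable_cst].
Qed.

Lemma consvD d x y (u v : vec d) : consv (x, u) + consv (y, v) = consv (x + y, u + v).
Proof. by apply/rowP => i; rewrite !mxE; case: unliftP => //= j _; rewrite mxE. Qed.

Lemma ge0_integral_shift d (a : vec d) (f : vec d -> \bar R) :
  measurable_fun setT f -> (forall x, 0 <= f x)%E ->
  (\int[leb d]_x f (x + a)%R = \int[leb d]_x f x)%E.
Proof.
elim: d a f => [|d IH] a f mf f0.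
  by rewrite !integral_leb0; congr f; apply/rowP => -[].
have mfc : measurable_fun setT (f \o @consv d).
  by apply: measurableT_comp => //; exact: measurable_consv.
rewrite !ge0_integral_lebS//; last first.
  by apply: measurableT_comp => //; exact: measurable_addv.
rewrite -[a in LHS]unconsvK; case: (unconsv a) => a1 a' {a}.
transitivity (\int[@lebesgue_measure R]_x \int[leb d]_v f (consv ((x : R) + a1, v)%R))%E.
  apply: eq_integral => x _; under eq_integral do rewrite consvD.
  rewrite (IH a' (fun v => f (consv ((x : R) + a1, v))))//.
  exact: (measurableT_comp mfc (measurable_pair1 _)).
rewrite (ge0_integral_shift1 a1 (f := fun x => \int[leb d]_v f (consv (x, v)))%E)//.
  by apply: (measurable_fun_fubini_tonelli_F (f \o @consv d)) => // x; exact: f0.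
by move=> x; apply: integral_ge0 => v _; exact: f0.
Qed.
End Space.

(** * Completeness of L^2 *)

Section RealSequences.
Variable R : realType.

(** With D the k-th increment, (1 - 2^k |D|)^2 >= 0 gives 2 |D| <= 2^-k + 2^k D^2, so the increments
    are absolutely summable. The hypothesis involves squares because it is an L^2 bound, integrated
    over x, that will supply it. *)
Lemma cvgn_of_weighted_increments (u : nat -> R) :
  (\sum_(k <oo) ((2 ^+ k * (u k.+1 - u k) ^+ 2)%:E) < +oo)%E -> cvgn u.
Proof.
set w := fun k => 2 ^+ k * (u k.+1 - u k) ^+ 2 => wfin.
have w0 k : 0 <= w k by rewrite mulr_ge0 ?sqr_ge0 ?exprn_ge0.
set W := (\sum_(k <oo) (w k)%:E)%E in wfin.
have W0 : (0 <= W)%E by apply: nneseries_ge0 => k _ _; rewrite lee_fin.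
have Wle n : series w n <= fine W.
  rewrite -lee_fin fineK ?ge0_fin_numE// /series/= -sumEFin.
  by apply: nneseries_lim_ge => k _ _; rewrite lee_fin.
suff : cvgn (series (telescope u)).
  move=> /cvg_ex[l cl]; apply/cvg_ex; exists (u 0%N + l).
  rewrite [X in X @ _](_ : u = fun n => u 0%N + series (telescope u) n).
    by apply: cvgD => //; exact: cvg_cst.
  by apply/funext => n; exact: eq_sum_telescope.
apply: normed_cvg; apply: nondecreasing_is_cvgn.
  by apply: (@nondecreasing_series _ (fun k => `|telescope u k|) xpredT 0%N).
have half_lt1 : `|2^-1 : R| < 1 by rewrite ger0_norm ?invr_ge0// invf_lt1// ltr1n.
exists (2 + fine W) => _ [n _ <-].
apply: (@le_trans _ _ (series (geometric 1 2^-1) n + series w n)).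
  rewrite /series/= -big_split/=; apply: ler_sum => k _.
  rewrite /w /telescope /=; set D := u k.+1 - u k.
  rewrite mul1r exprVn -[X in _ * X]real_normK ?num_real//.
  have p0 : 0 < 2 ^+ k :> R by rewrite exprn_gt0.
  have : 0 <= (1 - 2 ^+ k * `|D|) ^+ 2 / 2 ^+ k by rewrite mulr_ge0 ?sqr_ge0// invr_ge0 ltW.
  have -> : (1 - 2 ^+ k * `|D|) ^+ 2 / 2 ^+ k
    = (2 ^+ k)^-1 + 2 ^+ k * `|D| ^+ 2 - 2 * `|D| by field; rewrite gt_eqF.
  by have := normr_ge0 D; lra.
rewrite lerD//; apply: (le_trans (geometric_le_lim _ _ _ _)) => //.
by rewrite (_ : 1 - 2^-1 = 2^-1) ?invrK ?mul1r//; field.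
Qed.

Lemma cvg_sqrB (u : nat -> R) (v a : R) : u k @[k --> \oo] --> v ->
  ((u k - a) ^+ 2)%:E @[k --> \oo] --> ((v - a) ^+ 2)%:E.
Proof.
move=> uv; apply: cvg_EFin; first exact: nearW.
have uB : (u k - a) @[k --> \oo] --> v - a by apply: cvgB; [exact: uv|exact: cvg_cst].
rewrite (_ : _ \o _ = (fun k => u k - a) \* (fun k => u k - a)); last first.
  by apply/funext => k; rewrite /= expr2.
by rewrite expr2; exact: cvgM.
Qed.

End RealSequences.

Section L2.
Local Open Scope ereal_scope.
Context d (T : measurableType d) (R : realType) (mu : {measure set T -> \bar R}).

Lemma ge0_integrable (h : T -> \bar R) : measurable_fun setT h -> (forall x, 0 <= h x) ->
  \int[mu]_x h x < +oo -> mu.-integrable setT h.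
Proof.
by move=> mh h0 hfin; apply/integrableP; split => //; under eq_integral do rewrite gee0_abs//.
Qed.

Lemma ge0_ae_lty (h : T -> \bar R) : measurable_fun setT h -> (forall x, 0 <= h x) ->
  \int[mu]_x h x < +oo -> {ae mu, forall x, h x < +oo}.
Proof.
move=> mh h0 hfin; have := integrable_ae measurableT (ge0_integrable mh h0 hfin); apply: filterS => x /(_ I).
by rewrite ge0_fin_numE.
Qed.

Lemma measurable_sqr (u : T -> R) : measurable_fun setT u ->
  measurable_fun setT (fun x => ((u x) ^+ 2)%:E).
Proof. by move=> mu1; apply/measurable_EFinP; exact: measurable_funX. Qed.

(** Riesz-Fischer: along a subsequence whose increments have square integral below 4^-k, the
    weighted series of [cvgn_of_weighted_increments] has a finite integral, hence is finite almost
    everywhere. Fatou's lemma carries the Cauchy bound over to the limit. *)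
Lemma L2_complete (u : nat -> T -> R) :
  (forall n, measurable_fun setT (u n)) ->
  (forall eps : R, (0 < eps)%R -> exists N, forall m n, (N <= m)%N -> (N <= n)%N ->
     \int[mu]_x ((u m x - u n x) ^+ 2)%:E < eps%:E) ->
  exists2 v : T -> R, measurable_fun setT v & forall eps : R, (0 < eps)%R ->
    exists N, forall n, (N <= n)%N -> \int[mu]_x ((v x - u n x) ^+ 2)%:E <= eps%:E.
Proof.
move=> mu_ cau.
have mD m n : measurable_fun setT (fun x => ((u m x - u n x) ^+ 2)%:E).
  by apply: measurable_sqr; exact: measurable_funB.
have /boolp.choice[N0 N0P] (k : nat) : exists N, forall m n, (N <= m)%N -> (N <= n)%N ->
    \int[mu]_x ((u m x - u n x) ^+ 2)%:E < ((4 ^+ k)^-1)%:E.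
  by apply: cau; rewrite invr_gt0 exprn_gt0.
(* The cumulative sum makes the thresholds monotone and at least [N0 k]; the successor also forces
   [k <= N k]. *)
pose N k := (\sum_(j < k.+1) (N0 j).+1)%N.
have N0N k : (N0 k <= N k)%N by rewrite /N big_ord_recr/= (leq_trans (leqnSn _))// leq_addl.
have NS k : (N k <= N k.+1)%N by rewrite /N [leqRHS]big_ord_recr leq_addr.
have kN k : (k <= N k)%N.
  by elim: k => // k IH; rewrite /N big_ord_recr/= addnS ltnS (leq_trans IH)// leq_addr.
have Nmono : {homo N : x y / (x <= y)%N} by apply: homo_leq => // a b c; exact: leq_trans.
pose h k x := (2 ^+ k * (u (N k.+1) x - u (N k) x) ^+ 2)%:E.
have h0 k x : 0 <= h k x by rewrite lee_fin mulr_ge0 ?sqr_ge0 ?exprn_ge0.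
have mh k : measurable_fun setT (h k).
  by apply/measurable_EFinP; apply: measurable_funM => //; apply/measurable_EFinP/mD.
have hfin : \int[mu]_x (\sum_(k <oo) h k x) < +oo.
  rewrite integral_nneseries//.
  apply: (@le_lt_trans _ _ (\sum_(k <oo) (2%:E * (2^-1 ^+ k.+1)%:E))).
    apply: lee_nneseries => [k _ _|k _]; first by apply: integral_ge0 => x _; exact: h0.
    rewrite /h; under eq_integral do rewrite EFinM.
    rewrite ge0_integralZl_EFin ?exprn_ge0//; last by move=> x _; rewrite lee_fin sqr_ge0.
    apply: (@le_trans _ _ ((2 ^+ k)%:E * ((4 ^+ k)^-1)%:E)).
      rewrite lee_pmul2l// ?lte_fin ?exprn_gt0//.
      by apply/ltW/N0P => //; exact: (leq_trans (N0N k)).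
    rewrite -!EFinM lee_fin exprS mulrA divff// mul1r exprVn.
    rewrite (_ : 4 = 2 * 2)%R ?exprMn ?invfM ?mulrA ?divff ?mul1r//; last by ring.
  rewrite nneseriesZl//.
    have := @cvg_geometric_eseries_half R 1%R 0%N.
    rewrite [X in X @ _ --> _ -> _](_ : _ = fun n => \sum_(0 <= k < n) (2^-1 ^+ k.+1)%:E).
      by move=> /cvg_lim-> //; rewrite -EFinM ltry.
    by apply/funext => n; rewrite /eseries/=; apply: eq_bigr => k _; rewrite addn1 mul1r natrX exprVn.
(* The upper limit is measurable whether or not the sequence converges, and it equals the limit
   wherever there is one, that is, off a null set. *)
pose v x := fine (limn_esup (fun k => (u (N k) x)%:E)).
have mv : measurable_fun setT v.
  apply: (measurableT_comp (fine_measurable measurableT)).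
  by apply: measurable_fun_limn_esup => n; exact/measurable_EFinP.
have cv : {ae mu, forall x, u (N k) x @[k --> \oo] --> v x}.
  have := ge0_ae_lty _ _ hfin; case.
  - by apply: ge0_emeasurable_sum => // k x _ _; exact: h0.
  - by move=> x; apply: nneseries_ge0 => k _ _; exact: h0.
  move=> A [mA A0 AP]; exists A; split => // x /= ncv; apply: AP => /= hx.
  apply: ncv; have /cvg_ex[l cl] := cvgn_of_weighted_increments hx.
  have /cvg_limn_einf_sup[_ ls] : (u (N k) x)%:E @[k --> \oo] --> l%:E.
    by apply: cvg_EFin; [exact: nearW|exact: cl].
  by rewrite /v ls.
exists v => // eps eps0; have [K KP] := cau _ eps0.
exists K => n Kn.
(* Almost everywhere the integrand is the lower limit of the squares along the subsequence, the form
   to which Fatou's lemma applies. *)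
apply: (@le_trans _ _ (\int[mu]_x limn_einf (fun k => ((u (N k) x - u n x) ^+ 2)%:E))).
  rewrite le_eqVlt; apply/orP; left; apply/eqP/ge0_ae_eq_integral => //.
  - by apply: measurable_sqr; exact: measurable_funB.
  - under eq_fun do rewrite -[limn_einf _]oppeK -limn_esupN.
    apply: measurableT_comp => //; apply: measurable_fun_limn_esup => k /=.
    by apply/measurable_EFinP; apply: measurable_funN; exact/measurable_EFinP/mD.
  - by move=> x _; rewrite lee_fin sqr_ge0.
  - move=> x _; rewrite limn_einf_lim; apply: lime_ge.
      exact: is_cvg_einfs.
    by apply: nearW => k; apply: le_ereal_inf_tmp => _ [j _ <-]; rewrite lee_fin sqr_ge0.
  - move: cv; apply: filterS => x cx _.
    have /cvg_limn_einf_sup[-> _] // :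
        ((u (N k) x - u n x) ^+ 2)%:E @[k --> \oo] --> ((v x - u n x) ^+ 2)%:E.
    exact: cvg_sqrB.
apply: (le_trans (fatou _ _ _ _)) => //.
  by move=> k x _; rewrite lee_fin sqr_ge0.
rewrite limn_einf_lim; apply: lime_le; first exact: is_cvg_einfs.
apply: nearW => k.
apply: (@le_trans _ _ (\int[mu]_x ((u (N (maxn k K)) x - u n x) ^+ 2)%:E)).
  by apply: ereal_inf_lbound => /=; exists (maxn k K) => //=; exact: leq_maxl.
by apply/ltW/KP => //; exact: (leq_trans (leq_maxr k K)).
Qed.
End L2.

(** * The Poisson kernel *)

Section Poisson.
Variable R : realType.
Local Notation mu := (@lebesgue_measure R).

Lemma is_derive_cast (f : R -> R) (x d d' : R) :
  is_derive x (1 : R) f d -> d = d' -> is_derive x (1 : R) f d'.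
Proof. by move=> h <-. Qed.

Lemma is_derive_mull (k w : R) : is_derive w (1 : R) (fun x : R => k * x) k.
Proof.
have h : is_derive w (1 : R) (fun x : R => k *: x) (k *: 1) by exact: is_deriveZ.
by apply: (is_derive_cast h); rewrite /GRing.scale/= mulr1.
Qed.

Lemma is_derive_expR_mull (k w : R) :
  is_derive w (1 : R) (fun x : R => expR (k * x)) (k * expR (k * w)).
Proof.
have h := @is_derive1_comp R expR (fun x => k * x) w _ _ (is_derive_expR _) (is_derive_mull k w).
by apply: (is_derive_cast h); rewrite mulrC.
Qed.

Lemma is_derive_cos_mull (k w : R) :
  is_derive w (1 : R) (fun x : R => cos (k * x)) (- k * sin (k * w)).
Proof.
have h := @is_derive1_comp R (@cos R) (fun x => k * x) w _ _ (is_derive_cos _) (is_derive_mull k w).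
by apply: (is_derive_cast h); ring.
Qed.

Lemma is_derive_sin_mull (k w : R) :
  is_derive w (1 : R) (fun x : R => sin (k * x)) (k * cos (k * w)).
Proof.
have h := @is_derive1_comp R (@sin R) (fun x => k * x) w _ _ (is_derive_sin _) (is_derive_mull k w).
by apply: (is_derive_cast h); ring.
Qed.

Lemma is_derive_atan_mull (k w : R) :
  is_derive w (1 : R) (fun x : R => atan (k * x)) (k / (1 + (k * w) ^+ 2)).
Proof.
have h := @is_derive1_comp R (@atan R) (fun x => k * x) w _ _ (is_derive1_atan _) (is_derive_mull k w).
by apply: (is_derive_cast h); ring.
Qed.

Lemma is_derive_continuous (f : R -> R) (df : R -> R) :
  (forall x, is_derive x (1 : R) f (df x)) -> continuous f.
Proof.
by move=> h x; apply: differentiable_continuous; apply/derivable1_diffP; exact: ex_derive.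
Qed.

Lemma ge0_FTC2y (f F : R -> R) (a l : R) : (forall x, 0 <= f x) -> continuous f ->
  (forall x, is_derive x (1 : R) F (f x)) -> F x @[x --> +oo%R] --> l ->
  (\int[mu]_(x in `[a, +oo[) (f x)%:E = (l - F a)%:E)%E.
Proof.
move=> f0 cf dF Fl; have cF := is_derive_continuous dF.
rewrite EFinB; apply: ge0_continuous_FTC2y => //.
- by apply: continuous_subspaceT.
- by apply: cvg_at_right_filter; exact: cF.
- by move=> x _; rewrite derive1E; exact: derive_val.
Qed.

Lemma continuous_mull (k : R) : continuous (fun x : R => k * x).
Proof. exact: (is_derive_continuous (is_derive_mull k)). Qed.

Lemma cvg_expR_mulNy (e : R) : 0 < e -> expR (- e * x) @[x --> +oo%R] --> (0 : R).
Proof.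
move=> e0; have h : (e * x) @[x --> +oo%R] --> +oo%R by apply: gt0_cvgMry => //; exact: cvg_id.
rewrite (_ : (fun x => _) = (fun x => expR (- x)) \o (fun x => e * x)); last first.
  by apply/funext => x; rewrite /= mulNr.
by apply: (cvg_comp _ _ h); exact: cvgr_expR.
Qed.

Section kernel.
Variables (e : R) (e0 : 0 < e).

Lemma integral_exp_half : (\int[mu]_(x in `[0%R, +oo[) (expR (- e * x))%:E = (e^-1)%:E)%E.
Proof.
transitivity ((0 - (- e^-1 * expR (- e * 0)))%:E); last first.
  by congr EFin; rewrite mulr0 expR0; ring.
apply: (@ge0_FTC2y _ (fun x => - e^-1 * expR (- e * x))).
- by move=> x; exact: expR_ge0.
- exact: (is_derive_continuous (is_derive_expR_mull (- e))).
- move=> x; have h : is_derive x (1 : R) (fun x : R => - e^-1 *: expR (- e * x))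
    (- e^-1 *: (- e * expR (- e * x))).
    by apply: is_deriveZ; exact: is_derive_expR_mull.
  apply: (is_derive_cast h); rewrite /GRing.scale/=.
  by field; rewrite gt_eqF.
- rewrite -[X in _ --> X](mulr0 (- e^-1)).
  by apply: cvgMl_tmp; exact: cvg_expR_mulNy.
Qed.

Variable b : R.
Let q := e ^+ 2 + b ^+ 2.
Let q0 : 0 < q. Proof. by rewrite ltr_wpDr ?sqr_ge0// exprn_gt0. Qed.

(** Adding 1 to the cosine keeps the integrand nonnegative, as [ge0_FTC2y] demands;
    [integral_expabs_cos] recovers the cosine alone by subtraction. *)
Lemma integral_exp_cos_half :
  (\int[mu]_(x in `[0%R, +oo[) (expR (- e * x) * (1 + cos (b * x)))%:E = (e^-1 + e / q)%:E)%E.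
Proof.
pose F x := - e^-1 * expR (- e * x) + expR (- e * x) * (q^-1 * (b * sin (b * x) - e * cos (b * x))).
have cexp := is_derive_continuous (is_derive_expR_mull (- e)).
have ccos := is_derive_continuous (is_derive_cos_mull b).
have csin := is_derive_continuous (is_derive_sin_mull b).
transitivity ((0 - F 0)%:E).
  apply: ge0_FTC2y.
  - by move=> x; rewrite mulr_ge0 ?expR_ge0// -lerBlDl sub0r cos_geN1.
  - move=> x; apply: cvgM; first exact: cexp.
    by apply: cvgD; [exact: cvg_cst|exact: ccos].
  - move=> x; have h1 : is_derive x (1 : R) (fun x : R => - e^-1 *: expR (- e * x))
      (- e^-1 *: (- e * expR (- e * x))).
      by apply: is_deriveZ; exact: is_derive_expR_mull.
    have h2 : is_derive x (1 : R) (fun x : R => (q^-1 *: (b *: sin (b * x) - e *: cos (b * x))))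
       (q^-1 *: (b *: (b * cos (b * x)) - e *: (- b * sin (b * x)))).
      apply: is_deriveZ; apply: is_deriveB; apply: is_deriveZ.
        exact: is_derive_sin_mull.
      exact: is_derive_cos_mull.
    have h3 := is_deriveD h1 (is_deriveM (is_derive_expR_mull (- e) x) h2).
    apply: (is_derive_cast h3); rewrite /GRing.scale/=.
    have := q0; rewrite /q => q0'; field; by rewrite !gt_eqF.
  - rewrite -[X in _ --> X](addr0 0); apply: cvgD.
      rewrite -[X in _ --> X](mulr0 (- e^-1)).
      by apply: cvgMl_tmp; exact: cvg_expR_mulNy.
    apply/cvgr0Pnorm_lt => eps eps0.
    have B0 : 0 < q^-1 * (`|b| + e) by rewrite mulr_gt0 ?invr_gt0// ltr_wpDl.
    have := cvg_expR_mulNy e0 => /cvgr0Pnorm_lt /(_ (eps / (q^-1 * (`|b| + e)))).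
    rewrite divr_gt0// => /(_ isT); apply: filterS => x.
    rewrite ltr_pdivlMr//; apply: le_lt_trans; rewrite normrM ler_wpM2l// normrM.
    rewrite ger0_norm ?invr_ge0 ?(ltW q0)// ler_wpM2l ?invr_ge0 ?(ltW q0)//.
    rewrite (le_trans (ler_normB _ _))// lerD// normrM ?(gtr0_norm e0).
      by rewrite ler_piMr// ler_norml sin_geN1 sin_le1.
    by rewrite ler_piMr ?(ltW e0)// ler_norml cos_geN1 cos_le1.
by congr EFin; rewrite /F !mulr0 expR0 sin0 cos0; ring.
Qed.

Let W (w : R) : R := expR (- e * `|w|).

Let cW : continuous W.
Proof.
move=> x; apply: (@continuous_comp _ _ _ (fun x : R => `|x|) (fun x => expR (- e * x))).
  exact: norm_continuous.
exact: (is_derive_continuous (is_derive_expR_mull (- e))).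
Qed.

Let cWc : continuous (fun w => W w * (1 + cos (b * w))).
Proof.
move=> x; apply: cvgM; first exact: cW.
by apply: cvgD; [exact: cvg_cst|exact: (is_derive_continuous (is_derive_cos_mull b))].
Qed.

Let pos_half (f g : R -> R) : (forall x, 0 <= x -> f x = g x) ->
  (\int[mu]_(x in [set x | (0 <= x)%R]) (f x)%:E = \int[mu]_(x in `[0%R, +oo[) (g x)%:E)%E.
Proof.
move=> fg; rewrite set_itvcy; apply: eq_integral => x; rewrite inE/= => x0.
by rewrite fg.
Qed.

Lemma integral_expabs : (\int[mu]_w (W w)%:E = (2 / e)%:E)%E.
Proof.
rewrite ge0_symfun_integralT//.
- rewrite (pos_half (g := fun w => expR (- e * w))) ?integral_exp_half -?EFinM//.
  by move=> x x0; rewrite /W ger0_norm.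
- by move=> x; exact: expR_ge0.
- by move=> x; rewrite /= /W normrN.
Qed.

Lemma integral_expabs_1cos :
  (\int[mu]_w (W w * (1 + cos (b * w)))%:E = (2 / e + 2 * e / q)%:E)%E.
Proof.
rewrite ge0_symfun_integralT//.
- rewrite (pos_half (g := fun w => expR (- e * w) * (1 + cos (b * w)))).
    by rewrite integral_exp_cos_half -EFinM; congr EFin; ring.
  by move=> x x0; rewrite /W ger0_norm.
- by move=> x; rewrite mulr_ge0 ?expR_ge0// -lerBlDl sub0r cos_geN1.
- by move=> x; rewrite /= /W normrN mulrN cosN.
Qed.

Lemma integrable_expabs : mu.-integrable setT (EFin \o W).
Proof.
apply/integrableP; split; first by apply/measurable_EFinP; exact: continuous_measurable_fun.
under eq_integral do rewrite /= ger0_norm ?expR_ge0//.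
by rewrite integral_expabs ltry.
Qed.

Lemma integral_expabs_cos :
  (\int[mu]_w (W w * cos (b * w))%:E = (2 * e / q)%:E)%E.
Proof.
have iWc : mu.-integrable setT (fun w => (W w * (1 + cos (b * w)))%:E).
  apply/integrableP; split; first by apply/measurable_EFinP; exact: continuous_measurable_fun.
  under eq_integral do rewrite /= ger0_norm ?mulr_ge0 ?expR_ge0 -?[0 <= 1 + _]lerBlDl ?sub0r ?cos_geN1//.
  by rewrite integral_expabs_1cos ltry.
transitivity (\int[mu]_w ((W w * (1 + cos (b * w)))%:E - (W w)%:E))%E.
  by apply: eq_integral => w _; rewrite -EFinB mulrDr mulr1 addrAC subrr add0r.
rewrite integralB//; last exact: integrable_expabs.
by rewrite integral_expabs_1cos integral_expabs -EFinB addrAC subrr add0r.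
Qed.

End kernel.

(** The Poisson kernel: by [integral_expabs_cos] with b = 2 pi u, it is the Fourier transform at [u]
    of the damping factor e^(-e|w|). It has mass 1 and concentrates at 0 as [e] tends to 0. *)
Definition poisson (e u : R) : R := 2 * e / (e ^+ 2 + (2 * pi * u) ^+ 2).

Lemma poisson_ge0 (e u : R) : 0 < e -> 0 <= poisson e u.
Proof. by move=> e0; rewrite divr_ge0 ?mulr_ge0 ?addr_ge0 ?sqr_ge0 ?ltW. Qed.

Lemma poissonN (e u : R) : poisson e (- u) = poisson e u.
Proof. by rewrite /poisson mulrN sqrrN. Qed.

Lemma is_derive_poisson (e u : R) : 0 < e ->
  is_derive u (1 : R) (fun u => pi^-1 * atan ((2 * pi / e) * u)) (poisson e u).
Proof.
move=> e0; have h : is_derive u (1 : R) (fun u => pi^-1 *: atan ((2 * pi / e) * u))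
    (pi^-1 *: ((2 * pi / e) / (1 + ((2 * pi / e) * u) ^+ 2))).
  by apply: is_deriveZ; exact: is_derive_atan_mull.
apply: (is_derive_cast h); rewrite /GRing.scale/= /poisson.
have := @pi_gt0 R; move: (pi : R) => p p0.
have q1 : 0 < e ^+ 2 + (2 * p * u) ^+ 2 by rewrite ltr_wpDr ?sqr_ge0// exprn_gt0.
by field; rewrite ?gt_eqF//= ltr_wpDr ?sqr_ge0// exprn_gt0.
Qed.

Lemma continuous_poisson (e : R) : 0 < e -> continuous (poisson e).
Proof.
move=> e0 u; have q0 : e ^+ 2 + (2 * pi * u) ^+ 2 != 0.
  by rewrite gt_eqF// ltr_wpDr ?sqr_ge0// exprn_gt0.
apply: cvgM; first exact: cvg_cst.
apply: cvgV => //; apply: cvgD; first exact: cvg_cst.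
apply: (@continuous_comp _ _ _ (fun u : R => 2 * pi * u) (fun y : R => y ^+ 2)).
  exact: continuous_mull.
exact: exprn_continuous.
Qed.

Lemma integral_poisson_half (e a : R) : 0 < e ->
  (\int[mu]_(u in `[a, +oo[) (poisson e u)%:E =
     (2^-1 - pi^-1 * atan ((2 * pi / e) * a))%:E)%E.
Proof.
move=> e0; apply: (@ge0_FTC2y _ (fun u => pi^-1 * atan ((2 * pi / e) * u))).
- by move=> x; exact: poisson_ge0.
- exact: continuous_poisson.
- by move=> x; exact: is_derive_poisson.
- rewrite (_ : 2^-1 = pi^-1 * (pi / 2)); last first.
    by have := @pi_gt0 R; move: (pi : R) => p p0; field; rewrite gt_eqF.
  apply: cvgMl_tmp; apply: (@cvg_comp _ _ _ (fun u : R => (2 * pi / e) * u) (@atan R) _ +oo%R).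
    by apply: gt0_cvgMry; [rewrite divr_gt0 ?mulr_gt0 ?pi_gt0|exact: cvg_id].
  exact: cvgy_atan.
Qed.

Lemma integral_poisson (e : R) : 0 < e -> (\int[mu]_u (poisson e u)%:E = 1)%E.
Proof.
move=> e0; rewrite ge0_symfun_integralT//.
- rewrite -set_itvcy integral_poisson_half// mulr0 atan0 mulr0 subr0 -EFinM.
  by congr EFin; field.
- by move=> x; exact: poisson_ge0.
- exact: continuous_poisson.
- by move=> x /=; rewrite poissonN.
Qed.

Lemma measurable_poisson (e : R) : 0 < e -> measurable_fun setT (poisson e).
Proof. by move=> e0; apply: continuous_measurable_fun; exact: continuous_poisson. Qed.

End Poisson.

(** * Continuity of translations in L^2 *)

Section TranslationContinuity.
Variable R : realType.
Local Notation mu := (@lebesgue_measure R).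
Local Notation T1 := (measurableTypeR R).
Implicit Types (a b : T1 -> R) (u : R).

Definition sqnorm a : \bar R := (\int[mu]_x ((a x) ^+ 2)%:E)%E.
Definition transl_dist a u : \bar R := (\int[mu]_x ((a ((x : R) + u)%R - a x) ^+ 2)%:E)%E.

Lemma measurable_translr a u : measurable_fun setT a ->
  measurable_fun setT (fun x : T1 => a ((x : R) + u)).
Proof. by move=> ma; apply: (measurableT_comp ma); exact: measurable_shift1. Qed.

Lemma measurable_transl_dist a u : measurable_fun setT a ->
  measurable_fun setT (fun x : T1 => ((a ((x : R) + u)%R - a x) ^+ 2)%:E).
Proof.
by move=> ma; apply: measurable_sqr; apply: measurable_funB => //; exact: measurable_translr.
Qed.

Lemma sqnorm_transl a u : measurable_fun setT a ->
  (\int[mu]_x ((a ((x : R) + u)%R) ^+ 2)%:E = sqnorm a)%E.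
Proof.
move=> ma; rewrite /sqnorm -(ge0_integral_shift1 u (f := fun x => ((a x) ^+ 2)%:E))//.
- exact: measurable_sqr.
- by move=> x; rewrite lee_fin sqr_ge0.
Qed.

Lemma transl_distD a b u : measurable_fun setT a -> measurable_fun setT b ->
  (transl_dist (fun x => a x + b x)%R u <= 2%:E * transl_dist a u + 2%:E * transl_dist b u)%E.
Proof.
move=> ma mb; rewrite -!ge0_integralZl_EFin//=; first last.
- exact: measurable_transl_dist.
- by move=> x _; rewrite lee_fin sqr_ge0.
- exact: measurable_transl_dist.
- by move=> x _; rewrite lee_fin sqr_ge0.
rewrite -ge0_integralD//; first last.
- by apply: measurable_funeM; exact: measurable_transl_dist.
- by move=> x _; rewrite -EFinM lee_fin mulr_ge0 ?sqr_ge0.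
- by apply: measurable_funeM; exact: measurable_transl_dist.
- by move=> x _; rewrite -EFinM lee_fin mulr_ge0 ?sqr_ge0.
apply: ge0_le_integral => //.
- by move=> x _; rewrite lee_fin sqr_ge0.
- by apply: measurable_transl_dist; exact: measurable_funD.
- by apply: emeasurable_funD; apply: measurable_funeM; exact: measurable_transl_dist.
move=> x _; rewrite -!EFinM -EFinD lee_fin.
set p := a (x + u) - a x; set q := b (x + u) - b x.
have -> : a (x + u) + b (x + u) - (a x + b x) = p + q by rewrite /p /q; ring.
by rewrite -subr_ge0 (_ : _ - _ = (p - q) ^+ 2) ?sqr_ge0//; ring.
Qed.

Lemma transl_dist_le a u : measurable_fun setT a -> (transl_dist a u <= 4%:E * sqnorm a)%E.
Proof.
move=> ma; have msq := measurable_sqr ma.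
have msu := measurable_sqr (measurable_translr u ma).
have -> : (4%:E * sqnorm a = 2%:E * (\int[mu]_x ((a ((x : R) + u)%R) ^+ 2)%:E) + 2%:E * sqnorm a)%E.
  rewrite sqnorm_transl// -ge0_muleDl ?lee_fin// -EFinD.
  by congr (_%:E * _)%E; ring.
rewrite -!ge0_integralZl_EFin//; try by move=> x _; rewrite lee_fin sqr_ge0.
rewrite -ge0_integralD//; first last.
- exact: measurable_funeM.
- by move=> x _; rewrite -EFinM lee_fin mulr_ge0 ?sqr_ge0.
- exact: measurable_funeM.
- by move=> x _; rewrite -EFinM lee_fin mulr_ge0 ?sqr_ge0.
apply: ge0_le_integral => //.
- by move=> x _; rewrite lee_fin sqr_ge0.
- exact: measurable_transl_dist.
- by apply: emeasurable_funD; exact: measurable_funeM.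
move=> x _; rewrite -!EFinM -EFinD lee_fin.
by rewrite -subr_ge0 (_ : _ - _ = (a (x + u) + a x) ^+ 2) ?sqr_ge0//; ring.
Qed.

Definition transl_continuous a := measurable_fun setT a /\ forall eps : R, 0 < eps ->
  exists2 eta : R, 0 < eta & forall u, `|u| < eta -> (transl_dist a u <= eps%:E)%E.

Lemma transl_continuousD a b : transl_continuous a -> transl_continuous b ->
  transl_continuous (fun x => a x + b x).
Proof.
move=> [ma ca] [mb cb]; split; first exact: measurable_funD.
move=> eps eps0; have eps4 : 0 < eps / 4 by rewrite divr_gt0.
have [e1 e10 h1] := ca _ eps4; have [e2 e20 h2] := cb _ eps4.
exists (Num.min e1 e2); first by rewrite lt_min e10 e20.
move=> u; rewrite lt_min => /andP[u1 u2]; apply: (le_trans (transl_distD _ ma mb)).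
have -> : (eps%:E = 2%:E * (eps / 4)%:E + 2%:E * (eps / 4)%:E)%E.
  by rewrite -!EFinM -EFinD; congr EFin; field.
by apply: leeD; apply: lee_wpmul2l => //; [exact: h1|exact: h2].
Qed.

Lemma transl_continuousZ (k : R) a : transl_continuous a -> transl_continuous (fun x => k * a x).
Proof.
move=> [ma ca]; split; first exact: measurable_funM.
move=> eps eps0; have k1 : 0 < k ^+ 2 + 1 by rewrite ltr_wpDl ?sqr_ge0.
have [|e e0 h] := ca (eps / (k ^+ 2 + 1)); first by rewrite divr_gt0.
exists e => // u ue; rewrite /transl_dist.
under eq_integral do rewrite -mulrBr exprMn EFinM.
rewrite ge0_integralZl_EFin ?sqr_ge0//; last 2 first.
- by move=> x _; rewrite lee_fin sqr_ge0.
- exact: measurable_transl_dist.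
apply: (@le_trans _ _ ((k ^+ 2)%:E * (eps / (k ^+ 2 + 1))%:E)%E).
  by rewrite lee_wpmul2l ?lee_fin ?sqr_ge0//; exact: h.
rewrite -EFinM lee_fin mulrCA ler_piMr ?(ltW eps0)//.
by rewrite ler_pdivrMr// mul1r lerDl.
Qed.

(** The approximation error stays small under every translation, by [transl_dist_le], so only the
    translates of the approximant have to be controlled. *)
Lemma transl_continuous_closed a : measurable_fun setT a ->
  (forall eps : R, 0 < eps -> exists2 b, transl_continuous b &
     (sqnorm (fun x => a x - b x)%R <= eps%:E)%E) ->
  transl_continuous a.
Proof.
move=> ma h; split=> // eps eps0.
(* The error of approximation is multiplied by 2 in [transl_distD] and by 4 in [transl_dist_le]; 16
   leaves eps / 2 for it. *)
have [|b [mb cb] ab] := h (eps / 16); first by rewrite divr_gt0.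
have [|e e0 he] := cb (eps / 4); first by rewrite divr_gt0.
exists e => // u ue.
have mab : measurable_fun setT (fun x => a x - b x) by exact: measurable_funB.
have -> : a = (fun x => b x + (a x - b x)).
  by apply/funext => x; rewrite addrC subrK.
apply: (le_trans (transl_distD _ mb mab)).
have -> : (eps%:E = 2%:E * (eps / 4)%:E + 2%:E * (4%:E * (eps / 16)%:E))%E.
  by rewrite -!EFinM -EFinD; congr EFin; field.
apply: leeD; apply: lee_wpmul2l => //; first exact: he.
by apply: (le_trans (transl_dist_le _ mab)); rewrite lee_wpmul2l.
Qed.

(** A tube-lemma argument: addition is continuous at each (x, 0) with x in K, and compactness makes
    the admissible range of [u] uniform in x. *)
Lemma compact_subset_translate (K V : set R) : compact K -> open V -> K `<=` V ->
  exists2 eta : R, 0 < eta & forall u, `|u| < eta -> forall x, K x -> V (x + u).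
Proof.
move=> /compact_near_coveringP cK oV KV.
have : \forall u \near (0 : R), K `<=` (fun x => V (x + u)).
  apply: (cK R (nbhs (0 : R)) (fun u x => V (x + u))) => x Kx; have : (fun z : R * R => z.1 + z.2) z @[z --> (x, 0 : R)] --> x + 0.
    by apply: cvgD; [exact: cvg_fst|exact: cvg_snd].
  by rewrite addr0 => /(_ V); apply; apply: open_nbhs_nbhs; split => //; exact: KV.
move=> /nbhs_ballP[eta /= eta0 h]; exists eta => // u ue x Kx; apply: (h u) => //.
by rewrite /ball/= sub0r normrN.
Qed.
(** Choose an open V around K with V \ K of measure below eps / 2. For small [u], if exactly one of
    [x] and [x + u] is in K, the other one is in V \ K, so the distance is at most twice the measure
    of V \ K. *)
Lemma transl_continuous_compact (K : set R) : compact K -> transl_continuous (\1_K : T1 -> R).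
Proof.
move=> cK; have mK : measurable (K : set T1) by exact: compact_measurable.
split; first exact: measurable_indic.
move=> eps eps0; have [|V [oV KV VK]] := lebesgue_regularity_outer (eps := eps / 2) mK (compact_finite_measure cK).
  by rewrite divr_gt0.
have [eta eta0 h] := compact_subset_translate cK oV KV.
have mVK : measurable (V `\` K : set T1) by apply: measurableD => //; exact: open_measurable.
have mi : measurable_fun setT (\1_(V `\` K) : T1 -> R) by exact: measurable_indic.
exists eta => // u ue.
apply: (@le_trans _ _ (\int[mu]_x ((\1_(V `\` K) (x : R))%:E + (\1_(V `\` K) ((x : R) + u)%R)%:E))%E).
  apply: ge0_le_integral => //.
  - by move=> x _; rewrite lee_fin sqr_ge0.
  - by apply: measurable_transl_dist; exact: measurable_indic.
  - apply: emeasurable_funD; apply/measurable_EFinP => //.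
    exact: (@measurable_translr (\1_(V `\` K))).
  move=> x _; rewrite -EFinD lee_fin !indicE !in_setD.
  have [xK|xK] := boolP (x \in K); have [yK|yK] := boolP (x + u \in K) => //=;
    rewrite ?andbF ?andbT ?subrr ?expr0n ?sub0r ?subr0 ?sqrrN ?expr1n ?addr0 ?add0r ?ler01 ?addr_ge0//.
  - by rewrite mem_set//; apply: h => //; exact: set_mem.
  - rewrite mem_set//; rewrite -[x](addrK u); apply: (h (- u)); first by rewrite normrN.
    exact: set_mem.
rewrite ge0_integralD//=; first last.
- by apply/measurable_EFinP; exact: (@measurable_translr (\1_(V `\` K))).
- exact/measurable_EFinP.
rewrite (ge0_integral_shift1 u (f := fun x => (\1_(V `\` K) x)%:E))//; last first.
  exact/measurable_EFinP.
rewrite integral_indic// setIT [eps in leRHS]splitr EFinD.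
by apply: leeD; exact: ltW.
Qed.

Lemma transl_continuous_indic (A : set T1) : measurable A -> (mu A < +oo)%E ->
  transl_continuous (\1_A : T1 -> R).
Proof.
move=> mA Afin; apply: transl_continuous_closed; first exact: measurable_indic.
move=> eps eps0; have [K [cK KA AK]] := lebesgue_regularity_inner mA Afin eps0.
exists (\1_K); first exact: transl_continuous_compact.
have mK : measurable (K : set T1) by exact: compact_measurable.
rewrite /sqnorm (_ : (\int[mu]_x _)%E = mu (A `\` K)); first exact: ltW.
transitivity (\int[mu]_x (\1_(A `\` K) x)%:E)%E; last first.
  by rewrite integral_indic// ?setIT//; exact: measurableD.
apply: eq_integral => x _; rewrite !indicE in_setD.
have [xK|xK] := boolP (x \in K); last by rewrite subr0; case: (x \in A); rewrite /= ?expr1n ?expr0n.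
have -> : x \in A by apply/mem_set/KA/set_mem.
by rewrite subrr expr0n.
Qed.

Import HBNNSimple.

Lemma transl_continuous_nnsfun (f : {nnsfun T1 >-> R}) : (sqnorm f < +oo)%E -> transl_continuous f.
Proof.
move=> ffin; have mf r : measurable (f @^-1` [set r]) by rewrite -[X in measurable X]setTI; exact: measurable_funP.
have h r : transl_continuous (fun x => r * \1_(f @^-1` [set r]) x).
  (* The level set of 0 may have infinite measure, so its term is rewritten with the empty set; the
     other level sets have finite measure by Chebyshev's inequality. *)
  have [->|r0] := eqVneq r 0.
    rewrite (_ : (fun x => _) = (fun x => 0 * (\1_(set0 : set T1) x))).
      by apply: transl_continuousZ; apply: transl_continuous_indic; rewrite ?measure0.
    by apply/funext => x; rewrite !mul0r.
  apply: transl_continuousZ; apply: transl_continuous_indic => //.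
  have r20 : 0 < r ^+ 2 by rewrite exprn_even_gt0.
  rewrite -(@lte_pmul2l _ (r ^+ 2)%:E) ?lte_fin//; rewrite gt0_muley ?lte_fin//.
  apply: le_lt_trans ffin.
  have -> : mu (f @^-1` [set r]) = (\int[mu]_x (\1_(f @^-1` [set r]) x)%:E)%E.
    by rewrite integral_indic// setIT.
  rewrite -ge0_integralZl_EFin ?sqr_ge0//; last by apply/measurable_EFinP/measurable_indic.
  apply: ge0_le_integral => //.
  - by move=> x _; rewrite lee_fin mulr_ge0 ?sqr_ge0.
  - by apply/measurable_EFinP; apply: measurable_funM => //; exact: measurable_indic.
  - by apply: measurable_sqr.
  move=> x _; rewrite lee_fin indicE.
  by case: (boolP (x \in _)) => [/set_mem/= ->|_]; rewrite ?mulr1 ?mulr0 ?sqr_ge0.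
rewrite (_ : (f : T1 -> R) = fun x => \sum_(r <- finmap.enum_fset (fset_set (range f))) r * \1_(f @^-1` [set r]) x); last first.
  by apply/funext => x; rewrite [LHS]fimfunE fsbig_finite.
elim: (finmap.enum_fset _) => [|r s IH].
  rewrite (_ : (fun x => _) = (fun x => 0 * (\1_(f @^-1` [set 0]) x))).
    exact: h.
  by apply/funext => x; rewrite big_nil mul0r.
rewrite (_ : (fun x => _) = (fun x => r * \1_(f @^-1` [set r]) x + \sum_(j <- s) j * \1_(f @^-1` [set j]) x)).
  exact: transl_continuousD.
by apply/funext => x; rewrite big_cons.
Qed.

Lemma transl_continuous_ge0 a : measurable_fun setT a -> (forall x, 0 <= a x) ->
  (sqnorm a < +oo)%E -> transl_continuous a.
Proof.
move=> ma a0 afin; have mE : measurable_fun setT (EFin \o a) by exact/measurable_EFinP.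
pose f := nnsfun_approx measurableT mE.
have fa n x : f n x <= a x.
  by rewrite -lee_fin /f nnsfun_approxE; apply: le_approx => // y _; rewrite lee_fin.
have fc x : f n x @[n --> \oo] --> a x.
  have /fine_cvg/= := @cvg_nnsfun_approx _ _ _ _ measurableT _ mE (fun x _ => a0 x) x I.
  by [].
have fin n : (sqnorm (f n) < +oo)%E.
  apply: le_lt_trans afin; apply: ge0_le_integral => //.
  - by move=> x _; rewrite lee_fin sqr_ge0.
  - exact: measurable_sqr.
  - exact: measurable_sqr.
  by move=> x _; rewrite lee_fin lerXn2r ?nnegrE.
apply: transl_continuous_closed => // eps eps0.
have : (sqnorm (fun x => a x - f n x)%R @[n --> \oo] --> 0%E).
  rewrite -(integral0 mu setT); apply: (@dominated_cvg _ _ _ mu setT measurableT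
    (fun n x => ((a x - f n x) ^+ 2)%:E) (cst 0%E) (fun x => ((a x) ^+ 2)%:E)) => //.
  - by move=> n; apply: measurable_sqr; exact: measurable_funB.
  - move=> x _; have := @cvg_sqrB _ (fun n => f n x) _ (a x) (fc x).
    rewrite subrr expr0n /=; under eq_fun do rewrite -sqrrN opprB.
    by [].
  - apply/integrableP; split; first exact: measurable_sqr.
    by under eq_integral do rewrite gee0_abs ?lee_fin ?sqr_ge0//.
  - move=> n x _; rewrite gee0_abs ?lee_fin ?sqr_ge0// lerXn2r ?nnegrE ?subr_ge0//.
    by rewrite lerBlDr lerDl; exact: fun_ge0.
move=> /(_ _ (open_ereal_lt' (x := 0%E) (y := eps%:E) _)) /=; rewrite lte_fin => /(_ eps0).
case=> N _ /(_ N (leqnn N))/= hN; exists (f N); last exact: ltW.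
exact: transl_continuous_nnsfun.
Qed.

Lemma transl_continuous_L2 a : measurable_fun setT a -> (sqnorm a < +oo)%E -> transl_continuous a.
Proof.
move=> ma afin.
have h b : measurable_fun setT b -> (forall x, `|b x| = `|a x|) -> transl_continuous (fun x => Num.max (b x) 0).
  move=> mb ba; apply: transl_continuous_ge0.
  - by apply: measurable_maxr.
  - by move=> x; rewrite le_max lexx orbT.
  apply: le_lt_trans afin; apply: ge0_le_integral => //.
  - by move=> x _; rewrite lee_fin sqr_ge0.
  - by apply: measurable_sqr; exact: measurable_maxr.
  - exact: measurable_sqr.
  move=> x _; rewrite lee_fin -[leRHS]real_normK ?num_real// -ba real_normK ?num_real//.
  by case: (leP (b x) 0) => _; rewrite ?expr0n/= ?sqr_ge0.
have -> : a = (fun x => Num.max (a x) 0 + (- 1) * Num.max (- a x) 0).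
  by apply/funext => x; case: (leP (a x) 0) => ax; case: (leP (- a x) 0); lra.
apply: transl_continuousD; first exact: h.
apply: transl_continuousZ; apply: (h (fun x => - a x)); first exact: measurable_funN.
by move=> x; rewrite normrN.
Qed.
End TranslationContinuity.

(** * The Plancherel identity on the line *)

Section IntegralProduct.
Local Open Scope ereal_scope.
Context {d1 d2 : measure_display} {T1 : measurableType d1} {T2 : measurableType d2}
  {R : realType}.
Variables (m1 : {sigma_finite_measure set T1 -> \bar R})
  (m2 : {sigma_finite_measure set T2 -> \bar R}).

Lemma integrable_prod (f : T1 -> R) (g : T2 -> R) :
  m1.-integrable setT (EFin \o f) -> m2.-integrable setT (EFin \o g) ->
  (prodm m1 m2).-integrable setT (fun z => (f z.1 * g z.2)%:E).
Proof.
move=> intf intg; have mf : measurable_fun setT f by apply/measurable_EFinP; case/integrableP: intf.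
have mg : measurable_fun setT g by apply/measurable_EFinP; case/integrableP: intg.
apply/integrable12ltyP.
  apply/measurable_EFinP; apply: measurable_funM; first exact: (measurableT_comp mf).
  exact: (measurableT_comp mg).
under eq_integral => x _.
  under eq_integral do rewrite /= normrM EFinM.
  rewrite ge0_integralZl_EFin//; last by apply/measurable_EFinP; exact: measurableT_comp.
  over.
case/integrableP: intf => _ /= intf; case/integrableP: intg => mg' /= intg.
rewrite ge0_integralZr//; first by rewrite lte_mul_pinfty// ?integral_ge0// ge0_fin_numE// integral_ge0.
- by apply/measurable_EFinP; exact: measurableT_comp.
- exact: integral_ge0.
Qed.

Lemma integral_prod (f : T1 -> R) (g : T2 -> R) :
  m1.-integrable setT (EFin \o f) -> m2.-integrable setT (EFin \o g) ->
  \int[prodm m1 m2]_z (f z.1 * g z.2)%:E = ((\int[m1]_x f x) * (\int[m2]_y g y))%R%:E.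
Proof.
move=> intf intg; rewrite -[LHS]integral12_prod_meas1; last exact: integrable_prod.
have fing : \int[m2]_y (g y)%:E \is a fin_num by exact: integrable_fin_num.
have finf : \int[m1]_y (f y)%:E \is a fin_num by exact: integrable_fin_num.
transitivity (\int[m1]_x ((\int[m2]_y g y)%R%:E * (f x)%:E)).
  apply: eq_integral => x _; rewrite /fubini_F/=.
  under eq_integral do rewrite EFinM.
  by rewrite integralZl// /Rintegral fineK// muleC.
by rewrite integralZl// -(fineK finf) -EFinM mulrC.
Qed.

(** No integrability is assumed: the integrals of the positive and negative parts are measurable by
    Tonelli, and [fine] is measurable. *)
Lemma measurable_Rintegral (f : T1 * T2 -> R) : measurable_fun setT f ->
  measurable_fun setT (fun x => \int[m2]_y f (x, y))%R.
Proof.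
move=> mf; apply: (measurableT_comp (fine_measurable measurableT)).
rewrite (_ : (fun x => _) = (fun x => \int[m2]_y (EFin \o f)^\+ (x, y) - \int[m2]_y (EFin \o f)^\- (x, y))); last first.
  apply/funext => x; rewrite [LHS]integralE; congr (_ - _); apply: eq_integral => y _.
    by rewrite !funeposE.
  by rewrite !funenegE.
apply: emeasurable_funB; apply: measurable_fun_fubini_tonelli_F => //.
  by apply: measurable_funepos; exact/measurable_EFinP.
by apply: measurable_funeneg; exact/measurable_EFinP.
Qed.

End IntegralProduct.

Section Plancherel1.
Variable R : realType.
Local Notation mu := (@lebesgue_measure R).
Local Notation T1 := (measurableTypeR R).
Implicit Types (a b : T1 -> R) (e : R).

(** The usual estimate for an approximate identity: for |u| < eta the translation distance is at
    most eps / 2 and the kernel has mass 1; elsewhere the distance is at most 4 N and the kernel has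
    little mass. *)
Lemma poisson_transl_dist_small a (eps : R) : measurable_fun setT a -> (sqnorm a < +oo)%E -> 0 < eps ->
  exists2 e : R, 0 < e & (\int[mu]_u ((poisson e u)%:E * transl_dist a u) <= eps%:E)%E.
Proof.
move=> ma afin eps0; have [_ ca] := transl_continuous_L2 ma afin.
have [|eta eta0 h] := ca (eps / 2); first by rewrite divr_gt0.
have N0 : (0 <= sqnorm a)%E by apply: integral_ge0 => x _; rewrite lee_fin sqr_ge0.
have afn : sqnorm a \is a fin_num by rewrite ge0_fin_numE.
set N := fine (sqnorm a); have NE : sqnorm a = N%:E by rewrite /N fineK.
have {}N0 : 0 <= N by rewrite -lee_fin -NE.
(* Two tails of mass [del] weighted by 4 N contribute eps / 2 * (N / (N + 1)), at most eps / 2; N +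
   1 rather than N allows N = 0. *)
pose del := eps / (16 * (N + 1)).
have del0 : 0 < del by rewrite divr_gt0// mulr_gt0// ltr_wpDl.
have pi0 := @pi_gt0 R.
have : \forall x \near +oo, atan x > pi / 2 - pi * del.
  have := @cvgy_atan R => /cvgrPdist_lt /(_ (pi * del)); rewrite mulr_gt0// => /(_ isT).
  by apply: filterS => x; rewrite ltr_distl => /andP[]; lra.
move=> [M [_ hM]]; pose X := Num.max M 0 + 1.
have X0 : 0 < X by rewrite ltr_wpDl// le_max lexx orbT.
have {hM} hX : pi / 2 - pi * del < atan X.
  by apply: hM; rewrite ltr_pwDr// le_max lexx.
(* Chosen so that 2 pi eta / e = X, a point where the arctangent is within pi * del of pi / 2; the
   tail of the kernel beyond [eta] is then at most [del]. *)
pose e := 2 * pi * eta / X.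
have e0 : 0 < e by rewrite divr_gt0// mulr_gt0// mulr_gt0.
exists e => //.
(* Only the right tail is kept; the left one enters as its reflection, with the same integral by
   [ge0_integral_opp1]. *)
pose k1 := (EFin \o poisson e) \_ `[eta, +oo[%classic.
have mk : measurable_fun setT (EFin \o poisson e).
  by apply/measurable_EFinP; exact: measurable_poisson.
have mk1 : measurable_fun setT k1.
  by apply/(measurable_restrictT _ _).1 => //; exact: measurable_funS mk.
have k10 u : (0 <= k1 u)%E.
  by rewrite /k1 patchE; case: ifP => // _; rewrite lee_fin poisson_ge0.
have mk1N : measurable_fun setT (fun u : T1 => k1 (- (u : R))).
  apply: (measurableT_comp mk1).
  suff mN : measurable_fun [set: T1] (fun x : T1 => - (x : R) : R) by exact: mN.
  exact: measurable_funN.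
have Ik1 : (\int[mu]_u k1 u <= del%:E)%E.
  rewrite /k1 -integral_mkcond integral_poisson_half// lee_fin.
  have -> : 2 * pi / e * eta = X.
    by rewrite /e; move: (pi : R) pi0 => p p0; field; rewrite !gt_eqF.
  rewrite lerBlDr -lerBlDl.
  have -> : del = pi^-1 * (pi * del) by rewrite mulrA mulVf ?mul1r// gt_eqF.
  rewrite (_ : 2^-1 = pi^-1 * (pi / 2)); last by rewrite mulrA mulVf ?mul1r// gt_eqF.
  by rewrite -mulrBr ler_wpM2l ?invr_ge0 ?ltW//.
have mD : measurable_fun setT (transl_dist a).
  apply: (measurable_fun_fubini_tonelli_F (fun z : T1 * T1 => ((a ((z.2 : R) + z.1)%R - a z.2) ^+ 2)%:E)).
    apply/measurable_EFinP; apply: measurable_funX; apply: measurable_funB.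
      apply: (measurableT_comp ma).
      suff mN : measurable_fun [set: T1 * T1] (fun x : T1 * T1 => (x.2 : R) + x.1 : R) by exact: mN.
      by apply: measurable_funD; [exact: measurable_snd|exact: measurable_fst].
    by apply: (measurableT_comp ma); exact: measurable_snd.
  by move=> z; rewrite lee_fin sqr_ge0.
apply: (@le_trans _ _ (\int[mu]_u ((eps / 2)%:E * (poisson e u)%:E
    + (4 * N)%:E * (k1 u + k1 (- (u : R))%R))))%E.
  apply: ge0_le_integral => //.
  - move=> u _; rewrite mule_ge0 ?lee_fin ?poisson_ge0//.
    by apply: integral_ge0 => x _; rewrite lee_fin sqr_ge0.
  - exact: emeasurable_funM.
  - apply: emeasurable_funD; apply: measurable_funeM => //.
    exact: emeasurable_funD.
  move=> u _; have [ue|ue] := ltP `|u : R| eta.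
    rewrite -[leLHS]adde0; apply: leeD.
      by rewrite muleC lee_wpmul2r ?lee_fin ?poisson_ge0//; exact: h.
    by rewrite mule_ge0 ?adde_ge0 ?lee_fin ?mulr_ge0.
  rewrite -[leLHS]add0e; apply: leeD.
    by rewrite -EFinM lee_fin mulr_ge0 ?poisson_ge0// divr_ge0// ltW.
  rewrite muleC; apply: lee_pmul => //.
  - by apply: integral_ge0 => x _; rewrite lee_fin sqr_ge0.
  - by rewrite lee_fin poisson_ge0.
  - by apply: (le_trans (transl_dist_le _ ma)); rewrite NE.
  have k1E v : eta <= v -> k1 v = (poisson e v)%:E.
    by move=> ev; rewrite /k1 patchE mem_set//= in_itv/= andbT.
  have [u0|u0] := leP 0 (u : R).
    by rewrite -[leLHS]adde0 leeD// k1E//; rewrite ger0_norm in ue.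
  rewrite -[leLHS]add0e leeD// k1E ?poissonN//; rewrite ltr0_norm in ue => //.
rewrite ge0_integralD//; first last.
- by apply: measurable_funeM; exact: emeasurable_funD.
- by move=> u _; rewrite mule_ge0 ?adde_ge0 ?lee_fin ?mulr_ge0.
- exact: measurable_funeM.
- by move=> u _; rewrite -EFinM lee_fin mulr_ge0 ?poisson_ge0// divr_ge0// ltW.
rewrite ge0_integralZl_EFin//; first last.
- by rewrite divr_ge0// ltW.
- by move=> u _; rewrite lee_fin poisson_ge0.
rewrite integral_poisson// mule1 ge0_integralZl_EFin//; first last.
- by rewrite mulr_ge0.
- exact: emeasurable_funD.
- by move=> u _; rewrite adde_ge0.
rewrite ge0_integralD// (ge0_integral_opp1 (f := k1))//.
apply: (@le_trans _ _ ((eps / 2)%:E + (4 * N)%:E * (del%:E + del%:E))%E).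
  by rewrite leeD2l// lee_wpmul2l ?lee_fin ?mulr_ge0// leeD.
rewrite -(EFinD del) -EFinM -EFinD lee_fin /del.
have -> : 4 * N * (eps / (16 * (N + 1)) + eps / (16 * (N + 1))) = eps / 2 * (N / (N + 1)).
  by field; rewrite gt_eqF// ltr_wpDl.
rewrite [leRHS](splitr eps) lerD2l ler_piMr ?divr_ge0 ?(ltW eps0)//.
by rewrite ler_pdivrMr ?mul1r ?lerDl// ltr_wpDl.
Qed.
Lemma measurable_subr1 : measurable_fun setT (fun z : T1 * T1 => (z.1 : R) - z.2 : R).
Proof. by apply: measurable_funB; [exact: measurable_fst|exact: measurable_snd]. Qed.

Lemma measurable_poisson_sub e : 0 < e ->
  measurable_fun setT (fun z : T1 * T1 => poisson e ((z.1 : R) - z.2)).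
Proof.
move=> e0; apply: (measurableT_comp (measurable_poisson e0)); exact: measurable_subr1.
Qed.

Lemma measurable_poisson_shift e (y : R) : 0 < e ->
  measurable_fun setT (fun x : T1 => poisson e ((x : R) - y)).
Proof.
move=> e0; apply: (measurableT_comp (measurable_poisson e0)).
exact: (@measurable_shift1 R (- y)).
Qed.

Definition cosT a w : R := \int[mu]_x (a x * cos (2 * pi * w * x)).
Definition sinT a w : R := \int[mu]_x (a x * sin (2 * pi * w * x)).

Lemma continuous_mfun (f : R -> R) : continuous f -> measurable_fun setT (f : T1 -> R).
Proof. by move=> cf; apply: continuous_measurable_fun. Qed.

Lemma measurable_cosw (k : R) : measurable_fun setT (fun x : T1 => cos (k * (x : R))).
Proof. by apply: continuous_mfun; exact: (is_derive_continuous (is_derive_cos_mull k)). Qed.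

Lemma measurable_sinw (k : R) : measurable_fun setT (fun x : T1 => sin (k * (x : R))).
Proof. by apply: continuous_mfun; exact: (is_derive_continuous (is_derive_sin_mull k)). Qed.

Lemma integrable_mul_bounded d (T : measurableType d) (nu : {measure set T -> \bar R}) (f g : T -> R) :
  nu.-integrable setT (EFin \o f) -> measurable_fun setT g -> (forall x, `|g x| <= 1) ->
  nu.-integrable setT (fun x => (f x * g x)%:E).
Proof.
move=> intf mg g1; have mf : measurable_fun setT f by apply/measurable_EFinP; case/integrableP: intf.
apply: (le_integrable measurableT _ _ intf).
  by apply/measurable_EFinP; exact: measurable_funM.
by move=> x _ /=; rewrite lee_fin normrM ler_piMr.
Qed.

Lemma abs_cos_le1 (x : R) : `|cos x| <= 1.
Proof. by rewrite ler_norml cos_geN1 cos_le1. Qed.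

Lemma abs_sin_le1 (x : R) : `|sin x| <= 1.
Proof. by rewrite ler_norml sin_geN1 sin_le1. Qed.

Section identity.
Variables (a : T1 -> R) (e : R).
Hypotheses (ia : mu.-integrable setT (EFin \o a)) (e0 : 0 < e).

Let ma : measurable_fun setT a.
Proof. by apply/measurable_EFinP; case/integrableP: ia. Qed.

Let m2 := prodm mu mu.
Let W (w : R) := expR (- e * `|w|).
Let iW : mu.-integrable setT (EFin \o W). Proof. exact: integrable_expabs. Qed.

Lemma sqr_cosT_sinT w :
  (((cosT a w) ^+ 2 + (sinT a w) ^+ 2)%:E =
   \int[m2]_z (a z.1 * a z.2 * cos (2 * pi * ((z.1 : R) - z.2) * w))%:E)%E.
Proof.
have iac : mu.-integrable setT (EFin \o (fun x => a x * cos (2 * pi * w * x))).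
  by apply: (integrable_mul_bounded ia); [exact: measurable_cosw|move=> x; exact: abs_cos_le1].
have ias : mu.-integrable setT (EFin \o (fun x => a x * sin (2 * pi * w * x))).
  by apply: (integrable_mul_bounded ia); [exact: measurable_sinw|move=> x; exact: abs_sin_le1].
rewrite !expr2 EFinD -!integral_prod// -integralD//=;
  [|exact: (integrable_prod iac iac)|exact: (integrable_prod ias ias)].
apply: eq_integral => z _; rewrite -EFinD; congr EFin.
rewrite (_ : 2 * pi * ((z.1 : R) - z.2) * w = 2 * pi * w * z.1 - 2 * pi * w * z.2); last by ring.
by rewrite cosB; ring.
Qed.

Let integrable_triple : (prodm mu m2).-integrable setT
  (fun z : T1 * (T1 * T1) => (W z.1 * (a z.2.1 * a z.2.2) * cos (2 * pi * ((z.2.1 : R) - z.2.2) * z.1))%:E).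
Proof.
apply: integrable_mul_bounded; last by move=> x; exact: abs_cos_le1.
  exact: (integrable_prod iW (integrable_prod ia ia)).
have -> : (fun z : T1 * (T1 * T1) => cos (2 * pi * ((z.2.1 : R) - z.2.2) * z.1)) =
   (@cos R) \o (fun z : T1 * (T1 * T1) => 2 * pi * ((z.2.1 : R) - z.2.2) * z.1) by [].
apply: (measurableT_comp (continuous_mfun (@continuous_cos R))).
suff h : measurable_fun setT (fun z : T1 * (T1 * T1) => 2 * pi * ((z.2.1 : R) - z.2.2) * z.1 : R) by exact: h.
apply: measurable_funM; last exact: measurable_fst.
apply: measurable_funM; first exact: measurable_cst.
exact: (measurableT_comp measurable_subr1 measurable_snd).
Qed.

(** The damping factor makes the triple integrand absolutely integrable, so the integral over [w]
    can be taken first, where it gives the Poisson kernel at x - y. *)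
Lemma integral_weighted_sqr :
  (\int[mu]_w (W w * ((cosT a w) ^+ 2 + (sinT a w) ^+ 2))%:E =
   \int[m2]_z (a z.1 * a z.2 * poisson e ((z.1 : R) - z.2))%:E)%E.
Proof.
have iaa := integrable_prod ia ia.
have maa : measurable_fun setT (fun z : T1 * T1 => a z.1 * a z.2).
  by apply/measurable_EFinP; case/integrableP: iaa.
transitivity (\int[mu]_w \int[m2]_z (W w * (a z.1 * a z.2) * cos (2 * pi * ((z.1 : R) - z.2) * w))%:E)%E.
  apply: eq_integral => w _; rewrite EFinM sqr_cosT_sinT -integralZl//.
    by apply: eq_integral => z _; rewrite -EFinM; congr EFin; ring.
  apply: (integrable_mul_bounded iaa); last by move=> x; exact: abs_cos_le1.
  rewrite (_ : (fun z => _) = (fun y : T1 => cos (2 * pi * w * y)) \o (fun z : T1 * T1 => (z.1 : R) - z.2 : T1)).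
    by apply: (measurableT_comp (measurable_cosw _)); exact: measurable_subr1.
  by apply/funext => z /=; congr cos; ring.
rewrite (Fubini integrable_triple)/=.
apply: eq_integral => z _; rewrite EFinM /poisson -(integral_expabs_cos e0) -integralZl//.
  by apply: eq_integral => w _; rewrite -EFinM; congr EFin; rewrite /W; ring.
apply: (integrable_mul_bounded iW); last by move=> x; exact: abs_cos_le1.
exact: measurable_cosw.
Qed.

Hypothesis afin : (sqnorm a < +oo)%E.

Lemma integral_poisson_sqr1 :
  (\int[m2]_z (poisson e ((z.1 : R) - z.2) * (a z.1) ^+ 2)%:E = sqnorm a)%E.
Proof.
rewrite /m2 /prodm fubini_tonelli1//.
- apply: eq_integral => x _; rewrite /fubini_F/=.
  under eq_integral do rewrite mulrC EFinM -poissonN opprB.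
  rewrite ge0_integralZl_EFin ?sqr_ge0//; first last.
  + by apply/measurable_EFinP; exact: measurable_poisson_shift.
  + by move=> y _; rewrite lee_fin poisson_ge0.
  have mp : measurable_fun setT (EFin \o poisson e : T1 -> \bar R).
    by apply/measurable_EFinP; exact: measurable_poisson.
  rewrite (ge0_integral_shift1 (- (x : R)) (f := fun y => (poisson e y)%:E))//.
    by rewrite integral_poisson// mule1.
  by move=> y; rewrite lee_fin poisson_ge0.
- apply/measurable_EFinP; apply: measurable_funM; first exact: measurable_poisson_sub.
  by apply: measurable_funX; exact: (measurableT_comp ma).
- by move=> z; rewrite lee_fin mulr_ge0 ?poisson_ge0 ?sqr_ge0.
Qed.

Lemma integral_poisson_sqr2 :
  (\int[m2]_z (poisson e ((z.1 : R) - z.2) * (a z.2) ^+ 2)%:E = sqnorm a)%E.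
Proof.
rewrite /m2 /prodm fubini_tonelli2//.
- apply: eq_integral => x _; rewrite /fubini_G/=.
  under eq_integral do rewrite mulrC EFinM.
  rewrite ge0_integralZl_EFin ?sqr_ge0//; first last.
  + by apply/measurable_EFinP; exact: measurable_poisson_shift.
  + by move=> y _; rewrite lee_fin poisson_ge0.
  have mp : measurable_fun setT (EFin \o poisson e : T1 -> \bar R).
    by apply/measurable_EFinP; exact: measurable_poisson.
  rewrite (ge0_integral_shift1 (- (x : R)) (f := fun y => (poisson e y)%:E))//.
    by rewrite integral_poisson// mule1.
  by move=> y; rewrite lee_fin poisson_ge0.
- apply/measurable_EFinP; apply: measurable_funM; first exact: measurable_poisson_sub.
  by apply: measurable_funX; exact: (measurableT_comp ma).
- by move=> z; rewrite lee_fin mulr_ge0 ?poisson_ge0 ?sqr_ge0.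
Qed.

(** Substitute x = y + u for fixed y, then let Tonelli bring the integral over [u] outside. *)
Lemma integral_poisson_diff :
  (\int[m2]_z (poisson e ((z.1 : R) - z.2) * (a z.1 - a z.2) ^+ 2)%:E =
   \int[mu]_u ((poisson e u)%:E * transl_dist a u))%E.
Proof.
have mshift : measurable_fun setT (fun z : T1 * T1 => (z.2 : R) + z.1 : T1).
  suff mN : measurable_fun [set: T1 * T1] (fun x : T1 * T1 => (x.2 : R) + x.1 : R) by exact: mN.
  by apply: measurable_funD; [exact: measurable_snd|exact: measurable_fst].
have mF : measurable_fun setT (fun z : T1 * T1 =>
    (poisson e ((z.1 : R) - z.2) * (a z.1 - a z.2) ^+ 2)%:E).
  apply/measurable_EFinP; apply: measurable_funM; first exact: measurable_poisson_sub.
  by apply: measurable_funX; apply: measurable_funB; apply: (measurableT_comp ma).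
rewrite /m2 /prodm fubini_tonelli2//; last first.
  by move=> z; rewrite lee_fin mulr_ge0 ?poisson_ge0 ?sqr_ge0.
transitivity (\int[mu]_y \int[mu]_u (poisson e u * (a ((y : R) + u)%R - a y) ^+ 2)%:E)%E.
  apply: eq_integral => y _; rewrite /fubini_G/=.
  rewrite -(ge0_integral_shift1 (y : R) (f := fun x : T1 => (poisson e ((x : R) - y) * (a x - a y) ^+ 2)%:E))//.
  - by apply: eq_integral => u _; rewrite addrK [u + y]addrC.
  - exact: (measurableT_comp mF (measurable_pair2 y)).
  - by move=> x; rewrite lee_fin mulr_ge0 ?poisson_ge0 ?sqr_ge0.
rewrite -(fubini_tonelli (fun z : T1 * T1 => (poisson e z.1 * (a ((z.2 : R) + z.1)%R - a z.2) ^+ 2)%:E))//=.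
- apply: eq_integral => u _; under eq_integral do rewrite EFinM.
  rewrite ge0_integralZl_EFin ?poisson_ge0//; last exact: measurable_transl_dist.
  by move=> x _; rewrite lee_fin sqr_ge0.
- apply/measurable_EFinP; apply: measurable_funM.
    exact: (measurableT_comp (measurable_poisson e0) measurable_fst).
  apply: measurable_funX; apply: measurable_funB; first exact: (measurableT_comp ma).
  exact: (measurableT_comp ma).
- by move=> z; rewrite lee_fin mulr_ge0 ?poisson_ge0 ?sqr_ge0.
Qed.

(** Integrate 2 a(x) a(y) + (a(x) - a(y))^2 = a(x)^2 + a(y)^2 against the Poisson kernel at x - y.
    Since the kernel has mass 1, the right side gives twice the squared norm; the square on the left
    gives the averaged translation distance. As an exact identity it serves for both inequalities of
    Plancherel. *)
Lemma weighted_plancherel :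
  (2%:E * (\int[mu]_w (W w * ((cosT a w) ^+ 2 + (sinT a w) ^+ 2))%:E) +
   \int[mu]_u ((poisson e u)%:E * transl_dist a u) = 2%:E * sqnorm a)%E.
Proof.
pose k (z : T1 * T1) : R := poisson e ((z.1 : R) - z.2).
have mk : measurable_fun setT k by exact: measurable_poisson_sub.
have k0 z : 0 <= k z by exact: poisson_ge0.
have ma1 : measurable_fun setT (fun z : T1 * T1 => a z.1) by exact: (measurableT_comp ma).
have ma2 : measurable_fun setT (fun z : T1 * T1 => a z.2) by exact: (measurableT_comp ma).
have i1 : m2.-integrable setT (fun z => (k z * (a z.1) ^+ 2)%:E).
  apply: ge0_integrable; last by rewrite integral_poisson_sqr1.
    by apply/measurable_EFinP; apply: measurable_funM => //; exact: measurable_funX.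
  by move=> z; rewrite lee_fin mulr_ge0 ?sqr_ge0.
have i2 : m2.-integrable setT (fun z => (k z * (a z.2) ^+ 2)%:E).
  apply: ge0_integrable; last by rewrite integral_poisson_sqr2.
    by apply/measurable_EFinP; apply: measurable_funM => //; exact: measurable_funX.
  by move=> z; rewrite lee_fin mulr_ge0 ?sqr_ge0.
have i12 := integrableD measurableT i1 i2.
have iaak : m2.-integrable setT (fun z => (2 * (a z.1 * a z.2 * k z))%:E).
  apply: (le_integrable measurableT _ _ i12).
    by apply/measurable_EFinP; do 3 apply: measurable_funM => //.
  move=> z _; rewrite -EFinD/= lee_fin.
  have p0 := sqr_ge0 (a z.1 + a z.2); have n0 := sqr_ge0 (a z.1 - a z.2).
  rewrite [leRHS]ger0_norm; last by rewrite addr_ge0// mulr_ge0 ?sqr_ge0.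
  rewrite -mulrDr (_ : 2 * (a z.1 * a z.2 * k z) = k z * (2 * (a z.1 * a z.2))); last by ring.
  rewrite normrM ger0_norm// ler_wpM2l// ler_norml.
  by apply/andP; split; nra.
have id : m2.-integrable setT (fun z => (k z * (a z.1 - a z.2) ^+ 2)%:E).
  rewrite (_ : (fun z => _) = ((fun z => (k z * (a z.1) ^+ 2)%:E) \+ (fun z => (k z * (a z.2) ^+ 2)%:E))
      \- (fun z => (2 * (a z.1 * a z.2 * k z))%:E))%E; first exact: (integrableB measurableT i12 iaak).
  apply/funext => z; rewrite (_ : k z * (a z.1 - a z.2) ^+ 2 =
    k z * a z.1 ^+ 2 + k z * a z.2 ^+ 2 - 2 * (a z.1 * a z.2 * k z))//; ring.
rewrite integral_weighted_sqr -integral_poisson_diff.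
have iaa : m2.-integrable setT (fun z => (a z.1 * a z.2 * k z)%:E).
  rewrite (_ : (fun z => _) = (fun z => (2^-1)%:E * (2 * (a z.1 * a z.2 * k z))%:E)%E); first exact: (integrableZl measurableT 2^-1 iaak).
  by apply/funext => z; rewrite -EFinM; congr EFin; field.
rewrite -integralZl// -integralD//.
have -> : (2%:E * sqnorm a = sqnorm a + sqnorm a)%E by rewrite mule_natl.
rewrite -{1}integral_poisson_sqr1 -integral_poisson_sqr2 -integralD//.
by apply: eq_integral => z _; rewrite -EFinM -!EFinD; congr EFin; rewrite /k; ring.
Qed.

End identity.
End Plancherel1.

Section Plancherel1.
Variable R : realType.
Local Notation mu := (@lebesgue_measure R).
Local Notation T1 := (measurableTypeR R).
Implicit Types (a b : T1 -> R) (e : R).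

Lemma cvg_expR_harmonic (c : R) : expR (- (n.+1%:R^-1) * c) @[n --> \oo] --> (1 : R).
Proof.
have h : (- (n.+1%:R^-1) * c) @[n --> \oo] --> (0 : R).
  rewrite -(mul0r c); apply: cvgMr_tmp; rewrite -oppr0; apply: cvgN.
  exact: cvg_harmonic.
rewrite -[X in _ --> X]expR0; apply: (cvg_comp _ _ h); exact: continuous_expR.
Qed.

Lemma measurable_mul2 : measurable_fun setT (fun z : T1 * T1 => 2 * pi * (z.1 : R) * z.2 : R).
Proof.
apply: measurable_funM; last exact: measurable_snd.
by apply: measurable_funM; [exact: measurable_cst|exact: measurable_fst].
Qed.

Lemma measurable_cosT a : measurable_fun setT a -> measurable_fun setT (cosT a : T1 -> R).
Proof.
move=> ma; apply: (@measurable_Rintegral _ _ T1 T1 R mu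
  (fun z => a z.2 * cos (2 * pi * (z.1 : R) * z.2))).
apply: measurable_funM; first exact: (measurableT_comp ma).
exact: (measurableT_comp (continuous_mfun (@continuous_cos R)) measurable_mul2).
Qed.

Lemma measurable_sinT a : measurable_fun setT a -> measurable_fun setT (sinT a : T1 -> R).
Proof.
move=> ma; apply: (@measurable_Rintegral _ _ T1 T1 R mu
  (fun z => a z.2 * sin (2 * pi * (z.1 : R) * z.2))).
apply: measurable_funM; first exact: (measurableT_comp ma).
exact: (measurableT_comp (continuous_mfun (@continuous_sin R)) measurable_mul2).
Qed.

(** For <=, drop the nonnegative error in [weighted_plancherel] and remove the damping by Fatou
    along e = 1 / (n + 1). For >=, bound the damping by 1 and make the error small by
    [poisson_transl_dist_small]. *)
Lemma plancherel_real a : mu.-integrable setT (EFin \o a) -> (sqnorm a < +oo)%E ->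
  (\int[mu]_w ((cosT a w) ^+ 2 + (sinT a w) ^+ 2)%:E = sqnorm a)%E.
Proof.
move=> ia afin; have ma : measurable_fun setT a by apply/measurable_EFinP; case/integrableP: ia.
pose G w := (cosT a w) ^+ 2 + (sinT a w) ^+ 2.
have G0 w : 0 <= G w by rewrite addr_ge0 ?sqr_ge0.
have mG : measurable_fun setT (G : T1 -> R).
  by apply: measurable_funD; apply: measurable_funX; [exact: measurable_cosT|exact: measurable_sinT].
have mW e : measurable_fun setT (fun w : T1 => expR (- e * `|w : R|)).
  apply: (measurableT_comp (continuous_mfun (is_derive_continuous (is_derive_expR_mull (- e))))).
  exact: (@measurableT_comp _ _ _ _ _ _ (fun x : R => `|x|)).
have ge0w e w : (0 <= (expR (- e * `|w|) * G w)%:E)%E by rewrite lee_fin mulr_ge0 ?expR_ge0.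
have mWG e : measurable_fun setT (fun w : T1 => (expR (- e * `|w : R|) * G w)%:E).
  by apply/measurable_EFinP; exact: measurable_funM.
have J0 e : 0 < e -> (0 <= \int[mu]_u ((poisson e u)%:E * transl_dist a u))%E.
  move=> e0; apply: integral_ge0 => u _; rewrite mule_ge0 ?lee_fin ?poisson_ge0//.
  by apply: integral_ge0 => x _; rewrite lee_fin sqr_ge0.
apply/eqP; rewrite eq_le; apply/andP; split.
- have Wcvg w : limn_einf (fun n => (expR (- (n.+1%:R^-1) * `|w|) * G w)%:E) = (G w)%:E.
    have /cvg_limn_einf_sup[] // : (expR (- (n.+1%:R^-1) * `|w|) * G w)%:E @[n --> \oo] --> (G w)%:E.
    apply: cvg_EFin; first exact: nearW.
    rewrite -[X in _ --> X]mul1r; apply: cvgMr_tmp.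
    exact: cvg_expR_harmonic.
  apply: (@le_trans _ _ (\int[mu]_w limn_einf (fun n => (expR (- (n.+1%:R^-1) * `|w : R|) * G w)%:E))%E).
    by under [leRHS]eq_integral do rewrite Wcvg.
  apply: (le_trans (fatou _ _ _ _)) => //.
  rewrite limn_einf_lim; apply: lime_le; first exact: is_cvg_einfs.
  apply: nearW => n; apply: (@le_trans _ _ (\int[mu]_w (expR (- (n.+1%:R^-1) * `|w : R|) * G w)%:E)%E).
    by apply: ereal_inf_lbound => /=; exists n => //=.
  have n0 : 0 < n.+1%:R^-1 :> R by rewrite invr_gt0.
  rewrite -(@lee_pmul2l _ 2%:E)// -(weighted_plancherel ia n0 afin).
  by rewrite leeDl// J0.
- apply/lee_addgt0Pr => eps eps0; have [e e0 he] := poisson_transl_dist_small ma afin eps0.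
  have I0 : (0 <= \int[mu]_w (G w)%:E)%E by apply: integral_ge0 => w _; rewrite lee_fin.
  rewrite -(@lee_pmul2l _ 2%:E)// -(weighted_plancherel ia e0 afin).
  rewrite (ge0_muleDr 2%:E I0); last by rewrite lee_fin ltW.
  apply: leeD.
    rewrite lee_pmul2l//; apply: ge0_le_integral => //.
    + exact/measurable_EFinP.
    + move=> w _; rewrite lee_fin ler_piMl ?addr_ge0 ?sqr_ge0//.
      rewrite -[leRHS]expR0 ler_expR.
      by rewrite mulNr oppr_le0 mulr_ge0 ?(ltW e0) ?normr_ge0.
  by apply: (le_trans he); rewrite -EFinM lee_fin; lra.
Qed.

Lemma cosTN a w : cosT a (- w) = cosT a w.
Proof. by apply: eq_Rintegral => x _; rewrite mulrN mulNr cosN. Qed.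

Lemma sinTN a w : mu.-integrable setT (EFin \o a) -> sinT a (- w) = - sinT a w.
Proof.
move=> ia; rewrite -[RHS]mulN1r /sinT -RintegralZl//.
  by apply: eq_Rintegral => x _; rewrite mulrN mulNr sinN; ring.
by apply: (integrable_mul_bounded ia); [exact: measurable_sinw|move=> x; exact: abs_sin_le1].
Qed.

(** The left integrand is the squared modulus of the transform of a + ib. Its cross terms are odd in
    [w], so they cancel when the integral is added to its reflection; they never have to be
    integrated separately. *)
Lemma plancherel1 a b : mu.-integrable setT (EFin \o a) -> mu.-integrable setT (EFin \o b) ->
  (sqnorm a < +oo)%E -> (sqnorm b < +oo)%E ->
  (\int[mu]_w ((cosT a w + sinT b w) ^+ 2 + (cosT b w - sinT a w) ^+ 2)%:E = sqnorm a + sqnorm b)%E.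
Proof.
move=> ia ib fa fb; have ma : measurable_fun setT a by apply/measurable_EFinP; case/integrableP: ia.
have mb : measurable_fun setT b by apply/measurable_EFinP; case/integrableP: ib.
have mca := measurable_cosT ma; have mcb := measurable_cosT mb.
have msa := measurable_sinT ma; have msb := measurable_sinT mb.
pose F w := ((cosT a w + sinT b w) ^+ 2 + (cosT b w - sinT a w) ^+ 2)%:E.
have F0 w : (0 <= F w)%E by rewrite lee_fin addr_ge0 ?sqr_ge0.
have mF : measurable_fun setT (F : T1 -> \bar R).
  apply/measurable_EFinP; apply: measurable_funD; apply: measurable_funX.
    exact: measurable_funD.
  exact: measurable_funB.
have mFN : measurable_fun setT (fun w : T1 => F (- (w : R))).
  apply: (measurableT_comp mF).
  suff mN : measurable_fun [set: T1] (fun x : T1 => - (x : R) : R) by exact: mN.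
  exact: measurable_funN.
have ge0s c w : (0 <= ((cosT c w) ^+ 2 + (sinT c w) ^+ 2)%:E)%E.
  by rewrite lee_fin addr_ge0 ?sqr_ge0.
have ms c : measurable_fun setT c ->
    measurable_fun setT (fun w : T1 => ((cosT c w) ^+ 2 + (sinT c w) ^+ 2)%:E).
  move=> mc; apply/measurable_EFinP; apply: measurable_funD; apply: measurable_funX.
    exact: measurable_cosT.
  exact: measurable_sinT.
rewrite -(plancherel_real ia fa) -(plancherel_real ib fb) -ge0_integralD//; [|exact: ms|exact: ms].
have h : (\int[mu]_w F w + \int[mu]_w F w =
    2%:E * \int[mu]_w (((cosT a w) ^+ 2 + (sinT a w) ^+ 2)%:E + ((cosT b w) ^+ 2 + (sinT b w) ^+ 2)%:E))%E.
  rewrite -{2}(ge0_integral_opp1 mF F0) -ge0_integralD// -ge0_integralZl_EFin//.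
  - apply: eq_integral => w _; rewrite /F !cosTN !sinTN// -EFinD -EFinD -EFinM; congr EFin; ring.
  - by move=> w _; rewrite adde_ge0.
  - by apply: emeasurable_funD; exact: ms.
have {}h : (2%:E * \int[mu]_w F w =
    2%:E * \int[mu]_w (((cosT a w) ^+ 2 + (sinT a w) ^+ 2)%:E + ((cosT b w) ^+ 2 + (sinT b w) ^+ 2)%:E))%E.
  by rewrite -h mule_natl.
by apply/eqP; rewrite eq_le; apply/andP; split; rewrite -(@lee_pmul2l _ 2%:E)// -h// h.
Qed.

End Plancherel1.

(** * Complex-valued integrals *)

Section ComplexIntegral.
Variable R : realType.
Local Notation C := R[i].

Lemma ReM (x y : C) : complex.Re (x * y) = complex.Re x * complex.Re y - complex.Im x * complex.Im y.
Proof. by case: x => a b; case: y => c e. Qed.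
Lemma ImM (x y : C) : complex.Im (x * y) = complex.Re x * complex.Im y + complex.Im x * complex.Re y.
Proof. by case: x => a b; case: y => c e. Qed.
Lemma ReD (x y : C) : complex.Re (x + y) = complex.Re x + complex.Re y.
Proof. by case: x => a b; case: y => c e. Qed.
Lemma ImD (x y : C) : complex.Im (x + y) = complex.Im x + complex.Im y.
Proof. by case: x => a b; case: y => c e. Qed.
Lemma ReN (x : C) : complex.Re (- x) = - complex.Re x.
Proof. by case: x. Qed.
Lemma ImN (x : C) : complex.Im (- x) = - complex.Im x.
Proof. by case: x. Qed.

Lemma complex_ext (x y : C) : complex.Re x = complex.Re y -> complex.Im x = complex.Im y -> x = y.
Proof. by case: x => a b; case: y => c e /= -> ->. Qed.

Lemma cabs2_ge0 (x : C) : 0 <= cabs2 x.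
Proof. by rewrite addr_ge0 ?sqr_ge0. Qed.

Lemma cabs2M (x y : C) : cabs2 (x * y) = cabs2 x * cabs2 y.
Proof. by rewrite /cabs2 ReM ImM; ring. Qed.

Lemma cabs2_expi (t : R) : cabs2 (expi t) = 1.
Proof. by rewrite /cabs2/= cos2Dsin2. Qed.

Lemma expiD (s t : R) : expi (s + t) = expi s * expi t.
Proof. by apply: complex_ext; rewrite ?ReM ?ImM /= ?cosD ?sinD//; ring. Qed.

Lemma expi0 : expi (0 : R) = 1.
Proof. by apply: complex_ext; rewrite /= ?cos0 ?sin0. Qed.

Lemma cabs2_eq0 (x : C) : (cabs2 x == 0) = (x == 0).
Proof.
case: x => a b; rewrite /cabs2/= paddr_eq0 ?sqr_ge0// !sqrf_eq0.
by apply/andP/eqP => [[/eqP-> /eqP->]//|[-> ->]].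
Qed.

Lemma cabs2D_le (x y : C) : cabs2 (x + y) <= 2 * cabs2 x + 2 * cabs2 y.
Proof.
rewrite /cabs2 ReD ImD; have := sqr_ge0 (complex.Re x - complex.Re y).
by have := sqr_ge0 (complex.Im x - complex.Im y); nra.
Qed.

Lemma cabs2N (x : C) : cabs2 (- x) = cabs2 x.
Proof. by rewrite /cabs2 ReN ImN !sqrrN. Qed.

Section generic.
Context {d : measure_display} {T : measurableType d} (nu : {measure set T -> \bar R}).
Implicit Types f g : T -> C.

Definition cmeas f := measurable_fun setT (fun x => complex.Re (f x)) /\
  measurable_fun setT (fun x => complex.Im (f x)).

Definition cintegrable f := nu.-integrable setT (fun x => (complex.Re (f x))%:E) /\
  nu.-integrable setT (fun x => (complex.Im (f x))%:E).

Definition cint f : C := Complex (\int[nu]_x complex.Re (f x)) (\int[nu]_x complex.Im (f x)).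

Lemma cmeasM f g : cmeas f -> cmeas g -> cmeas (fun x => f x * g x).
Proof.
move=> [fr fi] [gr gi]; split.
  by under eq_fun do rewrite ReM; apply: measurable_funB; exact: measurable_funM.
by under eq_fun do rewrite ImM; apply: measurable_funD; exact: measurable_funM.
Qed.

Lemma cmeasD f g : cmeas f -> cmeas g -> cmeas (fun x => f x + g x).
Proof.
move=> [fr fi] [gr gi]; split.
  by under eq_fun do rewrite ReD; exact: measurable_funD.
by under eq_fun do rewrite ImD; exact: measurable_funD.
Qed.

Lemma cmeas_cst (c : C) : cmeas (fun=> c).
Proof. by split; exact: measurable_cst. Qed.

Lemma cmeasN f : cmeas f -> cmeas (fun x => - f x).
Proof.
move=> [fr fi]; split.
  by under eq_fun do rewrite ReN; exact: measurable_funN.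
by under eq_fun do rewrite ImN; exact: measurable_funN.
Qed.

Lemma cmeasB f g : cmeas f -> cmeas g -> cmeas (fun x => f x - g x).
Proof. by move=> mf mg; apply: cmeasD => //; exact: cmeasN. Qed.

Lemma cmeas_sum (I : Type) (s : seq I) (F : I -> T -> C) :
  (forall i, cmeas (F i)) -> cmeas (fun x => \sum_(i <- s) F i x).
Proof.
move=> mF; elim: s => [|i s IH]; first by under eq_fun do rewrite big_nil; exact: cmeas_cst.
by under eq_fun do rewrite big_cons; exact: cmeasD.
Qed.

Lemma cmeas_expi (h : T -> R) : measurable_fun setT h -> cmeas (fun x => expi (h x)).
Proof.
move=> mh; split => /=.
  by apply: (measurableT_comp _ mh); apply: continuous_measurable_fun; exact: continuous_cos.
by apply: (measurableT_comp _ mh); apply: continuous_measurable_fun; exact: continuous_sin.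
Qed.

Lemma cmeas_cabs2 f : cmeas f -> measurable_fun setT (fun x => (cabs2 (f x))%:E).
Proof.
by move=> [fr fi]; apply/measurable_EFinP; apply: measurable_funD; exact: measurable_funX.
Qed.

Lemma cintegrable_cmeas f : cintegrable f -> cmeas f.
Proof.
by move=> [/integrableP[fr _] /integrableP[fi _]]; split; apply/measurable_EFinP.
Qed.

Lemma cintegrableM f g : cintegrable f -> cmeas g -> (forall x, cabs2 (g x) <= 1) ->
  cintegrable (fun x => f x * g x).
Proof.
move=> [fr fi] [gr gi] g1.
have gr1 x : `|complex.Re (g x)| <= 1.
  rewrite -(@ler_pXn2r _ 2) ?nnegrE// expr1n real_normK ?num_real//.
  by apply: le_trans (g1 x); rewrite lerDl sqr_ge0.
have gi1 x : `|complex.Im (g x)| <= 1.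
  rewrite -(@ler_pXn2r _ 2) ?nnegrE// expr1n real_normK ?num_real//.
  by apply: le_trans (g1 x); rewrite lerDr sqr_ge0.
split.
  under eq_fun do rewrite ReM EFinB.
  by apply: integrableB => //; exact: integrable_mul_bounded.
under eq_fun do rewrite ImM EFinD.
by apply: integrableD => //; exact: integrable_mul_bounded.
Qed.

Lemma cintegrable_expi f (h : T -> R) : cintegrable f -> measurable_fun setT h ->
  cintegrable (fun x => f x * expi (h x)).
Proof.
move=> cf mh; apply: cintegrableM => //; first exact: cmeas_expi.
by move=> x; rewrite cabs2_expi.
Qed.

Lemma cintegrableZ f (c : C) : cintegrable f -> cintegrable (fun x => c * f x).
Proof.
move=> [fr fi]; split.
  under eq_fun do rewrite ReM EFinB !EFinM.
  by apply: integrableB => //; exact: integrableZl.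
under eq_fun do rewrite ImM EFinD !EFinM.
by apply: integrableD => //; exact: integrableZl.
Qed.

Lemma cintegrableD f g : cintegrable f -> cintegrable g -> cintegrable (fun x => f x + g x).
Proof.
move=> [fr fi] [gr gi]; split.
  by under eq_fun do rewrite ReD EFinD; exact: integrableD.
by under eq_fun do rewrite ImD EFinD; exact: integrableD.
Qed.

Lemma cintZ f (c : C) : cintegrable f -> cint (fun x => c * f x) = c * cint f.
Proof.
move=> [fr fi]; have iZ k (h : T -> R) : nu.-integrable setT (fun x => (h x)%:E) ->
    nu.-integrable setT (EFin \o (fun x => k * h x)).
  by move=> ih; exact: (integrableZl measurableT k ih).
have irr := iZ (complex.Re c) _ fr; have iri := iZ (complex.Re c) _ fi.
have iir := iZ (complex.Im c) _ fr; have iii := iZ (complex.Im c) _ fi.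
apply: complex_ext; rewrite ?ReM ?ImM/=.
  rewrite -!RintegralZl// -RintegralB//.
  by apply: eq_Rintegral => x _; rewrite ReM.
rewrite -!RintegralZl// -RintegralD//.
by apply: eq_Rintegral => x _; rewrite ImM.
Qed.

Lemma cintD f g : cintegrable f -> cintegrable g ->
  cint (fun x => f x + g x) = cint f + cint g.
Proof.
move=> [fr fi] [gr gi]; apply: complex_ext; rewrite ?ReD ?ImD/=.
  by rewrite -RintegralD//; apply: eq_Rintegral => x _; rewrite ReD.
by rewrite -RintegralD//; apply: eq_Rintegral => x _; rewrite ImD.
Qed.

Lemma cintegrable0 : cintegrable (fun=> 0).
Proof. by split; exact: integrable0. Qed.

Lemma cint0 : cint (fun=> 0) = 0.
Proof. by rewrite /cint/= /Rintegral integral0. Qed.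

Lemma cintegrable_sum (I : Type) (s : seq I) (F : I -> T -> C) :
  (forall i, cintegrable (F i)) -> cintegrable (fun x => \sum_(i <- s) F i x).
Proof.
move=> mF; elim: s => [|i s IH]; first by under eq_fun do rewrite big_nil; exact: cintegrable0.
by under eq_fun do rewrite big_cons; exact: cintegrableD.
Qed.

Lemma cint_sum (I : Type) (s : seq I) (F : I -> T -> C) : (forall i, cintegrable (F i)) ->
  cint (fun x => \sum_(i <- s) F i x) = \sum_(i <- s) cint (F i).
Proof.
move=> mF; elim: s => [|i s IH].
  by under [in LHS]eq_fun do rewrite big_nil; rewrite cint0 big_nil.
under [in LHS]eq_fun do rewrite big_cons.
by rewrite cintD ?IH ?big_cons//; exact: cintegrable_sum.
Qed.

Lemma ae_eq_cint f g : cmeas f -> cmeas g -> {ae nu, forall x, f x = g x} -> cint f = cint g.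
Proof.
move=> [fr fi] [gr gi] fg; apply: complex_ext; rewrite /= /Rintegral; congr fine.
  apply: ae_eq_integral => //; [exact/measurable_EFinP|exact/measurable_EFinP|].
  by apply: filterS fg => x -> _.
apply: ae_eq_integral => //; [exact/measurable_EFinP|exact/measurable_EFinP|].
by apply: filterS fg => x -> _.
Qed.

End generic.

Section product.
Context {d1 d2 : measure_display} {T1 : measurableType d1} {T2 : measurableType d2}.
Variables (m1 : {sigma_finite_measure set T1 -> \bar R})
  (m2 : {sigma_finite_measure set T2 -> \bar R}).

Lemma cmeas_cint1 (f : T1 * T2 -> C) : cmeas f -> cmeas (fun y => cint m1 (fun x => f (x, y))).
Proof.
move=> [fr fi]; split => /=.
  apply: (@measurable_Rintegral _ _ T2 T1 R m1 (fun z => complex.Re (f (z.2, z.1)))).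
  by apply: (measurableT_comp fr); exact: measurable_swap.
apply: (@measurable_Rintegral _ _ T2 T1 R m1 (fun z => complex.Im (f (z.2, z.1)))).
by apply: (measurableT_comp fi); exact: measurable_swap.
Qed.

Lemma ae_cintegrable2 (f : T1 * T2 -> C) : cintegrable (prodm m1 m2) f ->
  {ae m2, forall y, cintegrable m1 (fun x => f (x, y))}.
Proof.
move=> [fr fi]; have hr := ae_integrable2 fr; have hi := ae_integrable2 fi.
by apply: filterS2 hr hi => y /= r i; split.
Qed.

Lemma cint_prod2 (f : T1 * T2 -> C) : cintegrable (prodm m1 m2) f ->
  cintegrable m2 (fun y => cint m1 (fun x => f (x, y))) /\
  cint (prodm m1 m2) f = cint m2 (fun y => cint m1 (fun x => f (x, y))).
Proof.
move=> cf; have [fr fi] := cf; have cm := cmeas_cint1 (cintegrable_cmeas cf).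
have key (h : T1 * T2 -> R) : (prodm m1 m2).-integrable setT (EFin \o h) ->
    measurable_fun setT (fun y => \int[m1]_x h (x, y))%R ->
    m2.-integrable setT (fun y => (\int[m1]_x h (x, y))%R%:E) /\
    \int[prodm m1 m2]_z h z = \int[m2]_y \int[m1]_x h (x, y).
  move=> ih mh; have /integrableP[mEh _] := ih.
  (* Where the integral of a section is infinite, [Rintegral] returns 0, so the two inner integrals
     agree only almost everywhere. *)
  have ae : ae_eq m2 setT (fubini_G m1 (EFin \o h)) (fun y => (\int[m1]_x h (x, y))%R%:E).
    have := ae_integrable2 ih; apply: filterS => y /= iy _.
    by rewrite /Rintegral fineK//; exact: integrable_fin_num.
  have mh' : measurable_fun setT (fun y => (\int[m1]_x h (x, y))%R%:E) by exact/measurable_EFinP.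
  split.
    apply/integrableP; split => //; apply: le_lt_trans ((integrable21ltyP m1 m2 mEh).1 ih).
    apply: ge0_le_integral => //.
    - exact: measurableT_comp.
    - apply: (measurable_fun_fubini_tonelli_G (abse \o (EFin \o h))).
        exact: measurableT_comp.
      by move=> z; exact: abse_ge0.
    move=> y _; apply: (@le_trans _ _ `|\int[m1]_x (h (x, y))%:E|%E).
      by rewrite /Rintegral; case: (integral _ _ _) => //=; rewrite ?normr0 leey.
    by apply: le_abse_integral => //; exact: (measurableT_comp mEh (measurable_pair2 y)).
  rewrite {1}/Rintegral -(integral21_prod_meas1 ih); congr fine.
  apply: ae_eq_integral => //.
  exact: (measurable_fubini_G ih).
have [ir er] := key _ fr cm.1; have [ii ei] := key _ fi cm.2.
by split; [split|apply: complex_ext].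
Qed.

End product.
End ComplexIntegral.

(** * The Plancherel identity in several variables *)

Section FourierRd.
Variable R : realType.
Local Notation C := R[i].
Local Notation vec d := ('rV[R]_d).
Local Notation mu := (@lebesgue_measure R).
Local Notation T1 := (measurableTypeR R).

Lemma dotE d (x y : vec d) : dot x y = \sum_i x 0 i * y 0 i.
Proof. by rewrite /dot mxE; apply: eq_bigr => i _; rewrite mxE. Qed.

Lemma dotDr d (x y z : vec d) : dot x (y + z) = dot x y + dot x z.
Proof. by rewrite !dotE -big_split; apply: eq_bigr => i _; rewrite mxE mulrDr. Qed.

Lemma dotDl d (x y z : vec d) : dot (x + y) z = dot x z + dot y z.
Proof. by rewrite !dotE -big_split; apply: eq_bigr => i _; rewrite mxE mulrDl. Qed.

Lemma dot_consv d (a b : R) (u v : vec d) :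
  dot (consv (a, u)) (consv (b, v)) = a * b + dot u v.
Proof.
rewrite !dotE big_ord_recl !mxE unlift_none/=; congr (_ + _).
by apply: eq_bigr => i _; rewrite !mxE liftK.
Qed.

Lemma measurable_dot d (w : vec d) : measurable_fun setT (fun t => dot w t).
Proof.
under eq_fun do rewrite dotE; apply: measurable_sum => i.
by apply: measurable_funM; [exact: measurable_cst|exact: measurable_coord].
Qed.

Lemma measurable_dot2 d : measurable_fun setT (fun z : vec d * vec d => dot z.2 z.1).
Proof.
under eq_fun do rewrite dotE; apply: measurable_sum => i; apply: measurable_funM.
  exact: (measurableT_comp (measurable_coord i) measurable_snd).
exact: (measurableT_comp (measurable_coord i) measurable_fst).
Qed.

Definition phase d (w t : vec d) : C := expi (- (2 * pi * dot w t)).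

Lemma phaseDr d (w s t : vec d) : phase w (s + t) = phase w s * phase w t.
Proof. by rewrite /phase -expiD dotDr; congr expi; ring. Qed.

Lemma phaseDl d (v w t : vec d) : phase (v + w) t = phase v t * phase w t.
Proof. by rewrite /phase -expiD dotDl; congr expi; ring. Qed.

Lemma cmeas_phase d (w : vec d) : cmeas (phase w).
Proof.
apply: (cmeas_expi (h := fun t => - (2 * pi * dot w t))); apply: measurable_funN.
by apply: measurable_funM; [exact: measurable_cst|exact: measurable_dot].
Qed.

Lemma cmeas_phase_l d (t : vec d) : cmeas (fun w => phase w t).
Proof.
have -> : (fun w => phase w t) = phase t; last exact: cmeas_phase.
apply/funext => w; rewrite /phase !dotE; congr (expi (- (_ * _))).
by apply: eq_bigr => i _; rewrite mulrC.
Qed.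

Definition fourier d (g : vec d -> C) (w : vec d) : C := cint (leb R d) (fun t => g t * phase w t).

Definition sqint d (g : vec d -> C) : \bar R := (\int[leb R d]_x (cabs2 (g x))%:E)%E.

Lemma sqint_ge0 d (g : vec d -> C) : (0 <= sqint g)%E.
Proof. by apply: integral_ge0 => x _; rewrite lee_fin cabs2_ge0. Qed.

Lemma cintegrable_phase d (g : vec d -> C) w : cintegrable (leb R d) g ->
  cintegrable (leb R d) (fun t => g t * phase w t).
Proof.
move=> cg; apply: cintegrableM => //; first exact: cmeas_phase.
by move=> x; rewrite cabs2_expi.
Qed.

Lemma cmeas_fourier d (g : vec d -> C) : cmeas g -> cmeas (fourier g).
Proof.
move=> mg; apply: (@cmeas_cint1 _ _ _ _ _ (leb R d) (fun z : vec d * vec d => g z.1 * phase z.2 z.1)).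
apply: cmeasM.
  by split; [exact: (measurableT_comp mg.1)|exact: (measurableT_comp mg.2)].
apply: (cmeas_expi (h := fun z : vec d * vec d => - (2 * pi * dot z.2 z.1))).
by apply: measurable_funN; apply: measurable_funM; [exact: measurable_cst|exact: measurable_dot2].
Qed.

Lemma cint_lebS d (h : vec d.+1 -> C) : cintegrable (leb R d.+1) h ->
  cintegrable (prodm mu (leb R d)) (h \o @consv R d) /\
  cint (leb R d.+1) h = cint (prodm mu (leb R d)) (h \o @consv R d).
Proof.
move=> [hr hi]; have key (k : vec d.+1 -> R) : (leb R d.+1).-integrable setT (EFin \o k) ->
   (prodm mu (leb R d)).-integrable setT (EFin \o (k \o @consv R d)) /\
   \int[leb R d.+1]_x k x = \int[prodm mu (leb R d)]_z k (consv z).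
  move=> /integrableP[mk ik].
  have ik' : (prodm mu (leb R d)).-integrable setT (EFin \o (k \o @consv R d)).
    apply/integrableP; split; first exact: (measurableT_comp mk (@measurable_consv R d)).
    have mak : measurable_fun setT (fun x => `|(EFin \o k) x|)%E by exact: measurableT_comp.
    move: ik; rewrite ge0_integral_lebS//.
    rewrite -(fubini_tonelli1 (fun z => `|(EFin \o k) (consv z)|)%E)//.
    exact: (measurableT_comp mak (@measurable_consv R d)).
  split => //; rewrite /Rintegral; congr fine.
  exact: (@integral_pushforward _ _ _ _ _ _ (@measurable_consv R d) (prodm mu (leb R d)) setT _
    mk ik' measurableT).
have [ir er] := key _ hr; have [ii ei] := key _ hi.
by split; [split|apply: complex_ext].
Qed.

(** The partial Fourier transform: [p.1] is a frequency, while [p.2] still holds the remaining space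
    variables. *)
Definition fourier_head d (g : vec d.+1 -> C) (p : T1 * vec d) : C :=
  cint mu (fun x => g (consv (x, p.2)) * expi (- (2 * pi * (p.1 : R) * x))).

Lemma fourierS d (g : vec d.+1 -> C) (a : R) (w : vec d) : cintegrable (leb R d.+1) g ->
  cintegrable (leb R d) (fun v => fourier_head g (a, v)) /\
  fourier g (consv (a, w)) = fourier (fun v => fourier_head g (a, v)) w.
Proof.
move=> cg.
have split_phase x v : phase (consv (a, w)) (consv (x, v)) = expi (- (2 * pi * a * x)) * phase w v.
  by rewrite /phase dot_consv -expiD; congr expi; ring.
have [cg' _] := cint_lebS cg; have mg := cintegrable_cmeas cg'.
have mexp : measurable_fun setT (fun z : T1 * vec d => - (2 * pi * a * (z.1 : R))).
  apply: measurable_funN; apply: measurable_funM => //; exact: measurable_fst.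
have cge : cintegrable (prodm mu (leb R d)) (fun z => g (consv z) * expi (- (2 * pi * a * z.1))).
  exact: (cintegrable_expi cg' mexp).
have [ch eh] := cint_prod2 cge; split; first exact: ch.
have [c1 e1] := cint_lebS (cintegrable_phase (consv (a, w)) cg).
rewrite /fourier e1; have [c2 e2] := cint_prod2 c1; rewrite e2.
apply: ae_eq_cint.
- exact: cintegrable_cmeas c2.
- by apply: cmeasM; [exact: cintegrable_cmeas ch|exact: cmeas_phase].
have := ae_cintegrable2 cge; apply: filterS => v /= cv.
rewrite mulrC -cintZ//; congr cint; apply/funext => x /=.
by rewrite split_phase; ring.
Qed.

Lemma cmeas_fourier_head d (g : vec d.+1 -> C) : cmeas g -> cmeas (fourier_head g).
Proof.
move=> mg; have mc : measurable_fun setT (fun z : T1 * (T1 * vec d) => consv (z.1, z.2.2)).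
  apply: (measurableT_comp (@measurable_consv R d)); apply/measurable_fun_pair => //=.
  exact: (measurableT_comp measurable_snd measurable_snd).
apply: (@cmeas_cint1 _ _ _ _ _ mu (fun z : T1 * (T1 * vec d) =>
  g (consv (z.1, z.2.2)) * expi (- (2 * pi * (z.2.1 : R) * z.1)))).
apply: cmeasM.
  by split; [exact: (measurableT_comp mg.1)|exact: (measurableT_comp mg.2)].
apply: (cmeas_expi (h := fun z : T1 * (T1 * vec d) => - (2 * pi * (z.2.1 : R) * z.1))).
apply: measurable_funN; apply: measurable_funM; last exact: measurable_fst.
apply: measurable_funM; first exact: measurable_cst.
exact: (measurableT_comp measurable_fst measurable_snd).
Qed.

Lemma plancherel_1d (h : T1 -> C) : cintegrable mu h -> (\int[mu]_x (cabs2 (h x))%:E < +oo)%E ->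
  (\int[mu]_w (cabs2 (cint mu (fun x => h x * expi (- (2 * pi * (w : R) * x)))))%:E =
   \int[mu]_x (cabs2 (h x))%:E)%E.
Proof.
move=> [hr hi] hfin.
have mr : measurable_fun setT (fun x => complex.Re (h x)) by apply/measurable_EFinP; case/integrableP: hr.
have mi : measurable_fun setT (fun x => complex.Im (h x)) by apply/measurable_EFinP; case/integrableP: hi.
have m2r := measurable_sqr mr; have m2i := measurable_sqr mi.
have e : (\int[mu]_x (cabs2 (h x))%:E =
    sqnorm (fun x => complex.Re (h x)) + sqnorm (fun x => complex.Im (h x)))%E.
  by rewrite /sqnorm -ge0_integralD//; move=> x _; rewrite lee_fin sqr_ge0.
have nr0 : (0 <= sqnorm (fun x => complex.Re (h x)))%E by apply: integral_ge0 => x _; rewrite lee_fin sqr_ge0.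
have ni0 : (0 <= sqnorm (fun x => complex.Im (h x)))%E.
  by apply: integral_ge0 => x _; rewrite lee_fin sqr_ge0.
rewrite e in hfin *; rewrite -(plancherel1 hr hi).
- apply: eq_integral => w _; congr EFin; rewrite /cabs2 /cint/=.
  have icr := integrable_mul_bounded hr (measurable_cosw (2 * pi * w)) (fun x => abs_cos_le1 _).
  have isr := integrable_mul_bounded hr (measurable_sinw (2 * pi * w)) (fun x => abs_sin_le1 _).
  have ici := integrable_mul_bounded hi (measurable_cosw (2 * pi * w)) (fun x => abs_cos_le1 _).
  have isi := integrable_mul_bounded hi (measurable_sinw (2 * pi * w)) (fun x => abs_sin_le1 _).
  congr (_ ^+ 2 + _ ^+ 2).
    rewrite /cosT /sinT -RintegralD//; apply: eq_Rintegral => x _.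
    by rewrite ReM/= cosN sinN; ring.
  rewrite /cosT /sinT -RintegralB//; apply: eq_Rintegral => x _.
  by rewrite ImM/= cosN sinN; ring.
- by apply: le_lt_trans hfin; rewrite leeDl.
- by apply: le_lt_trans hfin; rewrite leeDr.
Qed.

(** Both hypotheses survive the partial transform: by [fourierS] it is integrable in the remaining
    variables for every first frequency, and it is square integrable for almost every one, because
    [plancherel_1d] on almost every line gives it the finite norm of [g]. The induction hypothesis
    then applies for almost every first frequency. *)
Theorem plancherel d (g : vec d -> C) : cintegrable (leb R d) g -> (sqint g < +oo)%E ->
  sqint (fourier g) = sqint g.
Proof.
elim: d g => [|d IH] g cg gfin.
  rewrite /sqint !integral_leb0; congr EFin.
  have -> : fourier g 0 = g 0 * phase (0 : vec 0) 0.
    by apply: complex_ext; rewrite /= /Rintegral integral_leb0.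
  by rewrite cabs2M cabs2_expi mulr1.
have mg := cintegrable_cmeas cg.
have mF := cmeas_cabs2 (cmeas_fourier mg).
have mg2 := cmeas_cabs2 mg.
have ge0c (T : Type) (f : T -> C) x : (0 <= (cabs2 (f x))%:E)%E by rewrite lee_fin cabs2_ge0.
have mh := cmeas_fourier_head mg; have mh2 := cmeas_cabs2 mh.
pose G := fourier_head g.
have mgc := measurableT_comp mg2 (@measurable_consv R d).
have [cg' _] := cint_lebS cg.
have gE : sqint g = (\int[leb R d]_v \int[mu]_x (cabs2 (g (consv (x, v))))%:E)%E.
  rewrite /sqint ge0_integral_lebS//.
  by apply: (fubini_tonelli (fun z => (cabs2 (g (consv z)))%:E)).
have headE : (\int[mu]_a \int[leb R d]_v (cabs2 (G (a, v)))%:E = sqint g)%E.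
  transitivity (\int[leb R d]_v \int[mu]_a (cabs2 (G (a, v)))%:E)%E.
    by apply: (fubini_tonelli (fun z => (cabs2 (G z))%:E)).
  rewrite gE.
  apply: ge0_ae_eq_integral => //.
  - exact: (measurable_fun_fubini_tonelli_G (fun z => (cabs2 (G z))%:E)).
  - exact: (measurable_fun_fubini_tonelli_G (fun z => (cabs2 (g (consv z)))%:E)).
  - by move=> v _; exact: integral_ge0.
  - by move=> v _; exact: integral_ge0.
  have h1 := ae_cintegrable2 cg'.
  have h2 : {ae leb R d, forall v, (\int[mu]_x (cabs2 (g (consv (x, v))))%:E < +oo)%E}.
    apply: ge0_ae_lty; last by rewrite -gE.
      exact: (measurable_fun_fubini_tonelli_G (fun z => (cabs2 (g (consv z)))%:E)).
    by move=> v; exact: integral_ge0.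
  by apply: filterS2 h1 h2 => v cv fv _; exact: (plancherel_1d cv fv).
rewrite -headE.
transitivity (\int[mu]_a \int[leb R d]_w (cabs2 (fourier g (consv (a, w))))%:E)%E.
  by apply: (ge0_integral_lebS mF).
apply: ge0_ae_eq_integral.
- exact: measurableT.
- by apply: (measurable_fun_fubini_tonelli_F (fun z => (cabs2 (fourier g (consv z)))%:E)) => //;
    exact: (measurableT_comp mF (@measurable_consv R d)).
- exact: (measurable_fun_fubini_tonelli_F (fun z => (cabs2 (G z))%:E)).
- by move=> a _; exact: integral_ge0.
- by move=> a _; exact: integral_ge0.
have : {ae mu, forall a, (\int[leb R d]_v (cabs2 (G (a, v)))%:E < +oo)%E}.
  apply: ge0_ae_lty; last by rewrite headE.
    exact: (measurable_fun_fubini_tonelli_F (fun z => (cabs2 (G z))%:E)).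
  by move=> a; exact: integral_ge0.
apply: filterS => a fa _; have [ca _] := fourierS a 0 cg.
rewrite -[RHS](IH _ ca fa); apply: eq_integral => w _.
by have [_ ->] := fourierS a w cg.
Qed.

End FourierRd.

(** * Finite sums of translates, and truncation to boxes *)

Section TranslateSums.
Variable R : realType.
Local Notation C := R[i].
Local Notation vec d := ('rV[R]_d).
Local Notation mu := (@lebesgue_measure R).

Lemma integral_shift d (a : vec d) (f : vec d -> \bar R) : measurable_fun setT f ->
  (\int[leb R d]_x f (x + a)%R = \int[leb R d]_x f x)%E.
Proof.
move=> mf; rewrite [LHS]integralE [RHS]integralE; congr (_ - _)%E.
  rewrite -[RHS](ge0_integral_shift a)//; last exact: measurable_funepos.
  by apply: eq_integral => x _; rewrite !funeposE.
rewrite -[RHS](ge0_integral_shift a)//; last exact: measurable_funeneg.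
by apply: eq_integral => x _; rewrite !funenegE.
Qed.

Lemma integrable_shift d (a : vec d) (f : vec d -> \bar R) : (leb R d).-integrable setT f ->
  (leb R d).-integrable setT (fun x => f (x + a)).
Proof.
move=> /integrableP[mf ff]; apply/integrableP; split.
  exact: (measurableT_comp mf (measurable_addv a)).
rewrite (integral_shift a (f := fun x => `|f x|)%E)//.
exact: measurableT_comp.
Qed.

Lemma cmeas_transl d (a : vec d) (g : vec d -> C) : cmeas g -> cmeas (transl a g).
Proof.
by move=> [mr mi]; split; [exact: (measurableT_comp mr (measurable_addv (- a)))|
  exact: (measurableT_comp mi (measurable_addv (- a)))].
Qed.

Lemma cintegrable_transl d (a : vec d) (g : vec d -> C) :
  cintegrable (leb R d) g -> cintegrable (leb R d) (transl a g).
Proof. by move=> [ir ii]; split; [exact: (integrable_shift (- a) ir)|exact: (integrable_shift (- a) ii)]. Qed.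

Lemma cint_transl d (a : vec d) (g : vec d -> C) :
  cintegrable (leb R d) g -> cint (leb R d) (transl a g) = cint (leb R d) g.
Proof.
move=> /cintegrable_cmeas[mr mi]; apply: complex_ext; rewrite /= /Rintegral; congr fine.
  by apply: (integral_shift (- a) (f := fun x => (complex.Re (g x))%:E)); exact/measurable_EFinP.
by apply: (integral_shift (- a) (f := fun x => (complex.Im (g x))%:E)); exact/measurable_EFinP.
Qed.

Lemma sqint_transl d (a : vec d) (g : vec d -> C) : cmeas g -> sqint (transl a g) = sqint g.
Proof.
move=> mg; rewrite /sqint.
exact: (integral_shift (- a) (f := fun x => (cabs2 (g x))%:E) (cmeas_cabs2 mg)).
Qed.

Lemma fourier_transl d (a : vec d) (g : vec d -> C) w : cintegrable (leb R d) g ->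
  fourier (transl a g) w = phase w a * fourier g w.
Proof.
move=> cg; rewrite /fourier -cintZ//; last exact: cintegrable_phase.
rewrite -(cint_transl a (g := fun t => phase w a * (g t * phase w t))).
  congr cint; apply/funext => t; rewrite /transl.
  have -> : phase w t = phase w a * phase w (t - a) by rewrite -phaseDr addrC subrK.
  by ring.
by apply: cintegrableZ; exact: cintegrable_phase.
Qed.

Lemma sqintD_le d (f g : vec d -> C) : cmeas f -> cmeas g ->
  (sqint (fun x => f x + g x)%R <= 2%:E * sqint f + 2%:E * sqint g)%E.
Proof.
move=> mf mg; have mf2 := cmeas_cabs2 mf; have mg2 := cmeas_cabs2 mg.
rewrite -!ge0_integralZl_EFin//; try by move=> x _; rewrite lee_fin cabs2_ge0.
rewrite -ge0_integralD//; first last.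
- exact: measurable_funeM.
- by move=> x _; rewrite -EFinM lee_fin mulr_ge0 ?cabs2_ge0.
- exact: measurable_funeM.
- by move=> x _; rewrite -EFinM lee_fin mulr_ge0 ?cabs2_ge0.
apply: ge0_le_integral => //.
- by move=> x _; rewrite lee_fin cabs2_ge0.
- by apply: cmeas_cabs2; exact: cmeasD.
- by apply: emeasurable_funD; exact: measurable_funeM.
by move=> x _; rewrite -!EFinM -EFinD lee_fin cabs2D_le.
Qed.

Lemma sqintB_sym d (f g : vec d -> C) : sqint (fun x => f x - g x) = sqint (fun x => g x - f x).
Proof. by apply: eq_integral => x _; rewrite -cabs2N opprB. Qed.

Lemma sqint_le2 d (f g : vec d -> C) : cmeas f -> cmeas g ->
  (sqint f <= 2%:E * sqint (fun x => f x - g x)%R + 2%:E * sqint g)%E.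
Proof.
move=> mf mg; have := sqintD_le (cmeasB mf mg) mg.
by under [X in (sqint X <= _)%E -> _]eq_fun do rewrite subrK.
Qed.

Lemma sqintM_le d (p f : vec d -> C) (B : R) : cmeas p -> cmeas f -> 0 <= B -> (forall x, cabs2 (p x) <= B) ->
  (sqint (fun x => p x * f x)%R <= B%:E * sqint f)%E.
Proof.
move=> mp mf B0 pB; have mf2 := cmeas_cabs2 mf.
rewrite -ge0_integralZl_EFin//; last by move=> x _; rewrite lee_fin cabs2_ge0.
apply: ge0_le_integral => //.
- by move=> x _; rewrite lee_fin cabs2_ge0.
- by apply: cmeas_cabs2; exact: cmeasM.
- exact: measurable_funeM.
by move=> x _; rewrite -EFinM lee_fin cabs2M ler_wpM2r ?cabs2_ge0.
Qed.

Section sums.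
Variables (d : nat) (I : eqType) (lam : I -> vec d) (b : I -> C).
Implicit Types (s : seq I) (g : vec d -> C).

Definition tsum s g t : C := \sum_(k <- s) b k * transl (lam k) g t.
Definition trig s (w : vec d) : C := \sum_(k <- s) b k * phase w (lam k).

Lemma cmeas_tsum s g : cmeas g -> cmeas (tsum s g).
Proof.
move=> mg; apply: (cmeas_sum s (F := fun k t => b k * transl (lam k) g t)) => k.
by apply: cmeasM; [exact: cmeas_cst|exact: cmeas_transl].
Qed.

Lemma cmeas_trig s : cmeas (trig s).
Proof.
apply: (cmeas_sum s (F := fun k w => b k * phase w (lam k))) => k.
by apply: cmeasM; [exact: cmeas_cst|exact: cmeas_phase_l].
Qed.

Lemma tsumB s g1 g2 t : tsum s (fun x => g1 x - g2 x) t = tsum s g1 t - tsum s g2 t.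
Proof. by rewrite /tsum -sumrB; apply: eq_bigr => k _; rewrite /transl mulrBr. Qed.

Lemma trig_bounded s : exists2 B : R, 0 <= B & forall w, cabs2 (trig s w) <= B.
Proof.
elim: s => [|k s [B B0 hB]].
  by exists 0 => // w; rewrite /trig big_nil /cabs2/= expr0n addr0.
exists (2 * cabs2 (b k) + 2 * B); first by rewrite addr_ge0 ?mulr_ge0 ?cabs2_ge0.
move=> w; rewrite /trig big_cons; apply: (le_trans (cabs2D_le _ _)).
by rewrite cabs2M cabs2_expi mulr1 lerD2l ler_wpM2l//; exact: hB.
Qed.

(** A crude bound that grows with [s]: it serves to pass to the limit in [g] with [s] fixed. Bounds
    uniform in [s] come from [riesz_bounds]. *)
Lemma tsum_bounded s : exists2 B : R, 0 <= B &
  forall g, cmeas g -> (sqint (tsum s g) <= B%:E * sqint g)%E.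
Proof.
elim: s => [|k s [B B0 hB]].
  exists 0 => // g mg; rewrite mul0e /sqint /tsum.
  by under eq_integral do rewrite big_nil /cabs2/= expr0n addr0; rewrite integral0.
exists (2 * cabs2 (b k) + 2 * B); first by rewrite addr_ge0 ?mulr_ge0 ?cabs2_ge0.
move=> g mg; have mt := cmeas_transl (lam k) mg.
have -> : tsum (k :: s) g = (fun t => b k * transl (lam k) g t + tsum s g t).
  by apply/funext => t; rewrite /tsum big_cons.
apply: (le_trans (sqintD_le _ _)).
- by apply: cmeasM => //; exact: cmeas_cst.
- exact: cmeas_tsum.
have -> : ((2 * cabs2 (b k) + 2 * B)%:E * sqint g =
    (2 * cabs2 (b k))%:E * sqint g + (2 * B)%:E * sqint g)%E.
  by rewrite EFinD ge0_muleDl// lee_fin mulr_ge0 ?cabs2_ge0.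
apply: leeD.
  rewrite EFinM -muleA lee_wpmul2l//.
  rewrite -(sqint_transl (lam k) mg); apply: (sqintM_le (p := fun=> b k)) => //.
  exact: cabs2_ge0.
by rewrite EFinM -muleA lee_wpmul2l//; exact: hB.
Qed.

Lemma cintegrable_tsum s g : cintegrable (leb R d) g -> cintegrable (leb R d) (tsum s g).
Proof.
move=> cg; apply: (cintegrable_sum s (F := fun k t => b k * transl (lam k) g t)) => k.
by apply: cintegrableZ; exact: cintegrable_transl.
Qed.

Lemma fourier_tsum s g w : cintegrable (leb R d) g ->
  fourier (tsum s g) w = trig s w * fourier g w.
Proof.
move=> cg; rewrite /fourier /tsum /trig mulr_suml.
under [in LHS]eq_fun do rewrite mulr_suml.
rewrite cint_sum; last first.
  by move=> k; apply: cintegrable_phase; apply: cintegrableZ; exact: cintegrable_transl.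
apply: eq_bigr => k _; rewrite -mulrA -(fourier_transl (lam k) w cg) /fourier -cintZ.
  by congr cint; apply/funext => t; rewrite mulrA.
by apply: cintegrable_phase; exact: cintegrable_transl.
Qed.

Lemma sqint_tsum s g : cintegrable (leb R d) g -> (sqint g < +oo)%E ->
  sqint (tsum s g) = sqint (fun w => trig s w * fourier g w).
Proof.
move=> cg gf; have [B B0 hB] := tsum_bounded s.
rewrite -plancherel; last 2 first.
- exact: cintegrable_tsum.
- apply: (le_lt_trans (hB _ (cintegrable_cmeas cg))).
  by rewrite lte_mul_pinfty ?lee_fin.
by apply: eq_integral => w _; rewrite fourier_tsum.
Qed.

End sums.

Definition box d (n : nat) : set (vec d) := [set t | forall i, `|t 0 i| <= n%:R].

Lemma measurable_box d n : measurable (@box d n).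
Proof.
rewrite (_ : @box d n = \bigcap_(i in [set: 'I_d]) [set t | `|t 0 i| <= n%:R]); last first.
  by apply/seteqP; split=> [t h i _|t h i]; exact: h.
apply: fin_bigcap_measurable => // i _.
have : measurable (setT `&` (fun t : vec d => t 0 i) @^-1` `[- (n%:R : R), n%:R]).
  by apply: (measurable_coord i) => //; exact: measurable_itv.
rewrite setTI; congr measurable.
by apply/seteqP; split => t /=; rewrite in_itv/= ler_norml.
Qed.

Lemma box_consv d n x (v : vec d) : box n (consv (x, v)) <-> (`|x| <= n%:R /\ box n v).
Proof.
split=> [h|[hx hv] i].
  split; first by have := h ord0; rewrite mxE unlift_none.
  by move=> i; have := h (lift ord0 i); rewrite mxE liftK.
by rewrite mxE; case: unliftP => [j|] _ //=; exact: hv.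
Qed.

Lemma leb_box_lty d n : (leb R d (@box d n) < +oo)%E.
Proof.
rewrite -[box n]setIT -integral_indic//; last exact: measurable_box.
have mb e : measurable_fun setT (EFin \o \1_(@box e n)).
  by apply/measurable_EFinP; apply: measurable_indic; exact: measurable_box.
elim: d => [|d IH]; first by rewrite integral_leb0 ltry.
rewrite ge0_integral_lebS//.
pose J := [set x : R | `|x| <= n%:R].
have JE : J = `[- n%:R, n%:R]%classic.
  by apply/seteqP; split => x; rewrite /J/= in_itv/= ler_norml.
have -> : (\int[mu]_x \int[leb R d]_v (\1_(box n) (consv (x, v)))%:E =
   \int[mu]_x ((\1_J x)%:E * \int[leb R d]_v (\1_(box n) v)%:E))%E.
  apply: eq_integral => x _; rewrite -ge0_integralZl_EFin//; last exact: mb.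
  apply: eq_integral => v _; rewrite -EFinM; congr EFin; rewrite !indicE -natrM mulnb.
  congr (_%:R); congr nat_of_bool; apply/idP/andP.
    by rewrite !inE => /box_consv[].
  by rewrite !inE => -[? ?]; apply/box_consv.
have mJ : measurable (J : set (measurableTypeR R)) by rewrite JE; exact: measurable_itv.
rewrite ge0_integralZr//; first last.
- by apply: integral_ge0 => x _; rewrite lee_fin.
- by apply/measurable_EFinP; exact: measurable_indic.
have J0 : (0 <= \int[mu]_x (\1_J x)%:E)%E by apply: integral_ge0 => x _; rewrite lee_fin.
rewrite lte_mul_pinfty// ge0_fin_numE// integral_indic// setIT.
by apply: compact_finite_measure; rewrite JE; exact: segment_compact.
Qed.

Lemma truncE d n (h : vec d -> C) t : trunc n h t = (\1_(box n) t)%:C%C * h t.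
Proof.
rewrite /trunc indicE; case: asboolP => [bt|bt].
  by rewrite mem_set// mul1r.
by rewrite memNset// mul0r.
Qed.

Definition cL2 d (f : vec d -> C) := cmeas f /\ (sqint f < +oo)%E.

Lemma cmeas_trunc d n (h : vec d -> C) : cmeas h -> cmeas (trunc n h).
Proof.
move=> mh; rewrite (funext (truncE n h)); apply: cmeasM => //; split => /=.
  by apply: measurable_indic; exact: measurable_box.
exact: measurable_cst.
Qed.

Lemma cabs2_trunc_le d n (h : vec d -> C) t : cabs2 (trunc n h t) <= cabs2 (h t).
Proof. by rewrite /trunc; case: ifP => // _; rewrite {1}/cabs2/= expr0n addr0 cabs2_ge0. Qed.

Lemma cabs2_sub_trunc_le d n (h : vec d -> C) t : cabs2 (h t - trunc n h t) <= cabs2 (h t).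
Proof.
rewrite /trunc; case: ifP => // _; last by rewrite subr0.
by rewrite subrr {1}/cabs2/= expr0n addr0 cabs2_ge0.
Qed.

Lemma sqint_mono d (f g : vec d -> C) : cmeas f -> cmeas g ->
  (forall t, cabs2 (f t) <= cabs2 (g t)) -> (sqint f <= sqint g)%E.
Proof.
move=> mf mg fg; apply: ge0_le_integral => //.
- by move=> x _; rewrite lee_fin cabs2_ge0.
- exact: cmeas_cabs2.
- exact: cmeas_cabs2.
by move=> x _; rewrite lee_fin.
Qed.

Lemma cL2_trunc d n (h : vec d -> C) : cL2 h -> cL2 (trunc n h).
Proof.
move=> [mh fh]; split; first exact: cmeas_trunc.
apply: le_lt_trans fh; apply: sqint_mono => //; first exact: cmeas_trunc.
by move=> t; exact: cabs2_trunc_le.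
Qed.

(** On the box |u| <= 1 + u^2, and the box has finite measure; so truncation puts an L^2 function
    into L^1, where the Fourier integral makes sense. *)
Lemma cintegrable_trunc d n (h : vec d -> C) : cL2 h -> cintegrable (leb R d) (trunc n h).
Proof.
move=> [mh fh]; have mt := cmeas_trunc n mh; have mb := @measurable_box d n.
have idom : (leb R d).-integrable setT (fun t => (\1_(box n) t + cabs2 (h t))%:E).
  under eq_fun do rewrite EFinD; apply: integrableD => //.
    apply: ge0_integrable; last by rewrite integral_indic// setIT leb_box_lty.
      by apply/measurable_EFinP; exact: measurable_indic.
    by move=> x; rewrite lee_fin.
  by apply: ge0_integrable => //; [exact: cmeas_cabs2|move=> x; rewrite lee_fin cabs2_ge0].
have bound (u : R) t : u ^+ 2 <= cabs2 (trunc n h t) -> `|u| <= \1_(box n) t + cabs2 (h t).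
  rewrite truncE cabs2M indicE; case: (t \in box n); rewrite /cabs2/=.
    by rewrite expr1n expr0n addr0 mul1r => h1; rewrite ler_norml; apply/andP; split; nra.
  by rewrite !expr0n/= addr0 mul0r add0r => h1; rewrite ler_norml; apply/andP; split; nra.
split; apply: (le_integrable measurableT _ _ idom).
- by apply/measurable_EFinP; exact: mt.1.
- move=> t _; rewrite /= lee_fin [leRHS]ger0_norm; last by apply: addr_ge0 => //; exact: cabs2_ge0.
  by apply: bound; rewrite lerDl sqr_ge0.
- by apply/measurable_EFinP; exact: mt.2.
- move=> t _; rewrite /= lee_fin [leRHS]ger0_norm; last by apply: addr_ge0 => //; exact: cabs2_ge0.
  by apply: bound; rewrite lerDr sqr_ge0.
Qed.

Lemma trunc_cvg d (h : vec d -> C) : cL2 h -> forall eps : R, 0 < eps -> exists N,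
  forall n, (N <= n)%N -> (sqint (fun t => h t - trunc n h t)%R < eps%:E)%E.
Proof.
move=> [mh fh] eps eps0.
have : (sqint (fun t => h t - trunc n h t)%R @[n --> \oo] --> 0%E).
  rewrite -(integral0 (leb R d) setT); apply: (@dominated_cvg _ _ _ (leb R d) setT measurableT
    (fun n t => (cabs2 (h t - trunc n h t))%:E) (cst 0%E) (fun x => (cabs2 (h x))%:E)) => //.
  - by move=> n; apply: cmeas_cabs2; apply: cmeasB => //; exact: cmeas_trunc.
  - move=> t _ /=; apply: (@cvg_near_cst _ _ _ _ _).
    have := nbhs_infty_ger (\big[Num.max/0]_(i < d) `|t 0 i|); apply: filterS => n tn.
    rewrite /trunc asboolT; first by rewrite subrr /cabs2/= expr0n addr0.
    by move=> i; apply: le_trans tn; exact: le_bigmax.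
  - by apply: ge0_integrable => //; [exact: cmeas_cabs2|move=> x; rewrite lee_fin cabs2_ge0].
  - by move=> n t _; rewrite gee0_abs ?lee_fin ?cabs2_ge0//; exact: cabs2_sub_trunc_le.
move=> /(_ _ (open_ereal_lt' (x := 0%E) (y := eps%:E) _)) /=; rewrite lte_fin => /(_ eps0).
by case=> N _ hN; exists N.
Qed.

End TranslateSums.

(** * The Fourier transform on L^2 *)

Section FourierL2.
Variable R : realType.
Local Notation C := R[i].
Local Notation vec d := ('rV[R]_d).

Lemma cL2_complete d (u : nat -> vec d -> C) : (forall n, cmeas (u n)) ->
  (forall eps : R, 0 < eps -> exists N, forall m n, (N <= m)%N -> (N <= n)%N ->
     (sqint (fun x => u m x - u n x)%R < eps%:E)%E) ->
  exists2 v : vec d -> C, cmeas v & forall eps : R, 0 < eps ->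
    exists N, forall n, (N <= n)%N -> (sqint (fun x => v x - u n x)%R < eps%:E)%E.
Proof.
move=> mu_ cau.
have mB m n := cmeasB (mu_ m) (mu_ n).
have part (p : C -> R) : (forall x y : C, p (x - y) = p x - p y) ->
    (forall n, measurable_fun setT (fun x => p (u n x))) -> (forall x : C, p x ^+ 2 <= cabs2 x) ->
    forall eps : R, 0 < eps -> exists N, forall m n, (N <= m)%N -> (N <= n)%N ->
     (\int[leb R d]_x ((p (u m x) - p (u n x)) ^+ 2)%:E < eps%:E)%E.
  move=> pB mp ple eps eps0; have [N hN] := cau _ eps0; exists N => m n mN nN.
  apply: le_lt_trans (hN m n mN nN); apply: ge0_le_integral => //.
  - by move=> x _; rewrite lee_fin sqr_ge0.
  - by apply: measurable_sqr; exact: measurable_funB.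
  - exact: cmeas_cabs2.
  by move=> x _; rewrite lee_fin -pB; exact: ple.
have [|vr mvr hr] := @L2_complete _ _ R (leb R d) (fun n x => complex.Re (u n x)) (fun n => (mu_ n).1).
  apply: (part (@complex.Re R)) => [x y|n|x]; [by rewrite ReD ReN|exact: (mu_ n).1|].
  by rewrite lerDl sqr_ge0.
have [|vi mvi hi] := @L2_complete _ _ R (leb R d) (fun n x => complex.Im (u n x)) (fun n => (mu_ n).2).
  apply: (part (@complex.Im R)) => [x y|n|x]; [by rewrite ImD ImN|exact: (mu_ n).2|].
  by rewrite lerDr sqr_ge0.
exists (fun x => Complex (vr x) (vi x)) => // eps eps0.
have e4 : 0 < eps / 4 by rewrite divr_gt0.
have [N1 h1] := hr _ e4; have [N2 h2] := hi _ e4.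
exists (maxn N1 N2) => n; rewrite geq_max => /andP[/h1 {}h1 /h2 {}h2].
have -> : sqint (fun x => Complex (vr x) (vi x) - u n x) =
    (\int[leb R d]_x ((vr x - complex.Re (u n x)) ^+ 2)%:E +
     \int[leb R d]_x ((vi x - complex.Im (u n x)) ^+ 2)%:E)%E.
  rewrite -ge0_integralD//; first last.
  - by apply: measurable_sqr; apply: measurable_funB => //; exact: (mu_ n).2.
  - by move=> x _; rewrite lee_fin sqr_ge0.
  - by apply: measurable_sqr; apply: measurable_funB => //; exact: (mu_ n).1.
  - by move=> x _; rewrite lee_fin sqr_ge0.
  by apply: eq_integral => x _; rewrite -EFinD /cabs2 ReD ImD ReN ImN.
apply: (@le_lt_trans _ _ ((eps / 4)%:E + (eps / 4)%:E)%E); first exact: leeD.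
by rewrite -EFinD lte_fin; lra.
Qed.

Definition fourier_limit d (psi Psi : vec d -> C) := cmeas Psi /\
  forall eps : R, 0 < eps -> exists N, forall n, (N <= n)%N ->
    (sqint (fun w => Psi w - fourier (trunc n psi) w)%R < eps%:E)%E.

Lemma fourierB d (g h : vec d -> C) w : cintegrable (leb R d) g -> cintegrable (leb R d) h ->
  fourier (fun x => g x - h x) w = fourier g w - fourier h w.
Proof.
move=> cg ch; rewrite /fourier -mulN1r -cintZ; last exact: cintegrable_phase.
rewrite -cintD; first by congr cint; apply/funext => x; ring.
  exact: cintegrable_phase.
by apply: cintegrableZ; exact: cintegrable_phase.
Qed.

Lemma cintegrableB d (g h : vec d -> C) : cintegrable (leb R d) g -> cintegrable (leb R d) h ->
  cintegrable (leb R d) (fun x => g x - h x).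
Proof.
move=> cg ch; rewrite (_ : (fun x => _) = (fun x => g x + (- 1) * h x)).
  by apply: cintegrableD => //; exact: cintegrableZ.
by apply/funext => x; rewrite mulN1r.
Qed.

(** Part (2) is given a transform of mu(S)^-1 phi, part (1) is not and takes it from here.
    Plancherel turns the convergence of the truncations into a Cauchy property of their
    transforms. *)
Lemma fourier_limit_exists d (psi : vec d -> C) : cL2 psi -> exists Psi, fourier_limit psi Psi.
Proof.
move=> psiL2; have mpsi := psiL2.1.
have [n|eps eps0|Psi mPsi hPsi] := @cL2_complete d (fun n => fourier (trunc n psi)).
- by apply: cmeas_fourier; exact: cmeas_trunc.
- have e4 : 0 < eps / 4 by rewrite divr_gt0.
  have [N hN] := trunc_cvg psiL2 e4; exists N => m n mN nN.
  have cm := cintegrable_trunc m psiL2; have cn := cintegrable_trunc n psiL2.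
  have mm := cmeas_trunc m mpsi; have mn := cmeas_trunc n mpsi.
  have -> : sqint (fun x => fourier (trunc m psi) x - fourier (trunc n psi) x) =
     sqint (fourier (fun x => trunc m psi x - trunc n psi x)).
    by apply: eq_integral => w _; rewrite fourierB.
  have h : (sqint (fun x => trunc m psi x - trunc n psi x)%R < eps%:E)%E.
    have -> : (fun x => trunc m psi x - trunc n psi x) =
        (fun x => (psi x - trunc n psi x) + - (psi x - trunc m psi x)).
      by apply/funext => x; ring.
    apply: (le_lt_trans (sqintD_le _ _)); [exact: cmeasB|by apply: cmeasN; exact: cmeasB|].
    have -> : sqint (fun x => - (psi x - trunc m psi x)) = sqint (fun x => psi x - trunc m psi x).
      by apply: eq_integral => x _; rewrite cabs2N.
    rewrite (_ : eps%:E = (2%:E * (eps / 4)%:E + 2%:E * (eps / 4)%:E)%E); last first.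
      by rewrite -!EFinM -EFinD; congr EFin; field.
    by apply: lteD; rewrite lte_pmul2l//; exact: hN.
  by rewrite plancherel//; [exact: cintegrableB|exact: (lt_trans h (ltry _))].
by exists Psi.
Qed.

(** Two comparisons, each losing a factor 2, give 4 on [z]; the errors add up to 2 * del / 4 + 4 *
    del / 8 = del. *)
Lemma two_step (x y z a b : \bar R) (del : R) : (x <= 2%:E * a + 2%:E * y)%E ->
  (y <= 2%:E * b + 2%:E * z)%E -> (a <= (del / 4)%:E)%E -> (b <= (del / 8)%:E)%E -> (0 <= b)%E ->
  0 <= del -> (0 <= z)%E -> (x <= 4%:E * z + del%:E)%E.
Proof.
move=> xy yz al bl b0 d0 z0; apply: (le_trans xy).
apply: (@le_trans _ _ (2%:E * (del / 4)%:E + 2%:E * (2%:E * (del / 8)%:E + 2%:E * z))%E).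
  apply: leeD; first by rewrite lee_wpmul2l.
  rewrite lee_wpmul2l//; apply: (le_trans yz); apply: leeD => //.
  by rewrite lee_wpmul2l.
case: z {xy yz} z0 => [z| |] // z0; last first.
  by rewrite [leRHS](_ : _ = +oo%E) ?leey// gt0_muley ?lte_fin// addye.
by rewrite -!EFinM -!EFinD lee_fin; lra.
Qed.

(* Equality holds with constant 1; the constant 4 comes from the truncation
   argument and is harmless, as only two-sided bounds are needed. *)
Lemma tsum_trig d (I : eqType) (lam : I -> vec d) (b : I -> C) (s : seq I) (psi Psi : vec d -> C) :
  cL2 psi -> fourier_limit psi Psi ->
  (sqint (tsum lam b s psi) <= 4%:E * sqint (fun w => trig lam b s w * Psi w)%R)%E /\
  (sqint (fun w => trig lam b s w * Psi w)%R <= 4%:E * sqint (tsum lam b s psi))%E.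
Proof.
move=> psiL2 [mPsi hPsi]; have mpsi := psiL2.1.
have [B B0 hB] := tsum_bounded lam b s; have [B' B'0 hB'] := trig_bounded lam b s.
have mt := cmeas_trig lam b s.
have appr (del : R) : 0 < del -> exists n,
   (sqint (fun t => tsum lam b s psi t - tsum lam b s (trunc n psi) t)%R <= del%:E)%E /\
   (sqint (fun w => trig lam b s w * Psi w - trig lam b s w * fourier (trunc n psi) w)%R <= del%:E)%E.
  move=> del0; have [|N1 h1] := trunc_cvg psiL2 (eps := del / (B + 1)).
    by rewrite divr_gt0// ltr_wpDl.
  have [|N2 h2] := hPsi (del / (B' + 1)); first by rewrite divr_gt0// ltr_wpDl.
  have le1 (D : R) : 0 <= D -> (D%:E * (del / (D + 1))%:E <= del%:E)%E.
    move=> D0; rewrite -EFinM lee_fin mulrCA ler_piMr ?(ltW del0)//.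
    by rewrite ler_pdivrMr ?mul1r ?lerDl// ltr_wpDl.
  exists (maxn N1 N2); set n := maxn N1 N2.
  have mn := cmeas_trunc n mpsi; have mF := cmeas_fourier mn; split.
    under [X in sqint X]eq_fun do rewrite -tsumB.
    apply: (le_trans (hB _ (cmeasB mpsi mn))); apply: (le_trans _ (le1 _ B0)).
    by rewrite lee_wpmul2l ?lee_fin//; apply/ltW/h1; exact: leq_maxl.
  under [X in sqint X]eq_fun do rewrite -mulrBr.
  apply: (le_trans (sqintM_le mt (cmeasB mPsi mF) B'0 hB')); apply: (le_trans _ (le1 _ B'0)).
  by rewrite lee_wpmul2l ?lee_fin//; apply/ltW/h2; exact: leq_maxr.
have step n : sqint (tsum lam b s (trunc n psi)) =
    sqint (fun w => trig lam b s w * fourier (trunc n psi) w).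
  by apply: sqint_tsum; [exact: cintegrable_trunc|exact: (cL2_trunc n psiL2).2].
have mn n := cmeas_tsum lam b s (cmeas_trunc n mpsi).
have mF n := cmeasM mt (cmeas_fourier (cmeas_trunc n mpsi)).
have ms := cmeas_tsum lam b s mpsi; have mtP := cmeasM mt mPsi.
split; apply/lee_addgt0Pr => del del0.
  have [|n [h1 h2]] := appr (del / 8); first by rewrite divr_gt0.
  have yz := sqint_le2 (mF n) mtP; rewrite -step in yz.
  apply: (two_step (sqint_le2 ms (mn n)) yz); rewrite ?sqint_ge0 ?(ltW del0)//.
  - by apply: (le_trans h1); rewrite lee_fin; lra.
  - by rewrite sqintB_sym.
have [|n [h1 h2]] := appr (del / 8); first by rewrite divr_gt0.
have yz := sqint_le2 (mn n) ms; rewrite step in yz.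
apply: (two_step (sqint_le2 mtP (mF n)) yz); rewrite ?sqint_ge0 ?(ltW del0)//.
- by apply: (le_trans h2); rewrite lee_fin; lra.
- by rewrite sqintB_sym.
Qed.

End FourierL2.

(** * Zero sets of trigonometric polynomials *)

Section ZeroSets.
Variable R : realType.
Local Notation C := R[i].
Local Notation vec d := ('rV[R]_d).
Local Notation mu := (@lebesgue_measure R).
Local Notation T1 := (measurableTypeR R).

Definition isolated_in (Z : set R) : set R :=
  [set x | Z x /\ exists2 e : R, 0 < e & forall y, Z y -> `|y - x| < e -> y = x].

(** An isolated point is the only point of Z in some interval with rational end points, and there
    are countably many such intervals. *)
Lemma countable_isolated_in (Z : set R) : countable (isolated_in Z).
Proof.
have /boolp.choice[f hf] (x : R) : exists pq : rat * rat, isolated_in Z x ->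
    ratr pq.1 < x < ratr pq.2 /\ forall y, Z y -> ratr pq.1 < y < ratr pq.2 -> y = x.
  have [Ix|nIx] := pselect (isolated_in Z x); last by exists (0, 0).
  case: Ix => Zx [e e0 h].
  have [p] : exists p : rat, ratr p \in `](x - e), x[ by apply: rat_in_itvoo; lra.
  have [q] : exists q : rat, ratr q \in `]x, (x + e)[ by apply: rat_in_itvoo; lra.
  rewrite !in_itv/= => /andP[q1 q2] /andP[p1 p2]; exists (p, q) => _ /=; split.
    by rewrite p2 q1.
  by move=> y Zy /andP[y1 y2]; apply: h => //; rewrite ltr_norml; lra.
apply/countable_injP; exists (fun x => pickle (f x)) => x y /set_mem Ix /set_mem Iy.
move=> /(pcan_inj pickleK) fxy; have [hx _] := hf _ Ix; have [_ uy] := hf _ Iy.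
by apply: uy; [case: Ix|rewrite -fxy].
Qed.

(** Zeros of f arbitrarily close to x make the difference quotient vanish there, so it cannot tend
    to a nonzero [l]. *)
Lemma derive_at_accumulation (f : R -> R) (x l : R) (Z : set R) :
  (forall y, Z y -> f y = 0) -> Z x -> ~ isolated_in Z x -> is_derive x (1 : R) f l -> l = 0.
Proof.
move=> fZ Zx nI dl; apply/eqP; apply: contrapT => /negP l0.
have := @ex_derive _ _ _ _ _ _ _ dl; have := @derive_val _ _ _ _ _ _ _ dl => dv /cvg_ex[l' cl'].
have l'l : l' = l by rewrite -dv; apply/esym/cvg_lim => //.
move: cl'; rewrite l'l => /cvgrPdist_lt /(_ `|l|); rewrite normr_gt0 => /(_ l0).
rewrite near_withinE => /nbhs_ballP[e /= e0 he]; apply: nI; split=> //; exists e => // y Zy yx.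
apply: contrapT => /eqP nyx; have := he (y - x); rewrite /ball/= sub0r normrN => /(_ yx).
rewrite subr_eq0 => /(_ nyx); rewrite /GRing.scale/= mulr1 subrK (fZ _ Zy) (fZ _ Zx) subr0 mulr0 subr0.
by rewrite ltxx.
Qed.

Section exponential_sums.
Variable I : eqType.
Implicit Types (A : seq I) (gam : I -> C) (th : I -> R).

Definition expsum A gam th (x : R) : C := \sum_(a <- A) gam a * expi (th a * x).

Lemma is_derive_expsum A gam th (x : R) :
  is_derive x (1 : R) (fun x => complex.Re (expsum A gam th x))
    (complex.Re (expsum A (fun a => gam a * Complex 0 (th a)) th x)) /\
  is_derive x (1 : R) (fun x => complex.Im (expsum A gam th x))
    (complex.Im (expsum A (fun a => gam a * Complex 0 (th a)) th x)).
Proof.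
elim: A => [|a A [IHr IHi]].
  by rewrite /expsum; split; under eq_fun do rewrite big_nil; rewrite big_nil; exact: is_derive_cst.
have dc (k : R) := @is_deriveZ _ _ _ (fun x => cos (th a * x)) k x 1 _ (is_derive_cos_mull (th a) x).
have ds (k : R) := @is_deriveZ _ _ _ (fun x => sin (th a * x)) k x 1 _ (is_derive_sin_mull (th a) x).
split.
  rewrite (_ : (fun x => complex.Re (expsum (a :: A) gam th x)) =
     ((fun x => complex.Re (gam a) *: cos (th a * x)) - (fun x => complex.Im (gam a) *: sin (th a * x))
      + (fun x => complex.Re (expsum A gam th x)))); last first.
    by apply/funext => y; rewrite /expsum big_cons ReD ReM.
  have h := is_deriveD (is_deriveB (dc (complex.Re (gam a))) (ds (complex.Im (gam a)))) IHr.
  apply: (is_derive_cast h); rewrite [in RHS]/expsum big_cons ReD !ReM ?ImM/= /GRing.scale/=.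
  by congr (_ + _); ring.
rewrite (_ : (fun x => complex.Im (expsum (a :: A) gam th x)) =
     ((fun x => complex.Re (gam a) *: sin (th a * x)) + (fun x => complex.Im (gam a) *: cos (th a * x))
      + (fun x => complex.Im (expsum A gam th x)))); last first.
  by apply/funext => y; rewrite /expsum big_cons ImD ImM.
have h := is_deriveD (is_deriveD (ds (complex.Re (gam a))) (dc (complex.Im (gam a)))) IHi.
apply: (is_derive_cast h); rewrite [in RHS]/expsum big_cons ImD !ImM ?ReM/= /GRing.scale/=.
by congr (_ + _); ring.
Qed.

(* Factoring out one exponential and differentiating removes one term; a zero
   that is not a zero of the derivative is isolated. *)
Lemma countable_expsum_zeros A gam th : uniq A -> {in A &, injective th} ->
  has (fun a => gam a != 0) A -> countable [set x | expsum A gam th x = 0].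
Proof.
elim: A gam th => //= a A IH gam th /andP[aA uA] inj hg.
pose th' c := th c - th a; pose g x := gam a + expsum A gam th' x.
have gE x : expsum (a :: A) gam th x = expi (th a * x) * g x.
  rewrite /expsum big_cons /g mulrDr [gam a * _]mulrC; congr (_ + _).
  rewrite mulr_sumr; apply: eq_bigr => c _; rewrite mulrCA -expiD; congr (_ * expi _).
  by rewrite /th'; ring.
have zE : [set x | expsum (a :: A) gam th x = 0] = [set x | g x = 0].
  apply/seteqP; split => x /=; rewrite gE; last by move=> ->; rewrite mulr0.
  move=> /eqP; rewrite mulf_eq0 => /orP[|/eqP//].
  by rewrite -cabs2_eq0 cabs2_expi oner_eq0.
rewrite zE; have [hA|nA] := boolP (has (fun a => gam a != 0) A); last first.
  have ga : gam a != 0 by move: hg; rewrite (negbTE nA) orbF.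
  rewrite (_ : mkset _ = set0); first exact: countable0.
  apply/seteqP; split => x //=; rewrite /g /expsum big_seq big1 ?addr0; first exact/eqP.
  by move=> c cA; move/hasPn: nA => /(_ c cA); rewrite negbK => /eqP ->; rewrite mul0r.
pose gam' c := gam c * Complex 0 (th' c).
have cZ : countable [set x | expsum A gam' th' x = 0].
  apply: IH => //.
    move=> c e cA eA /addIr; apply: inj; rewrite in_cons ?cA ?eA orbT//.
  (* The frequencies are distinct, so [th' c] is nonzero and differentiation keeps the coefficient
     of [c] nonzero. *)
  move/hasP: hA => [c cA gc]; apply/hasP; exists c => //.
  rewrite /gam' mulf_neq0//; apply/eqP => -[] /eqP; rewrite subr_eq0 => /eqP thca.
  move: aA; rewrite -(inj c a) ?cA// in_cons ?eqxx ?cA ?orbT//.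
apply: (@sub_countable _ _ _ ([set x | expsum A gam' th' x = 0] `|` isolated_in [set x | g x = 0])); last first.
  by rewrite -bigcup2E; apply: bigcup_countable => // -[|[|[|]]] //= _; exact: countable_isolated_in.
apply: subset_card_le => x gx; have [Ix|nIx] := pselect (isolated_in [set x | g x = 0] x); [by right|left].
have [dr di] := is_derive_expsum A gam th' x; apply: complex_ext.
  apply: (derive_at_accumulation (f := fun x => complex.Re (g x)) _ gx nIx).
    by move=> y /= ->.
  have h := is_deriveD (is_derive_cst (complex.Re (gam a)) x 1) dr.
  rewrite (_ : (fun x => _) = cst (complex.Re (gam a)) + (fun x => complex.Re (expsum A gam th' x))).
    by apply: (is_derive_cast h); rewrite add0r.
  by apply/funext => y; rewrite /g ReD.
apply: (derive_at_accumulation (f := fun x => complex.Im (g x)) _ gx nIx).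
  by move=> y /= ->.
have h := is_deriveD (is_derive_cst (complex.Im (gam a)) x 1) di.
rewrite (_ : (fun x => _) = cst (complex.Im (gam a)) + (fun x => complex.Im (expsum A gam th' x))).
  by apply: (is_derive_cast h); rewrite add0r.
by apply/funext => y; rewrite /g ImD.
Qed.
End exponential_sums.

(** Along a line parallel to the first axis a trigonometric polynomial is an exponential sum. Terms
    with equal first coordinate of [lam] are grouped, since [countable_expsum_zeros] needs distinct
    frequencies; the coefficients of the groups are trigonometric polynomials in [v]. *)
Lemma trig_consv d (I : eqType) (lam : I -> vec d.+1) (b : I -> C) (s : seq I) (x : R) (v : vec d) :
  let hd k := lam k 0 ord0 in let tl k := (unconsv (lam k)).2 in
  trig lam b s (consv (x, v)) = expsum (undup [seq hd k | k <- s])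
    (fun a => trig tl b [seq k <- s | hd k == a] v) (fun a => - (2 * pi * a)) x.
Proof.
move=> hd tl; rewrite /trig /expsum.
under [RHS]eq_bigr do rewrite big_filter mulr_suml.
rewrite (exchange_big_dep xpredT)//= [LHS]big_seq [RHS]big_seq; apply: eq_bigr => k ks.
rewrite -big_filter (_ : [seq _ <- _ | _] = [:: hd k]).
  rewrite big_seq1 -mulrA; congr (_ * _).
  rewrite -[X in phase _ X](unconsvK (lam k)) /phase -expiD.
  rewrite [unconsv (lam k)]surjective_pairing dot_consv; congr expi; rewrite /hd/= ; ring.
rewrite (eq_filter (a2 := pred1 (hd k))); last by move=> a; exact: eq_sym.
by rewrite filter_pred1_uniq ?undup_uniq// mem_undup; apply/mapP; exists k.
Qed.

Lemma measurable_trig_zeros d (I : eqType) (lam : I -> vec d) (b : I -> C) (s : seq I) :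
  measurable [set w | trig lam b s w = 0].
Proof.
rewrite (_ : mkset _ = setT `&` (fun w => cabs2 (trig lam b s w)) @^-1` [set 0]).
  have /measurable_EFinP h := cmeas_cabs2 (cmeas_trig lam b s).
  by apply: h => //; exact: measurable_set1.
rewrite setTI; apply/seteqP; split => w /=; first by move=> ->; rewrite /cabs2/= expr0n addr0.
by move=> /eqP; rewrite cabs2_eq0 => /eqP.
Qed.

(** Group the terms by first frequency as in [trig_consv]. By induction, the coefficient of the
    group containing a [k0] with [b k0 != 0] is nonzero for almost every [v]; on each such line the
    zeros are countable, and Tonelli concludes. *)
Lemma leb_trig_zeros d (I : eqType) (lam : I -> vec d) (b : I -> C) (s : seq I) :
  uniq s -> {in s &, injective lam} -> has (fun k => b k != 0) s ->
  leb R d [set w | trig lam b s w = 0] = 0%E.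
Proof.
elim: d lam s => [|d IH] lam s us inj /hasP[k0 k0s bk0].
  (* All vectors of dimension 0 are equal, so injectivity of [lam] leaves a single term. *)
  have -> : s = [:: k0].
    have h k : k \in s -> k = k0 by move=> ks; apply: inj => //; apply/rowP => -[].
    have : size s = 1%N.
      have : (size s <= size [:: k0])%N.
        by apply: uniq_leq_size => // k /h ->; rewrite mem_head.
      by case: (s) k0s => [|? []].
    by case: (s) h => [|k []]//= h _; rewrite (h k) ?mem_head.
  rewrite (_ : mkset _ = set0) ?measure0//; apply/seteqP; split => w //=.
  rewrite /trig big_seq1 => /eqP; rewrite mulf_eq0 (negbTE bk0)/= -cabs2_eq0 cabs2_expi.
  by rewrite oner_eq0.
set Z := mkset _; have mZ' : measurable Z by exact: measurable_trig_zeros.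
have mi : measurable_fun setT (fun w => (\1_Z w)%:E : \bar R).
  by apply/measurable_EFinP; exact: measurable_indic.
have mic := measurableT_comp mi (@measurable_consv R d).
rewrite -[Z]setIT -integral_indic// ge0_integral_lebS//.
transitivity (\int[leb R d]_v \int[mu]_x (\1_Z (consv (x, v)))%:E)%E.
  by apply: (fubini_tonelli (fun z => (\1_Z (consv z))%:E)) => // z; rewrite lee_fin.
rewrite -(integral0 (leb R d) setT); apply: ge0_ae_eq_integral => //.
- apply: (measurable_fun_fubini_tonelli_G (fun z => (\1_Z (consv z))%:E)) => //.
- by move=> v _; apply: integral_ge0 => x _; rewrite lee_fin.
pose tl k := (unconsv (lam k)).2; pose r := [seq k <- s | lam k 0 ord0 == lam k0 0 ord0].
have nr : {ae leb R d, forall v, trig tl b r v != 0}.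
  exists [set w | trig tl b r w = 0]; split; [exact: measurable_trig_zeros| |by move=> v /=; case: eqP].
  apply: IH; first exact: filter_uniq.
    move=> k l; rewrite !mem_filter => /andP[/eqP hk ks] /andP[/eqP hl ls] tkl.
    apply: inj => //; rewrite -[lam k]unconsvK -[lam l]unconsvK; congr consv.
    by rewrite [LHS]surjective_pairing [RHS]surjective_pairing /= hk hl; congr pair.
  by apply/hasP; exists k0 => //; rewrite mem_filter eqxx.
apply: filterS nr => v nv _ /=.
have := @countable_expsum_zeros R (undup [seq lam k 0 ord0 | k <- s])
  (fun a => trig tl b [seq k <- s | lam k 0 ord0 == a] v) (fun a => - (2 * pi * a)) (undup_uniq _).
set Zv := mkset _ => cZ; have {}cZ : countable Zv.
  apply: cZ => [x y _ _ /oppr_inj /mulfI|].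
    by apply; rewrite mulf_neq0// gt_eqF//; exact: pi_gt0.
  by apply/hasP; exists (lam k0 0 ord0) => //; rewrite mem_undup; apply/mapP; exists k0.
transitivity (\int[mu]_x (\1_Zv x)%:E)%E.
  apply: eq_integral => x _; congr (_%:E); rewrite !indicE; congr (_%:R); congr nat_of_bool.
  by apply/idP/idP; rewrite !inE /Z /Zv /= trig_consv.
have mZv : measurable (Zv : set T1) by exact: countable_measurable.
by rewrite integral_indic// setIT; exact: countable_lebesgue_measure0.
Qed.

End ZeroSets.

(** * Periodization over the dual lattice *)

Section Periodization.
Variable R : realType.
Local Notation C := R[i].
Local Notation vec d := ('rV[R]_d).

(** Sums over the lattice become series over the natural numbers, so that they can be exchanged with
    integrals by [integral_nneseries]; indices that code no lattice point contribute 0. *)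
Lemma esum_pickle (T : countType) (a : T -> \bar R) : (forall k, 0 <= a k)%E ->
  (\esum_(k in [set: T]) a k = \sum_(0 <= n <oo) oapp a 0 (@pickle_inv T n))%E.
Proof.
move=> a0; have o0 n : (0 <= oapp a 0 (@pickle_inv T n))%E by case: pickle_inv => /=.
transitivity (\esum_(n in [set n | isSome (@pickle_inv T n)]) oapp a 0 (@pickle_inv T n))%E.
  rewrite [RHS](@reindex_esum _ T _ setT _ pickle).
    by apply: eq_esum => k _; rewrite pickleK_inv.
  split => [k _|k l _ _|n /=]; first by rewrite /= pickleK_inv.
    exact: (pcan_inj pickleK_inv).
  by case E : pickle_inv => [k|]// _; exists k => //; have := @pickle_invK T n; rewrite E.
rewrite esum_mkcond nneseries_esum// [in RHS](_ : [set _ | _] = setT); last by apply/seteqP; split => x /=.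
by apply: eq_esum => n _; case: ifPn => // /negP; rewrite inE /=; case: pickle_inv => // k [].
Qed.

Lemma esumZl (T : countType) (a : T -> \bar R) (x : R) : (forall k, 0 <= a k)%E -> 0 <= x ->
  (\esum_(k in [set: T]) (x%:E * a k) = x%:E * \esum_(k in [set: T]) a k)%E.
Proof.
move=> a0 x0; rewrite !esum_pickle//; last by move=> k; rewrite mule_ge0.
rewrite -nneseriesZl; last by move=> n _; case: pickle_inv => /=.
by apply: eq_eseriesr => n _; case: pickle_inv => //=; rewrite mule0.
Qed.

Section lattice.
Variables (d : nat) (M : 'M[R]_d).
Hypothesis uM : M \in unitmx.
Local Notation gam := (duallatpt M).

(** A half-open cell of the dual lattice, the entries of [x *m M] being the coordinates in its
    basis. Half-open cells partition the space exactly, whereas the translates of the closed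
    [dualcell] overlap on their boundaries; [cell_dualcell] relates the two. *)
Definition cell (k : 'rV[int]_d) : set (vec d) :=
  [set x | forall i, Num.floor ((x *m M) 0 i) = k 0 i].

Lemma cell_shift (k l : 'rV[int]_d) x : cell k (x + gam l) <-> cell (k - l) x.
Proof.
rewrite /cell /= mulmxDl /duallatpt mulmxKV//.
by split => h i; have := h i; rewrite !mxE floorDrz ?intr_int// intrKfloor; [move=> <-; rewrite addrK|move=> ->; rewrite subrK].
Qed.

Lemma measurable_mulmx_coord i : measurable_fun setT (fun x : vec d => (x *m M) 0 i).
Proof.
under eq_fun do rewrite mxE; apply: measurable_sum => j; apply: measurable_funM.
  exact: measurable_coord.
exact: measurable_cst.
Qed.

Lemma measurable_cell k : measurable (cell k).
Proof.
rewrite (_ : cell k = \bigcap_(i in [set: 'I_d])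
   (setT `&` (fun x : vec d => (x *m M) 0 i) @^-1` `[(k 0 i)%:~R, (k 0 i + 1)%:~R[%classic)).
  apply: fin_bigcap_measurable => // i _.
  by apply: measurable_mulmx_coord => //; exact: measurable_itv.
apply/seteqP; split => [x h i _|x h i].
  split => //=; rewrite in_itv/= -(h i); exact: floor_itv.
by have [_ /=] := h i I; rewrite in_itv/=; exact: floor_def.
Qed.

Lemma cell_unique x k l : cell k x -> cell l x -> k = l.
Proof. by move=> hk hl; apply/rowP => i; rewrite -hk -hl. Qed.

Lemma cell_cover x : cell (\row_i Num.floor ((x *m M) 0 i)) x.
Proof. by move=> i; rewrite mxE. Qed.

Local Notation D := (cell 0).

(** The space is the disjoint union of the cells, and translation by [gam k] carries the integral
    over the k-th cell to the cell at 0. *)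
Lemma integral_tile (F : vec d -> \bar R) : measurable_fun setT F -> (forall x, 0 <= F x)%E ->
  (\int[leb R d]_x F x = \int[leb R d]_(x in D) \esum_(k in [set: 'rV[int]_d]) F (x + gam k)%R)%E.
Proof.
move=> mF F0; pose c n := oapp cell set0 (@pickle_inv 'rV[int]_d n).
have mc n : measurable (c n) by rewrite /c; case: pickle_inv => //= k; exact: measurable_cell.
have mFs (k : 'rV[int]_d) : measurable_fun setT (fun x : vec d => F (x + gam k)).
  exact: (measurableT_comp mF (measurable_addv _)).
have cT : \bigcup_n c n = setT.
  apply/seteqP; split => // x _; exists (pickle (\row_i Num.floor ((x *m M) 0 i))) => //.
  by rewrite /c pickleK_inv; exact: cell_cover.
have tc : trivIset setT c.
  apply/trivIsetP => i j _ _ ij; apply/seteqP; split => // x [].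
  have := @pickle_invK 'rV[int]_d i; have := @pickle_invK 'rV[int]_d j; rewrite /c.
  case: (pickle_inv i) => [k|]//=; case: (pickle_inv j) => [l|]//= jl ik hk hl.
  by move: ij; rewrite -ik -jl (cell_unique hk hl) eqxx.
rewrite -cT ge0_integral_bigcup//; last by rewrite cT.
under [RHS]eq_integral => x _ do rewrite esum_pickle//.
rewrite integral_nneseries.
- apply: eq_eseriesr => n _; rewrite /c; case: pickle_inv => [k|]/=; last first.
    by rewrite integral_set0 integral0.
  rewrite [LHS]integral_mkcond -(ge0_integral_shift (gam k))//.
  + rewrite [RHS]integral_mkcond; apply: eq_integral => x _; rewrite !patchE.
    suff -> : (x + gam k \in cell k) = (x \in D) by [].
    have := cell_shift k k x; rewrite subrr => -[h1 h2].
    by apply/idP/idP; rewrite !inE; [exact: h1|exact: h2].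
  + by apply/(measurable_restrictT F (measurable_cell k)); exact: measurable_funTS.
  + by move=> x; rewrite patchE; case: ifP.
- exact: measurable_cell.
- move=> n; case: pickle_inv => [k|]/=; last exact: measurable_cst.
  exact: measurable_funTS.
- by move=> n x _; case: pickle_inv => /=.
Qed.

End lattice.
End Periodization.

(** * Orthogonality of the characters on the fundamental cell *)

Section Orthogonality.
Variable R : realType.
Local Notation C := R[i].
Local Notation vec d := ('rV[R]_d).

Lemma expi_pi : expi (pi : R) = - 1.
Proof. by apply: complex_ext; rewrite /= ?cospi ?sinpi ?oppr0. Qed.

Lemma expi_2pi_int (n : int) : expi (2 * pi * n%:~R : R) = 1.
Proof.
have pos (k : nat) : expi (2 * pi * k%:R : R) = 1.
  elim: k => [|k IH]; first by rewrite mulr0 expi0.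
  have -> : 2 * pi * k.+1%:R = 2 * pi * k%:R + (pi + pi) :> R by rewrite -natr1; ring.
  by rewrite expiD IH mul1r expiD expi_pi mulrNN mulr1.
case: n => k; first exact: pos.
have := expi0 R; rewrite -[in LHS](subrr (2 * pi * k.+1%:R)) expiD pos mul1r => <-.
by rewrite NegzE mulrNz mulrN.
Qed.

(** The real part of z times the conjugate of w: the cross term of |z + w|^2, which keeps all the
    integrals real. *)
Definition rdot (z w : C) : R := complex.Re z * complex.Re w + complex.Im z * complex.Im w.

Lemma cabs2_rdot (z w : C) : cabs2 (z + w) = cabs2 z + cabs2 w + 2 * rdot z w.
Proof. by rewrite /cabs2 /rdot ReD ImD; ring. Qed.

Lemma rdotDr (z w w' : C) : rdot z (w + w') = rdot z w + rdot z w'.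
Proof. by rewrite /rdot ReD ImD; ring. Qed.

Lemma rdotNl (z w : C) : rdot (- z) w = - rdot z w.
Proof. by rewrite /rdot ReN ImN; ring. Qed.

Lemma rdotM (z w u : C) : rdot (z * u) (w * u) = cabs2 u * rdot z w.
Proof. by rewrite /rdot /cabs2 !ReM !ImM; ring. Qed.

Lemma abs_rdot_le (z w : C) : `|rdot z w| <= cabs2 z + cabs2 w.
Proof.
have h1 := cabs2_ge0 (z + w); have h2 := cabs2_ge0 (z - w).
have hz := cabs2_ge0 z; have hw := cabs2_ge0 w.
move: h1 h2 hz hw; rewrite /rdot /cabs2 !ReD !ImD ReN ImN ler_norml => h1 h2 hz hw.
by apply/andP; split; lra.
Qed.

Lemma measurable_rdot d (f g : vec d -> C) : cmeas f -> cmeas g ->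
  measurable_fun setT (fun x => rdot (f x) (g x)).
Proof. by move=> [fr fi] [gr gi]; apply: measurable_funD; exact: measurable_funM. Qed.

Variables (d : nat) (M : 'M[R]_d).
Hypothesis uM : M \in unitmx.
Local Notation gam := (duallatpt M).
Local Notation D := (cell M 0).
Local Notation lebD f := (\int[leb R d]_(x in D) f x).

Lemma dot_dual (u : vec d) (k : 'rV[int]_d) :
  dot (u *m invmx M) (latpt M k) = \sum_i u 0 i * (k 0 i)%:~R.
Proof.
rewrite /dot /latpt trmx_mul trmxK mulmxA mulmxKV// mxE.
by apply: eq_bigr => i _; rewrite !mxE.
Qed.

Lemma phase_dual (k l : 'rV[int]_d) : phase (gam k) (latpt M l) = 1.
Proof.
rewrite /phase dot_dual -mulrN -(expi_2pi_int (- \sum_i k 0 i * l 0 i)) mulrNz.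
congr expi; congr (_ * - _); rewrite rmorph_sum; apply: eq_bigr => i _.
by rewrite mxE rmorphM.
Qed.

Lemma phase_separate (k l : 'rV[int]_d) : k != l ->
  exists v, phase v (latpt M k) = - phase v (latpt M l).
Proof.
move=> kl; have [i kli] : exists i, k 0 i != l 0 i.
  apply/existsP; apply: contraR kl; rewrite negb_exists => /forallP h.
  by apply/eqP/rowP => i; apply/eqP; have := h i; rewrite negbK.
have ne : (k 0 i)%:~R - (l 0 i)%:~R != 0 :> R by rewrite subr_eq0 eqr_int.
(* Half a period of the quotient of the two characters: moving coordinate i by -1 / (2 (k_i - l_i))
   changes the relative phase by pi. *)
pose u : vec d := \row_j (if j == i then - (2 * ((k 0 i)%:~R - (l 0 i)%:~R))^-1 else 0).
have uE (h : 'rV[int]_d) : \sum_j u 0 j * (h 0 j)%:~R = u 0 i * (h 0 i)%:~R.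
  rewrite (bigD1 i)//= big1 ?addr0// => j ji.
  by rewrite mxE (negbTE ji) mul0r.
exists (u *m invmx M); rewrite /phase !dot_dual !uE mxE eqxx.
have eN y : - expi y = expi (pi + y) :> C by rewrite expiD expi_pi mulN1r.
rewrite eN; congr expi.
by field; rewrite -intrB intr_eq0 subr_eq0 -(eqr_int R) -subr_eq0.
Qed.

(** Written over the whole space and shifted back by [v], the integrand is G restricted to a
    translated cell; after tiling, each point has exactly one lattice translate in that cell, the
    one given by [k0], and G takes the same value there. *)
Lemma integral_periodic_shift (G : vec d -> \bar R) v : measurable_fun setT G ->
  (forall x, 0 <= G x)%E -> (forall k x, G (x + gam k) = G x) ->
  (\int[leb R d]_(x in D) G (x + v)%R = \int[leb R d]_(x in D) G x)%E.
Proof.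
move=> mG G0 pG; pose f := (fun x : vec d => G (x + v)) \_ D.
have mD : measurable D by exact: measurable_cell.
have mf : measurable_fun setT f.
  apply/(measurable_restrictT _ mD); apply: measurable_funTS.
  exact: (measurableT_comp mG (measurable_addv v)).
have f0 x : (0 <= f x)%E by rewrite /f patchE; case: ifP.
rewrite [LHS]integral_mkcond -(ge0_integral_shift (- v) mf f0).
rewrite (integral_tile uM); last 2 first.
- exact: (measurableT_comp mf (measurable_addv (- v))).
- by move=> x; exact: f0.
apply: eq_integral => x _.
pose k0 : 'rV[int]_d := - \row_i Num.floor (((x - v) *m M) 0 i).
rewrite -[RHS](@esum_set1 R _ k0 (fun=> G x)) // [RHS]esum_mkcond; apply: eq_esum => k _.
rewrite /f patchE subrK pG addrAC.
suff -> : (x - v + gam k \in D) = (k \in [set k0]) by [].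
have := cell_shift uM 0 k (x - v); rewrite sub0r => -[h1 h2].
apply/idP/idP; rewrite !inE => h.
  by rewrite /k0 -(cell_unique (h1 h) (cell_cover M (x - v))) opprK.
by apply: h2; rewrite h /k0 opprK; exact: cell_cover.
Qed.

Hypothesis fD : (leb R d D < +oo)%E.

Lemma integrable_cell (g : vec d -> R) (B : R) : measurable_fun setT g -> (forall x, `|g x| <= B) ->
  (leb R d).-integrable D (EFin \o g).
Proof.
move=> mg gB; apply: measurable_bounded_integrable => //.
- exact: measurable_cell.
- exact: measurable_funTS.
exists B; split; first exact: num_real.
by move=> y By x _ /=; apply: le_trans (gB x) (ltW By).
Qed.

Lemma antiperiodic_cell (g : vec d -> R) (B : R) v : measurable_fun setT g -> (forall x, `|g x| <= B) ->
  (forall k x, g (x + gam k) = g x) -> (forall x, g (x + v) = - g x) -> lebD g = 0.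
Proof.
move=> mg gB pg ag; have mD : measurable D by exact: measurable_cell.
have iB : (leb R d).-integrable D (EFin \o cst B).
  by apply: (integrable_cell (B := `|B|)).
have ig := integrable_cell mg gB.
(* Adding the bound B makes the functions nonnegative, as [integral_periodic_shift] requires. *)
have e : lebD (fun x => B + g x) = lebD (fun x => B - g x).
  rewrite /Rintegral; congr fine.
  rewrite -(integral_periodic_shift (G := fun x => (B + g x)%:E) v)//.
  - by apply: eq_integral => x _; rewrite ag.
  - by apply/measurable_EFinP; apply: measurable_funD.
  - by move=> x; rewrite lee_fin -lerBlDl sub0r; have := gB x; rewrite ler_norml => /andP[].
  - by move=> k x; rewrite pg.
by move: e; rewrite RintegralD// RintegralB// => /addrI e; lra.
Qed.

Local Notation lp := (latpt M).

(* A suitable translation flips the sign of the product of two distinct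
   characters, while the cell integral of a periodic function is invariant. *)
Lemma rdot_phase_cell (a b : C) k l : k != l ->
  lebD (fun x => rdot (a * phase x (lp k)) (b * phase x (lp l))) = 0.
Proof.
move=> /phase_separate[v hv].
apply: (antiperiodic_cell (B := cabs2 a + cabs2 b) (v := v)).
- by apply: measurable_rdot; apply: cmeasM; [exact: cmeas_cst|exact: cmeas_phase_l|
    exact: cmeas_cst|exact: cmeas_phase_l].
- by move=> x; apply: (le_trans (abs_rdot_le _ _)); rewrite !cabs2M !cabs2_expi !mulr1.
- by move=> h x; rewrite !phaseDl !phase_dual !mulr1.
- move=> x; rewrite !phaseDl hv !mulrN rdotNl !mulrA rdotM cabs2_expi mul1r //.
Qed.

(** Parseval's identity on the cell, one character at a time: [cross] makes each new character
    orthogonal to the sum of the others. *)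
Lemma trig_cabs2_cell (b : 'rV[int]_d -> C) s : uniq s ->
  lebD (fun x => cabs2 (trig lp b s x)) = fine (leb R d D) * \sum_(k <- s) cabs2 (b k).
Proof.
have mD : measurable D by exact: measurable_cell.
have mt := cmeas_trig lp b.
have mp k : cmeas (fun x => b k * phase x (lp k)).
  by apply: cmeasM; [exact: cmeas_cst|exact: cmeas_phase_l].
have it r : (leb R d).-integrable D (EFin \o (fun x => cabs2 (trig lp b r x))).
  have [B B0 hB] := trig_bounded lp b r; apply: (integrable_cell (B := B)).
    by apply/measurable_EFinP; exact: cmeas_cabs2.
  by move=> x; rewrite ger0_norm ?cabs2_ge0.
have ir k (r : seq 'rV[int]_d) : (leb R d).-integrable D
    (EFin \o (fun x => rdot (b k * phase x (lp k)) (trig lp b r x))).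
  have [B B0 hB] := trig_bounded lp b r; apply: (integrable_cell (B := cabs2 (b k) + B)).
    exact: measurable_rdot.
  move=> x; apply: (le_trans (abs_rdot_le _ _)).
  by rewrite cabs2M cabs2_expi mulr1 lerD2l.
have cross k (r : seq 'rV[int]_d) : k \notin r ->
    lebD (fun x => rdot (b k * phase x (lp k)) (trig lp b r x)) = 0.
  elim: r => [|l r IH] kr.
    rewrite /Rintegral (eq_integral (cst 0%E)) ?integral0// => x _.
    by rewrite /trig big_nil /rdot/= !mulr0 addr0.
  move: kr; rewrite in_cons negb_or => /andP[kl kr].
  rewrite -[RHS]addr0 -{1}(rdot_phase_cell (b k) (b l) kl) -(IH kr) -RintegralD//.
    by apply: eq_Rintegral => x _; rewrite /trig big_cons rdotDr.
  apply: (integrable_cell (B := cabs2 (b k) + cabs2 (b l))); first exact: measurable_rdot.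
  by move=> x; apply: (le_trans (abs_rdot_le _ _)); rewrite !cabs2M !cabs2_expi !mulr1.
elim: s => [|k s IH] /= => [_|/andP[ks us]].
  rewrite big_nil mulr0 /Rintegral (eq_integral (cst 0%E)) ?integral0// => x _.
  by rewrite /trig big_nil /cabs2/= expr0n addr0.
rewrite big_cons mulrDr -(IH us).
transitivity (lebD (fun x => cabs2 (b k) + (cabs2 (trig lp b s x) +
   (rdot (b k * phase x (lp k)) (trig lp b s x) + rdot (b k * phase x (lp k)) (trig lp b s x))))).
  apply: eq_Rintegral => x _; rewrite {1}/trig big_cons cabs2_rdot cabs2M cabs2_expi mulr1 /trig.
  by ring.
have icst : (leb R d).-integrable D (EFin \o cst (cabs2 (b k))).
  by apply: (integrable_cell (B := `|cabs2 (b k)|)).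
have iD (g h : vec d -> R) : (leb R d).-integrable D (EFin \o g) ->
    (leb R d).-integrable D (EFin \o h) -> (leb R d).-integrable D (EFin \o (fun x => g x + h x)).
  by move=> ig ih; rewrite (_ : _ \o _ = (EFin \o g) \+ (EFin \o h)) //; exact: integrableD.
have irr := iD _ _ (ir k s) (ir k s).
have itr := iD _ _ (it s) irr.
rewrite RintegralD// RintegralD// RintegralD// cross// !addr0 Rintegral_cst//.
by rewrite mulrC.
Qed.

End Orthogonality.

(** * Riesz bounds from the periodization *)

Section RieszBounds.
Variable R : realType.
Local Notation C := R[i].
Local Notation vec d := ('rV[R]_d).
Variables (d : nat) (M : 'M[R]_d) (Psi : vec d -> C) (A B : R).
Hypotheses (uM : M \in unitmx) (mPsi : cmeas Psi) (fPsi : (sqint Psi < +oo)%E) (A0 : 0 < A)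
  (AB : A <= B).
Local Notation D := (cell M 0).
Local Notation per := (periodization M Psi).
Hypothesis perAB : {ae leb R d, forall t, D t -> (A%:E <= per t <= B%:E)%E}.

Lemma measurable_periodization : measurable_fun setT per.
Proof.
rewrite /periodization; under eq_fun => t.
  by rewrite (esum_pickle (a := fun k => (cabs2 (Psi (t + duallatpt M k)))%:E)); first over;
    move=> k; rewrite lee_fin cabs2_ge0.
apply: ge0_emeasurable_sum => n.
  by case: pickle_inv => [k|] t _ //=; rewrite lee_fin cabs2_ge0.
move=> _; case: pickle_inv => [k|] /=; last exact: measurable_cst.
exact: (measurableT_comp (cmeas_cabs2 mPsi) (measurable_addv (duallatpt M k))).
Qed.

Let per0 t : (0 <= per t)%E.
Proof. by apply: esum_ge0 => k _; rewrite lee_fin cabs2_ge0. Qed.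

Let mD : measurable D.
Proof. exact: measurable_cell. Qed.

Lemma sqint_cell : sqint Psi = (\int[leb R d]_(x in D) per x)%E.
Proof. by apply: (integral_tile uM (cmeas_cabs2 mPsi)) => x; rewrite lee_fin cabs2_ge0. Qed.

(** The volume 1 / |det M| is never computed: A times the measure of the cell is at most the cell
    integral of the periodization, which is the finite squared norm of Psi. *)
Lemma leb_cell_lty : (leb R d D < +oo)%E.
Proof.
have h : (A%:E * leb R d D <= sqint Psi)%E.
  rewrite sqint_cell -integral_cst//; apply: ae_ge0_le_integral => //.
  - by move=> x _; rewrite lee_fin ltW.
  - by apply: measurable_funTS; exact: measurable_periodization.
  - by apply: filterS perAB => t h Dt; have /andP[] := h Dt.
rewrite ltNge; apply/negP; rewrite leye_eq => /eqP e.
by move: h; rewrite e gt0_muley ?lte_fin// leye_eq => /eqP h; have := fPsi; rewrite h ltxx.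
Qed.

(** Over a null cell the periodization would integrate to 0, and so would |Psi|^2 over the whole
    space by [sqint_cell]. *)
Lemma leb_cell_gt0 : sqint Psi != 0%E -> 0 < fine (leb R d D).
Proof.
move=> nz; apply: fine_gt0; rewrite leb_cell_lty andbT lt_neqAle measure_ge0 andbT eq_sym.
by apply: contra nz => /eqP D0; rewrite sqint_cell null_set_integral// ; exact: measurable_funTS measurable_periodization.
Qed.

Lemma riesz_bounds (b : 'rV[int]_d -> C) s : uniq s ->
  ((A * (fine (leb R d D) * \sum_(k <- s) cabs2 (b k)))%:E <=
   sqint (fun w => trig (latpt M) b s w * Psi w)%R <=
   (B * (fine (leb R d D) * \sum_(k <- s) cabs2 (b k)))%:E)%E.
Proof.
move=> us; set L := fine _; set N := \sum_(_ <- _) _; pose T w := (cabs2 (trig (latpt M) b s w))%:E.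
have mT : measurable_fun setT T by apply: cmeas_cabs2; exact: cmeas_trig.
have T0 w : (0 <= T w)%E by rewrite lee_fin cabs2_ge0.
have eN : (\int[leb R d]_(x in D) T x = (L * N)%:E)%E.
  rewrite -(trig_cabs2_cell uM leb_cell_lty b us) /Rintegral fineK//.
  have [K K0 hK] := trig_bounded (latpt M) b s.
  rewrite ge0_fin_numE; last by apply: integral_ge0 => x _; exact: T0.
  apply: (@le_lt_trans _ _ (K%:E * leb R d D)%E); last first.
    by rewrite lte_mul_pinfty// leb_cell_lty.
  rewrite -integral_cst//; apply: ge0_le_integral => //.
  - by move=> x _; exact: T0.
  - exact: (measurable_funTS mT).
  - by move=> x _; rewrite lee_fin.
(* By [phase_dual] the trigonometric polynomial is periodic under the dual lattice, so it factors
   out of the sum over the translates. *)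
have eI : sqint (fun w => trig (latpt M) b s w * Psi w) = (\int[leb R d]_(x in D) (T x * per x))%E.
  rewrite /sqint (integral_tile uM).
  - apply: eq_integral => x _; rewrite /periodization -esumZl ?cabs2_ge0//; last first.
      by move=> k; rewrite lee_fin cabs2_ge0.
    apply: eq_esum => k _; rewrite -EFinM cabs2M; congr (cabs2 _ * _)%:E.
    by apply: eq_bigr => l _; rewrite phaseDl phase_dual// mulr1.
  - by apply: cmeas_cabs2; apply: cmeasM => //; exact: cmeas_trig.
  - by move=> x; rewrite lee_fin cabs2_ge0.
have mTD : measurable_fun D T by exact: measurable_funTS.
have mTp : measurable_fun D (fun x => T x * per x)%E.
  by apply: emeasurable_funM => //; apply: measurable_funTS; exact: measurable_periodization.
rewrite eI !EFinM -EFinM -eN; apply/andP; split.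
  rewrite -ge0_integralZl//; last by rewrite lee_fin ltW.
  apply: ae_ge0_le_integral => //.
  - by move=> x _; rewrite mule_ge0// lee_fin ltW.
  - exact: measurable_funeM.
  - by move=> x _; rewrite mule_ge0.
  - by apply: filterS perAB => x h Dx; have /andP[h1 _] := h Dx; rewrite muleC lee_wpmul2l.
have B0 : 0 <= B by apply: le_trans AB; exact: ltW.
rewrite -ge0_integralZl//.
apply: ae_ge0_le_integral => //.
- by move=> x _; rewrite mule_ge0.
- by move=> x _; rewrite mule_ge0.
- exact: measurable_funeM.
- by apply: filterS perAB => x h Dx; have /andP[_ h1] := h Dx; rewrite muleC lee_wpmul2r.
Qed.

End RieszBounds.

(** * From the notions of the statement to the measure [leb] *)

Section Transfer.
Variable R : realType.
Local Notation C := R[i].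
Local Notation vec d := ('rV[R]_d).

Lemma conjE (z : C) : z^* = Complex (complex.Re z) (- complex.Im z).
Proof. by case: z. Qed.

Lemma normcE (z : C) : `|z| = Complex (Num.sqrt (cabs2 z)) 0.
Proof. by case: z. Qed.

Lemma norm1_cabs2 (z : C) : `|z| = 1 <-> cabs2 z = 1.
Proof.
rewrite normcE; split=> [[h]|->]; last by rewrite sqrtr1.
by rewrite -(sqr_sqrtr (cabs2_ge0 z)) h expr1n.
Qed.

Lemma cabs2_conj (z : C) : cabs2 z^* = cabs2 z.
Proof. by rewrite conjE /cabs2/= sqrrN. Qed.

Lemma measCE d (f : vec d -> C) : measC f <-> cmeas f.
Proof. by rewrite /measC /cmeas !measurable_vecE. Qed.

Lemma norm2sqE d (f : vec d -> C) : cmeas f -> norm2sq f = sqint f.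
Proof.
move=> mf; apply: (IintE (f := fun x => (cabs2 (f x))%:E) (cmeas_cabs2 mf)) => x.
by rewrite lee_fin cabs2_ge0.
Qed.

Lemma L2E d (f : vec d -> C) : L2 f <-> cL2 f.
Proof.
split=> [[/measCE mf ff]|[mf ff]]; first by split=> //; rewrite -norm2sqE.
by split; [exact/measCE|rewrite norm2sqE].
Qed.

Lemma nullRdE d (N : set (vec d)) : nullRd N <-> (leb R d).-negligible N.
Proof.
have indE (N' : set (vec d)) : measurable N' -> intRd (fun t => (\1_N' t)%:E) = leb R d N'.
  move=> mN; rewrite /intRd (IintE (f := fun t => (\1_N' t)%:E)).
  - by rewrite integral_indic// setIT.
  - by apply/measurable_EFinP; exact: measurable_indic.
  - by move=> x; rewrite lee_fin.
split=> [[N' [mN' NN' h]]|[N' [mN' h NN']]]; exists N'; split => //.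
  by rewrite -indE.
by rewrite indE.
Qed.

Lemma aeE d (P : vec d -> Prop) : ae P <-> {ae leb R d, forall x, P x}.
Proof.
split=> [[N [/nullRdE nN h]]|h].
  apply: negligibleS nN => x /= nP; apply: contrapT => nN; apply: nP; exact: h.
exists (~` [set x | P x]); split; first exact/nullRdE.
by move=> t _ /= /contrapT.
Qed.

Lemma sqint_eq0 d (f : vec d -> C) : cmeas f ->
  (sqint f = 0%E <-> {ae leb R d, forall x, f x = 0}).
Proof.
move=> mf; have h := ae_eq_integral_abs (leb R d) measurableT (cmeas_cabs2 mf).
have e : (\int[leb R d]_x `|(cabs2 (f x))%:E| = sqint f)%E.
  by apply: eq_integral => x _; rewrite gee0_abs// lee_fin cabs2_ge0.
rewrite -e; split.
  move=> /h; apply: filterS => x /(_ I) -[] /eqP; rewrite cabs2_eq0 => /eqP //.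
by move=> h0; apply/h; apply: filterS h0 => x -> _; rewrite /cabs2/= expr0n addr0.
Qed.

Lemma aeeqE d (f g : vec d -> C) : cmeas f -> cmeas g ->
  (aeeq f g <-> sqint (fun x => f x - g x)%R = 0%E).
Proof.
move=> mf mg; rewrite /aeeq aeE sqint_eq0; last exact: cmeasB.
by split; apply: filterS => x; [move=> ->; rewrite subrr|move=> /subr0_eq].
Qed.

Lemma aeeq_sqint d (f g : vec d -> C) : cmeas f -> cmeas g -> aeeq f g -> sqint f = sqint g.
Proof.
move=> mf mg /aeE fg; apply: ge0_ae_eq_integral => //.
- exact: cmeas_cabs2.
- exact: cmeas_cabs2.
- by move=> x _; rewrite lee_fin cabs2_ge0.
- by move=> x _; rewrite lee_fin cabs2_ge0.
by apply: filterS fg => x -> _.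
Qed.

Lemma rintRdE d (g : vec d -> R) : (leb R d).-integrable setT (EFin \o g) ->
  rintRd g = \int[leb R d]_x g x.
Proof.
move=> ig; have mg : measurable_fun setT g by apply/measurable_EFinP; case/integrableP: ig.
have intE (h : vec d -> R) : measurable_fun setT h ->
    intRd (fun t => (Num.max (h t) 0)%:E) = (\int[leb R d]_x (EFin \o h)^\+ x)%E.
  move=> mh; rewrite /intRd (IintE (f := fun t => (Num.max (h t) 0)%:E)).
  - by apply: eq_integral => x _; rewrite funeposE /= EFin_max.
  - by apply/measurable_EFinP; exact: measurable_maxr.
  - by move=> x; rewrite lee_fin le_max lexx orbT.
rewrite /rintRd intE// intE; last exact: measurable_funN.
have ge0 : (\int[leb R d]_x (EFin \o (fun x => - g x)%R)^\+ x = \int[leb R d]_x (EFin \o g)^\- x)%E.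
  by apply: eq_integral => x _; rewrite funeposE funenegE.
rewrite ge0 -fineB.
- by congr fine; rewrite [RHS]integralE.
- exact: integrable_pos_fin_num.
- exact: integrable_neg_fin_num.
Qed.

Lemma fourier1E d (g : vec d -> C) w : cintegrable (leb R d) g -> fourier1 g w = fourier g w.
Proof.
move=> cg; have [hr hi] := cintegrable_phase w cg.
by rewrite /fourier1 /cintRd !rintRdE.
Qed.

Lemma is_fourierL2_limit d (psi Psi : vec d -> C) : cL2 psi -> is_fourierL2 psi Psi ->
  cL2 Psi /\ fourier_limit psi Psi.
Proof.
move=> psi2 [/L2E Psi2 h]; split=> //; split; first exact: Psi2.1.
move=> eps /h[N hN]; exists N => n /hN; rewrite norm2sqE.
  by congr (_ < _)%E; apply: eq_integral => w _; rewrite fourier1E//; exact: cintegrable_trunc.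
apply: cmeasB; first exact: Psi2.1.
have -> : fourier1 (trunc n psi) = fourier (trunc n psi).
  by apply/funext => w; rewrite fourier1E//; exact: cintegrable_trunc.
by apply: cmeas_fourier; apply: cmeas_trunc; exact: psi2.1.
Qed.

End Transfer.

(** * Unconditionally convergent sums *)

Section UnconditionalSums.
Variable R : realType.
Local Notation C := R[i].
Local Notation vec d := ('rV[R]_d).
Variables (d : nat) (I : choiceType) (e : I -> vec d -> C).
Hypothesis me : forall k, cmeas (e k).
Implicit Types (b : I -> C) (s t : seq I) (f g h : vec d -> C).

Definition fsum b s (x : vec d) : C := \sum_(k <- s) b k * e k x.

Definition sums_to b f := cL2 f /\ forall eps : R, 0 < eps -> exists s0 : seq I,
  forall s, uniq s -> {subset s0 <= s} -> (sqint (fun x => f x - fsum b s x)%R < eps%:E)%E.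

Lemma cmeas_fsum b s : cmeas (fsum b s).
Proof.
apply: (cmeas_sum s (F := fun k x => b k * e k x)) => k.
by apply: cmeasM => //; exact: cmeas_cst.
Qed.

(** The triangle inequality for squared norms; its factor 4 explains the eps / 4 and eps / 4 / 4 in
    the proofs that follow. *)
Lemma sqint_lt_add h f g (eps : R) : cmeas f -> cmeas g -> (forall x, h x = f x + g x) ->
  (sqint f < (eps / 4)%:E)%E -> (sqint g < (eps / 4)%:E)%E -> (sqint h < eps%:E)%E.
Proof.
move=> mf mg hE lf lg; rewrite (funext hE); apply: (le_lt_trans (sqintD_le mf mg)).
have -> : eps%:E = (2%:E * (eps / 4)%:E + 2%:E * (eps / 4)%:E)%E.
  by rewrite -!EFinM -EFinD; congr _%:E; field.
by apply: lteD; rewrite lte_pmul2l.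
Qed.

Lemma sqintZ1 (nu : C) f : cabs2 nu = 1 -> sqint (fun x => nu * f x) = sqint f.
Proof. by move=> nu1; apply: eq_integral => x _; rewrite cabs2M nu1 mul1r. Qed.

Lemma fsum_subset b s t x : uniq s -> uniq t -> {subset t <= s} ->
  fsum b s x = fsum b t x + fsum b [seq k <- s | k \notin t] x.
Proof.
move=> us ut ts; rewrite /fsum -big_cat /=; apply: perm_big.
rewrite -(perm_filterC (mem t)) perm_cat2r.
apply: uniq_perm => //; first exact: filter_uniq.
by move=> k; rewrite mem_filter /=; case: (boolP (k \in t)) => // /ts ->.
Qed.

Lemma fsum_supp b s t x : uniq s -> uniq t -> {subset t <= s} ->
  (forall k, k \notin t -> b k = 0) -> fsum b s x = fsum b t x.
Proof.
move=> us ut ts bt; rewrite (fsum_subset b x us ut ts) [X in _ + X]big_seq big1 ?addr0// => k.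
by rewrite mem_filter => /andP[/bt -> _]; rewrite mul0r.
Qed.

Lemma sums_to_supp b t : uniq t -> (forall k, cL2 (e k)) -> (forall k, k \notin t -> b k = 0) ->
  sums_to b (fsum b t).
Proof.
move=> ut e2 bt; split.
  split; first exact: cmeas_fsum.
  elim: t {ut bt} => [|k t IH].
    rewrite (_ : sqint _ = 0%E) ?ltry//.
    apply/sqint_eq0; first exact: cmeas_fsum.
    by apply: aeW => x; rewrite /fsum big_nil.
  have -> : fsum b (k :: t) = (fun x => b k * e k x + fsum b t x).
    by apply/funext => x; rewrite /fsum big_cons.
  have mk : cmeas (fun x => b k * e k x) by apply: cmeasM => //; exact: cmeas_cst.
  apply: (le_lt_trans (sqintD_le mk (cmeas_fsum b t))).
  have h1 : (sqint (fun x => b k * e k x)%R < +oo)%E.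
    apply: (@le_lt_trans _ _ ((cabs2 (b k))%:E * sqint (e k))%E).
      apply: (@sqintM_le R d (fun=> b k) (e k)) => //; exact: cabs2_ge0.
    by rewrite lte_mul_pinfty ?lee_fin ?cabs2_ge0//; exact: (e2 k).2.
  by apply: lte_add_pinfty; rewrite lte_mul_pinfty.
move=> eps eps0; exists t => s us ts.
rewrite (_ : sqint _ = 0%E) ?lte_fin//; apply/sqint_eq0.
  by apply: cmeasB; exact: cmeas_fsum.
by apply: aeW => x; rewrite (fsum_supp x us ut ts bt) subrr.
Qed.

Lemma sums_to_small b b' f f' (nu : C) : cabs2 nu = 1 -> sums_to b f -> sums_to b' f' ->
  sqint (fun x => f x - nu * f' x)%R = 0%E ->
  forall eps : R, 0 < eps -> exists s0 : seq I, forall s, uniq s -> {subset s0 <= s} ->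
    (sqint (fsum (fun k => b k - nu * b' k)%R s) < eps%:E)%E.
Proof.
move=> nu1 [f2 hf] [f'2 hf'] ff' eps eps0.
have e16 : 0 < eps / 4 / 4 by rewrite !divr_gt0.
have [s0 h0] := hf _ e16; have [s1 h1] := hf' _ e16.
exists (s0 ++ s1) => s us ss.
have ss0 : {subset s0 <= s} by move=> k ks; apply: ss; rewrite mem_cat ks.
have ss1 : {subset s1 <= s} by move=> k ks; apply: ss; rewrite mem_cat ks orbT.
have mb := cmeas_fsum b s; have mb' := cmeas_fsum b' s.
have m1 : cmeas (fun x => nu * (f' x - fsum b' s x)).
  by apply: cmeasM; [exact: cmeas_cst|apply: cmeasB => //; exact: f'2.1].
have m2 : cmeas (fun x => - (f x - fsum b s x)).
  by apply: cmeasN; apply: cmeasB => //; exact: f2.1.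
have m3 : cmeas (fun x => f x - nu * f' x).
  by apply: cmeasB; [exact: f2.1|apply: cmeasM; [exact: cmeas_cst|exact: f'2.1]].
(* The partial sum for b - nu b' is nu times the remainder of f', minus the remainder of f, plus f -
   nu f', whose norm is 0. *)
apply: (@sqint_lt_add _ (fun x => nu * (f' x - fsum b' s x) - (f x - fsum b s x))
  (fun x => f x - nu * f' x)) => //.
- exact: cmeasD.
- move=> x; have -> : fsum (fun k => b k - nu * b' k) s x = fsum b s x - nu * fsum b' s x.
    rewrite /fsum mulr_sumr -sumrB; apply: eq_bigr => k _; ring.
  ring.
- apply: (sqint_lt_add m1 m2) => //; first by rewrite sqintZ1// h1.
  have := h0 _ us ss0; congr (_ < _)%E; apply: eq_integral => x _.
  by rewrite cabs2N.
- by rewrite ff' lte_fin divr_gt0.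
Qed.

Lemma sums_to_unique b f f' : sums_to b f -> sums_to b f' -> sqint (fun x => f x - f' x)%R = 0%E.
Proof.
move=> [f2 hf] [f'2 hf']; apply/eqP; rewrite eq_le sqint_ge0 andbT; apply/lee_addgt0Pr => eps eps0.
have e4 : 0 < eps / 4 by rewrite divr_gt0.
have [s0 h0] := hf _ e4; have [s1 h1] := hf' _ e4; pose s := undup (s0 ++ s1).
have us : uniq s by exact: undup_uniq.
have ss0 : {subset s0 <= s} by move=> k ks; rewrite mem_undup mem_cat ks.
have ss1 : {subset s1 <= s} by move=> k ks; rewrite mem_undup mem_cat ks orbT.
have mb := cmeas_fsum b s.
rewrite add0e; apply: ltW.
apply: (@sqint_lt_add _ (fun x => f x - fsum b s x) (fun x => fsum b s x - f' x)).
- by apply: cmeasB => //; exact: f2.1.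
- by apply: cmeasB => //; exact: f'2.1.
- by move=> x; ring.
- exact: h0.
- by rewrite sqintB_sym; exact: h1.
Qed.

Lemma sums_toZ (nu : C) b f : cabs2 nu = 1 -> sums_to b f ->
  sums_to (fun k => nu * b k) (fun x => nu * f x).
Proof.
move=> nu1 [f2 hf]; split.
  split; first by apply: cmeasM; [exact: cmeas_cst|exact: f2.1].
  by rewrite sqintZ1//; exact: f2.2.
move=> eps /hf[s0 h0]; exists s0 => s us ss; have := h0 s us ss.
rewrite -(sqintZ1 _ nu1); congr (_ < _)%E; apply: eq_integral => x _; congr (cabs2 _)%:E.
by rewrite mulrBr /fsum mulr_sumr; congr (_ - _); apply: eq_bigr => k _; rewrite mulrA.
Qed.

Section riesz.
Variables c1 c2 : R.
Hypotheses (c10 : 0 < c1) (c20 : 0 < c2).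
Hypothesis lower : forall b s, uniq s -> ((c1 * \sum_(k <- s) cabs2 (b k))%:E <= sqint (fsum b s))%E.
Hypothesis upper : forall b s, uniq s -> (sqint (fsum b s) <= (c2 * \sum_(k <- s) cabs2 (b k))%:E)%E.

(** By the lower bound, every partial sum over a set containing [k] has squared norm at least c1
    |b_k|^2; this value is taken as tolerance. *)
Lemma small_fsum_eq0 b :
  (forall eps : R, 0 < eps -> exists s0 : seq I, forall s, uniq s -> {subset s0 <= s} ->
    (sqint (fsum b s) < eps%:E)%E) -> forall k, b k = 0.
Proof.
move=> h k; apply/eqP; rewrite -cabs2_eq0 eq_le cabs2_ge0 andbT leNgt; apply/negP => bk0.
have [s0 h0] := h (c1 * cabs2 (b k)) (mulr_gt0 c10 bk0).
have us := undup_uniq (k :: s0); pose s := undup (k :: s0).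
have ks : k \in s by rewrite mem_undup mem_head.
have := le_lt_trans (lower b us) (h0 s us _); rewrite lte_fin => /(_ _)/wrap[].
  by move=> l ls; rewrite mem_undup in_cons ls orbT.
rewrite ltr_pM2l// (bigD1_seq k)//= ltNge lerDl sumr_ge0// => l _; exact: cabs2_ge0.
Qed.

(* The two-sided bounds transfer the Cauchy property of the partial sums from
   [b] to [b']. *)
Lemma sums_to_same_modulus b b' f : (forall k, cabs2 (b' k) = cabs2 (b k)) -> sums_to b f ->
  exists f', sums_to b' f'.
Proof.
move=> bb' [f2 hf].
have tail (eps : R) : 0 < eps -> exists s0, uniq s0 /\ forall r, uniq r ->
    (forall k, k \in r -> k \notin s0) -> (sqint (fsum b' r) < eps%:E)%E.
  (* The 4 is spent in [sqint_lt_add]; the ratio c1 / c2 pays for passing from [b] to [b'] through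
     their common sum of squares. *)
  move=> eps0; have e0 : 0 < c1 / c2 * eps / 4 by rewrite divr_gt0// mulr_gt0// divr_gt0.
  have [s1 h1] := hf _ e0; have us0 := undup_uniq s1; exists (undup s1); split=> // r ur rs.
  have us : uniq (undup s1 ++ r).
    by rewrite cat_uniq us0 ur andbT /=; apply/hasPn => k /rs.
  have small : (sqint (fsum b r) < (c1 / c2 * eps)%:E)%E.
    apply: (@sqint_lt_add _ (fun x => f x - fsum b (undup s1) x)
       (fun x => fsum b (undup s1 ++ r) x - f x)).
    - by apply: cmeasB; [exact: f2.1|exact: cmeas_fsum].
    - by apply: cmeasB; [exact: cmeas_fsum|exact: f2.1].
    - by move=> x; rewrite /fsum big_cat/=; ring.
    - by apply: h1 => // k; rewrite mem_undup.
    - by rewrite sqintB_sym; apply: h1 => // k; rewrite mem_cat mem_undup => ->.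
  have lt := le_lt_trans (lower b ur) small.
  apply: (le_lt_trans (upper b' ur)); move: lt; rewrite !lte_fin.
  under [in X in _ -> X]eq_bigr do rewrite bb'.
  by rewrite mulrAC -mulrA ltr_pM2l// ltr_pdivlMr// mulrC.
have /boolp.choice[t0 ht0] (n : nat) : exists s0, uniq s0 /\ forall r, uniq r ->
    (forall k, k \in r -> k \notin s0) -> (sqint (fsum b' r) < n.+1%:R^-1%:E)%E.
  by apply: tail; rewrite invr_gt0.
(* The sets [t0 n] need not be nested; their unions are, so that the partial sums over [t n] form a
   Cauchy sequence, and its limit is the candidate for the unordered sum. *)
pose t n := undup (flatten [seq t0 i | i <- iota 0 n.+1]).
have ut n : uniq (t n) by exact: undup_uniq.
have tsub m n : (m <= n)%N -> {subset t m <= t n}.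
  move=> mn k; rewrite !mem_undup => /flattenP[s /mapP[i im ->] ks].
  apply/flattenP; exists (t0 i) => //; apply: map_f; move: im; rewrite !mem_iota/= !add0n.
  by move=> im; apply: leq_trans im _.
have t0t n : {subset t0 n <= t n}.
  move=> k kn; rewrite mem_undup; apply/flattenP; exists (t0 n) => //; apply: map_f.
  by rewrite mem_iota/= add0n.
have rest n s : uniq s -> {subset t n <= s} ->
    (sqint (fun x => fsum b' s x - fsum b' (t n) x)%R < n.+1%:R^-1%:E)%E.
  move=> us ts; have [_ h] := ht0 n.
  have := h [seq k <- s | k \notin t n] (filter_uniq _ us) _.
  move=> /(_ _)/wrap[].
    by move=> k; rewrite mem_filter => /andP[kt _]; apply: contra kt; exact: t0t.
  congr (_ < _)%E; apply: eq_integral => x _.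
  by rewrite (fsum_subset b' x us (ut n) ts) addrAC subrr add0r.
have small (eps : R) : 0 < eps -> exists N : nat, N.+1%:R^-1 < eps.
  by move=> eps0; have [N] := ltr_add_invr eps0; rewrite add0r => hN; exists N.
have [n|eps eps0|v mv hv] := @cL2_complete R d (fun n => fsum b' (t n)).
- exact: cmeas_fsum.
- have [N hN] := small (eps / 4) (divr_gt0 eps0 (ltr0n _ 4)).
  exists N => m n Nm Nn.
  apply: (@sqint_lt_add _ (fun x => fsum b' (t m) x - fsum b' (t N) x)
       (fun x => fsum b' (t N) x - fsum b' (t n) x)).
  + by apply: cmeasB; exact: cmeas_fsum.
  + by apply: cmeasB; exact: cmeas_fsum.
  + by move=> x; ring.
  + by apply: (lt_trans (rest N _ (ut m) (tsub _ _ Nm))); rewrite lte_fin.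
  + by rewrite sqintB_sym; apply: (lt_trans (rest N _ (ut n) (tsub _ _ Nn))); rewrite lte_fin.
have fin_fsum s : uniq s -> (sqint (fsum b' s) < +oo)%E.
  by move=> us; apply: le_lt_trans (upper b' us) _; exact: ltry.
exists v; split.
  split=> //; have [N hN] := hv 1 ltr01.
  apply: (le_lt_trans (sqint_le2 mv (cmeas_fsum b' (t N)))).
  apply: lte_add_pinfty; rewrite lte_mul_pinfty// ?fin_fsum//.
  by apply: (lt_trans (hN N (leqnn N))); exact: ltry.
move=> eps eps0; have e4 : 0 < eps / 4 by rewrite divr_gt0.
have e16 : 0 < eps / 4 / 4 by rewrite divr_gt0.
have [N hN] := small _ e16; have [N' hN'] := hv _ e16.
exists (t (maxn N N')) => s us ts; pose n := maxn N N'.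
have inv_lt : (n.+1%:R^-1 < eps / 4 / 4)%R.
  by apply: le_lt_trans hN; rewrite lef_pV2 ?posrE// ler_nat ltnS leq_maxl.
apply: (@sqint_lt_add _ (fun x => v x - fsum b' (t n) x) (fun x => fsum b' (t n) x - fsum b' s x)).
- by apply: cmeasB => //; exact: cmeas_fsum.
- by apply: cmeasB; exact: cmeas_fsum.
- by move=> x; ring.
- by apply: (lt_trans (hN' _ (leq_maxr _ _))); rewrite lte_fin ltr_pdivrMr//; lra.
- rewrite sqintB_sym; apply: (lt_trans (rest n s us ts)); rewrite lte_fin; apply: (lt_trans inv_lt); rewrite ltr_pdivrMr//; lra.
Qed.

End riesz.
End UnconditionalSums.

(** * Translates of a fixed function *)

Section Translates.
Variable R : realType.
Local Notation C := R[i].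
Local Notation vec d := ('rV[R]_d).

Lemma unimodular_expi (z : C) : cabs2 z = 1 -> exists t, z = expi t.
Proof.
case: z => a b; rewrite /cabs2/= => ab1.
have a1 : -1 <= a <= 1 by apply/andP; split; nra.
have sa : sin (acos a) = `|b|.
  by rewrite sin_acos// -sqrtr_sqr; congr Num.sqrt; lra.
have [b0|b0] := leP 0 b.
  by exists (acos a); apply: complex_ext; rewrite /= ?acosK// sa ger0_norm.
by exists (- acos a); apply: complex_ext; rewrite /= ?cosN ?acosK// sinN sa ltr0_norm// opprK.
Qed.

(** A number is real exactly when it equals its conjugate; for e^(-it) z the conjugate is e^(it)
    z^*, and multiplying by e^(it) gives the stated form. *)
Lemma Im_expi_eq0 (t : R) (z : C) : complex.Im (expi (- t) * z) = 0 <-> z = expi (2 * t) * z^*.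
Proof.
have -> : z = expi (2 * t) * z^* <-> expi (- t) * z = expi t * z^*.
  have et : expi (2 * t) = expi t * expi t by rewrite -expiD; congr expi; ring.
  have e1 : expi t * expi (- t) = 1 by rewrite -expiD subrr expi0.
  split=> [e|e].
    by rewrite [in LHS]e et !mulrA [expi (- t) * _]mulrC e1 mul1r.
  by rewrite et -mulrA -e mulrA e1 mul1r.
rewrite conjE; case: z => a b; split=> [|/(congr1 (@complex.Im R))].
  by rewrite ImM/= cosN sinN => h; apply: complex_ext; rewrite ?ReM ?ImM/= ?cosN ?sinN; lra.
by rewrite !ImM/= cosN sinN => h; lra.
Qed.

Lemma simE d (f h : vec d -> C) : cmeas f -> cmeas h ->
  (sim f h <-> exists2 nu : C, cabs2 nu = 1 & sqint (fun x => f x - nu * h x)%R = 0%E).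
Proof.
move=> mf mh; have mnu (nu : C) : cmeas (fun x => nu * h x).
  by apply: cmeasM => //; exact: cmeas_cst.
split=> [[nu [/norm1_cabs2 nu1 /(aeeqE mf (mnu nu)) e]]|[nu nu1 e]]; exists nu => //.
by split; [exact/norm1_cabs2|exact/(aeeqE mf (mnu nu))].
Qed.

Lemma latpt_inj d (M : 'M[R]_d) : M \in unitmx -> injective (latpt M).
Proof.
move=> uM k l; rewrite /latpt => /(congr1 (mulmx^~ (invmx M^T))).
rewrite !mulmxK ?unitmx_tr// => /rowP h; apply/rowP => i.
by have := h i; rewrite !mxE => /intr_inj.
Qed.

Lemma cell_dualcell d (M : 'M[R]_d) : M \in unitmx -> cell M 0 `<=` dualcell M.
Proof.
move=> uM x hx; exists (x *m M); split; last by rewrite mulmxK.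
move=> i; have := floor_itv ((x *m M) 0 i); rewrite hx mxE add0r => /andP[h1 h2].
by rewrite h1 ltW.
Qed.

(** The one-term sum with shift 0 and coefficient 1 turns [tsum_trig] into a comparison of the norms
    of psi and Psi. *)
Lemma fourier_limit_eq0 d (psi Psi : vec d -> C) : cL2 psi -> fourier_limit psi Psi ->
  sqint Psi = 0%E -> sqint psi = 0%E.
Proof.
move=> psi2 fl Psi0; have [h _] := tsum_trig (fun _ : unit => 0) (fun=> 1) [:: tt] psi2 fl.
apply/eqP; rewrite eq_le sqint_ge0 andbT; move: h.
have -> : tsum (fun _ : unit => 0) (fun=> 1) [:: tt] psi = psi.
  by apply/funext => x; rewrite /tsum big_seq1 mul1r /transl subr0.
have -> : (fun w => trig (fun _ : unit => 0) (fun=> 1) [:: tt] w * Psi w) = Psi.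
  apply/funext => w; rewrite /trig big_seq1 mul1r /phase.
  by rewrite dotE big1 ?mulr0 ?oppr0 ?expi0 ?mul1r// => i _; rewrite mxE mulr0.
by rewrite Psi0 mule0.
Qed.

Section system.
Variables (d : nat) (phi : vec d -> C) (M : 'M[R]_d) (S : 'M[R]_(d + d)).
Variables U Uinv : (vec d -> C) -> (vec d -> C).
Hypotheses (phi2 : L2 phi) (phi0 : ~ aeeq phi (fun=> 0)) (uM : M \in unitmx).
Hypothesis mU : metaplectic S U Uinv.
Local Notation lp := (latpt M).
Local Notation psi := (Uinv phi).
Local Notation e := (fun k => TS U Uinv (lp k) phi).

Lemma cL2_psi : cL2 psi.
Proof. by case: mU => h _ _ _ _; have [_ /L2E] := h _ phi2. Qed.

Lemma cL2_U h : cL2 h -> cL2 (U h).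
Proof. by case: mU => hU _ _ _ _ /L2E /hU[/L2E]. Qed.

Lemma sqint_U h : cL2 h -> sqint (U h) = sqint h.
Proof.
move=> h2; have [mUh _] := cL2_U h2; have [mh _] := h2.
by case: mU => _ _ _ _ [iso _]; rewrite -norm2sqE// iso ?norm2sqE//; exact/L2E.
Qed.

Lemma cL2_transl a (h : vec d -> C) : cL2 h -> cL2 (transl a h).
Proof. by move=> [mh fh]; split; [exact: cmeas_transl|rewrite sqint_transl]. Qed.

Lemma cL2_TS k : cL2 (e k).
Proof. by apply: cL2_U; apply: cL2_transl; exact: cL2_psi. Qed.

Lemma cL2_tsum b s : cL2 (tsum lp b s psi).
Proof.
have [mpsi fpsi] := cL2_psi; split; first exact: cmeas_tsum.
have [B B0 hB] := tsum_bounded lp b s; apply: (le_lt_trans (hB _ mpsi)).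
by rewrite lte_mul_pinfty ?lee_fin.
Qed.

Lemma U_tsum b s : aeeq (U (tsum lp b s psi)) (fsum e b s).
Proof.
case: mU => _ _ lin _ _; apply/aeE.
have linE a h g : cL2 h -> cL2 g ->
    {ae leb R d, forall t, U (fun t => a * h t + g t) t = a * U h t + U g t}.
  by move=> /L2E h2 /L2E g2; apply/aeE; exact: lin.
elim: s => [|k s IH].
  have c0 : cL2 (fun _ : vec d => 0 : C).
    have := cL2_tsum b [::]; rewrite (_ : tsum _ _ _ _ = fun=> 0)//.
    by apply/funext => x; rewrite /tsum big_nil.
  (* Linearity with scalar 1 and zero functions reads U 0 = U 0 + U 0, hence U 0 = 0 almost
     everywhere. *)
  have := linE 1 _ _ c0 c0; apply: filterS => t.
  rewrite (_ : (fun t => 1 * 0 + 0) = fun=> 0); last by apply/funext => x; rewrite mulr0 addr0.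
  rewrite mul1r (_ : tsum _ _ _ _ = fun=> 0); last by apply/funext => x; rewrite /tsum big_nil.
  by move=> h; rewrite /fsum big_nil; apply: (@addrI _ (U (fun=> 0) t)); rewrite -h addr0.
have := linE (b k) _ _ (cL2_transl (lp k) cL2_psi) (cL2_tsum b s).
apply: filterS2 IH => t IH.
rewrite (_ : (fun t => _ + _) = tsum lp b (k :: s) psi); last first.
  by apply/funext => x; rewrite /tsum big_cons.
by move=> ->; rewrite IH /fsum big_cons.
Qed.

Lemma cmeas_TS k : cmeas (e k).
Proof. exact: (cL2_TS k).1. Qed.

Lemma sqint_fsum b s : sqint (fsum e b s) = sqint (tsum lp b s psi).
Proof.
rewrite -[RHS]sqint_U; last exact: cL2_tsum.
apply/esym/aeeq_sqint; [exact: (cL2_U (cL2_tsum b s)).1|exact: cmeas_fsum cmeas_TS b s|exact: U_tsum].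
Qed.

Lemma series_toE c f : series_to M U Uinv phi c f <-> sums_to e c f.
Proof.
split=> [[/L2E f2 h]|[f2 h]].
  split=> // eps /h[s0 h0]; exists s0 => s us ss; have := h0 s us ss.
  by rewrite norm2sqE//; apply: cmeasB; [exact: f2.1|exact: cmeas_fsum cmeas_TS c s].
split; first exact/L2E.
move=> eps /h[s0 h0]; exists s0 => s us ss; have := h0 s us ss.
by rewrite -norm2sqE//; apply: cmeasB; [exact: f2.1|exact: cmeas_fsum cmeas_TS c s].
Qed.

Lemma sqint_psi_neq0 : sqint psi <> 0%E.
Proof.
move=> psi0; apply: phi0; have psi2 := cL2_psi; have /L2E phi2' := phi2.
have mUpsi := (cL2_U psi2).1.
case: (mU) => _ _ _ inv _; have [_ e1] := inv _ phi2.
have := aeeq_sqint mUpsi phi2'.1 e1; rewrite sqint_U// psi0 => e2.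
apply/aeeqE; [exact: phi2'.1|exact: cmeas_cst|rewrite [RHS]e2]; apply: eq_integral => x _.
by rewrite subr0.
Qed.

(** The argument shared by parts (1) and (2), which differ in how they establish the last
    hypothesis, the uniqueness of the coefficients. *)
Lemma sim_conj_iff (c : 'rV[int]_d -> C) f fx : ell2 c -> sums_to e c f ->
  sums_to e (fun k => (c k)^*) fx ->
  (forall nu : C, cabs2 nu = 1 -> sqint (fun x => f x - nu * fx x)%R = 0%E ->
     forall k, c k - nu * (c k)^* = 0) ->
  (~ sim f fx <-> ell2O c).
Proof.
move=> c2 hf hfx key; have mf := hf.1.1; have mfx := hfx.1.1; split=> [ns|[_ nO]].
  split=> // -[t ht]; apply: ns; apply/(simE mf mfx).
  exists (expi (2 * t)); first exact: cabs2_expi.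
  have := sums_toZ (cabs2_expi (2 * t)) hfx.
  rewrite (_ : (fun k => _) = c); last by apply/funext => k; apply/esym/Im_expi_eq0.
  exact: (sums_to_unique cmeas_TS hf).
move=> /(simE mf mfx)[nu nu1 /(key nu nu1) h]; have [t tE] := unimodular_expi nu1.
apply: nO; exists (t / 2) => k; apply/Im_expi_eq0.
by rewrite [2 * _]mulrC divfK// -tE; apply/subr0_eq.
Qed.

Lemma finite_case (c : 'rV[int]_d -> C) f : ell2 c -> c00 c -> sums_to e c f ->
  (exists fx, sums_to e (fun k => (c k)^*) fx) /\
  (forall fx, sums_to e (fun k => (c k)^*) fx -> (~ sim f fx <-> ell2O c)).
Proof.
move=> c2 /finite_seqP[s0 hs] hf; pose t := undup s0.
have ut : uniq t by exact: undup_uniq.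
have ct k : k \notin t -> c k = 0.
  move=> kt; apply/eqP; apply: contraNT kt => ck.
  by rewrite mem_undup; have : [set` s0] k by rewrite -hs.
have cct k : k \notin t -> (c k)^* = 0 by move=> /ct ->; rewrite conjC0.
split=> [|fx hfx]; first by eexists; exact: (sums_to_supp cmeas_TS ut cL2_TS cct).
apply: (sim_conj_iff c2 hf hfx) => nu nu1 sim0.
pose b k := c k - nu * (c k)^*.
have bt k : k \notin t -> b k = 0 by move=> kt; rewrite /b (ct _ kt) conjC0 mulr0 subr0.
(* Every partial sum over a set containing the support [t] equals the one over [t], whose squared
   norm is therefore below every eps. *)
have b0 : sqint (fsum e b t) = 0%E.
  apply/eqP; rewrite eq_le sqint_ge0 andbT; apply/lee_addgt0Pr => eps eps0.
  have [s1 h1] := sums_to_small cmeas_TS nu1 hf hfx sim0 eps0.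
  have us := undup_uniq (s1 ++ t); have := h1 _ us _.
  rewrite add0e (_ : fsum _ _ _ = fsum e b t).
    by move=> h; apply: ltW; apply: h => k ks; rewrite mem_undup mem_cat ks.
  apply/funext => x; apply: fsum_supp => // k kt.
  by rewrite mem_undup mem_cat kt orbT.
have [Psi fl] := fourier_limit_exists cL2_psi; have [mPsi _] := fl.
have [_ trig0] := tsum_trig lp b t cL2_psi fl.
move: trig0; rewrite -sqint_fsum b0 mule0 => trig0.
have {}trig0 : sqint (fun w => trig lp b t w * Psi w) = 0%E.
  by apply/eqP; rewrite eq_le trig0 sqint_ge0.
have [hb|/hasPn nb] := boolP (has (fun k => b k != 0) t); last first.
  by move=> k; have [/nb/negPn/eqP|/bt] := boolP (k \in t).
exfalso; apply: sqint_psi_neq0; apply: (fourier_limit_eq0 cL2_psi fl).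
apply/(sqint_eq0 mPsi).
have Z : {ae leb R d, forall w, trig lp b t w != 0}.
  exists [set w | trig lp b t w = 0]; split.
  - exact: measurable_trig_zeros.
  - by apply: leb_trig_zeros => // k l _ _; exact: latpt_inj.
  - by move=> w /=; case: eqP.
have /sqint_eq0 := trig0; move=> /(_ (cmeasM (cmeas_trig lp b t) mPsi)).
apply: filterS2 Z => w /negPf nz /eqP; by rewrite mulf_eq0 nz => /eqP.
Qed.

Lemma riesz_case (c : 'rV[int]_d -> C) f (A B : R) Psi : ell2 c -> sums_to e c f ->
  0 < A -> A <= B -> is_fourierL2 psi Psi ->
  ae_on (dualcell M) (fun t => (A%:E <= periodization M Psi t <= B%:E)%E) ->
  (exists fx, sums_to e (fun k => (c k)^*) fx) /\
  (forall fx, sums_to e (fun k => (c k)^*) fx -> (~ sim f fx <-> ell2O c)).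
Proof.
move=> c2 hf A0 AB fPsi [N [/nullRdE nN perN]].
have [[mPsi fPsi2] fl] := is_fourierL2_limit cL2_psi fPsi.
have perAB : {ae leb R d, forall t, cell M 0 t -> (A%:E <= periodization M Psi t <= B%:E)%E}.
  apply: negligibleS nN => t /= nt; apply: contrapT => nNt; apply: nt => Dt.
  by apply: perN => //; exact: (cell_dualcell uM).
pose L := fine (leb R d (cell M 0)).
have L0 : 0 < L.
  apply: (leb_cell_gt0 uM mPsi fPsi2 A0 perAB); apply/eqP => /(fourier_limit_eq0 cL2_psi fl).
  exact: sqint_psi_neq0.
have bounds := riesz_bounds uM mPsi fPsi2 A0 AB perAB.
(* The factors 4 in the two Riesz constants are those of [tsum_trig]; A, B and the cell measure L
   come from [riesz_bounds]. *)
have c10 : 0 < A * L / 4 by rewrite divr_gt0// mulr_gt0.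
have c20 : 0 < 4 * (B * L) by rewrite !mulr_gt0// (lt_le_trans A0).
have lower b s : uniq s -> ((A * L / 4 * \sum_(k <- s) cabs2 (b k))%:E <= sqint (fsum e b s))%E.
  move=> us; rewrite sqint_fsum; have [_ h] := tsum_trig lp b s cL2_psi fl.
  have /andP[h1 _] := bounds b s us; rewrite -(@lee_pmul2l _ 4%:E)//.
  apply: le_trans h; apply: le_trans h1; rewrite -EFinM lee_fin le_eqVlt; apply/orP; left.
  by apply/eqP; rewrite -/L; field.
have upper b s : uniq s -> (sqint (fsum e b s) <= (4 * (B * L) * \sum_(k <- s) cabs2 (b k))%:E)%E.
  move=> us; rewrite sqint_fsum; have [h _] := tsum_trig lp b s cL2_psi fl.
  have /andP[_ h1] := bounds b s us; apply: (le_trans h).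
  by rewrite -!mulrA EFinM lee_pmul2l.
split=> [|fx hfx].
  exact: (sums_to_same_modulus cmeas_TS c10 c20 lower upper (fun k => cabs2_conj (c k)) hf).
apply: (sim_conj_iff c2 hf hfx) => nu nu1 sim0.
exact: (small_fsum_eq0 c10 lower (sums_to_small cmeas_TS nu1 hf hfx sim0)).
Qed.

End system.
End Translates.

Theorem theorem3p8 (R : realType) (d : nat)
    (phi : 'rV[R]_d -> R[i]) (M : 'M[R]_d) (S : 'M[R]_(d + d))
    (U Uinv : ('rV[R]_d -> R[i]) -> ('rV[R]_d -> R[i]))
    (c : 'rV[int]_d -> R[i]) (f : 'rV[R]_d -> R[i]) :
  L2 phi -> ~ aeeq phi (fun _ => 0) ->
  M \in unitmx ->
  symplectic S -> metaplectic S U Uinv ->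
  ell2 c ->
  series_to M U Uinv phi c f ->
  (* (1) *)
  (c00 c ->
     (exists fx, series_to M U Uinv phi (fun k => (c k)^*) fx) /\
     (forall fx, series_to M U Uinv phi (fun k => (c k)^*) fx ->
        (~ sim f fx <-> ell2O c))) /\
  (* (2) *)
  ((exists A B : R, [/\ 0 < A, A <= B &
      exists Psi, is_fourierL2 (Uinv phi) Psi /\
        ae_on (dualcell M) (fun t => (A%:E <= periodization M Psi t <= B%:E)%E)]) ->
     (exists fx, series_to M U Uinv phi (fun k => (c k)^*) fx) /\
     (forall fx, series_to M U Uinv phi (fun k => (c k)^*) fx ->
        (~ sim f fx <-> ell2O c))).
Proof.
move=> phi2 phi0 uM _ mU c2 /(series_toE M phi2 mU) hf; split.
  move=> cfin; have [[fx hfx] h] := finite_case phi2 phi0 uM mU c2 cfin hf.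
  split; first by exists fx; apply/(series_toE M phi2 mU).
  by move=> gx /(series_toE M phi2 mU) /h.
move=> [A [B [A0 AB [Psi [fPsi perAB]]]]].
have [[fx hfx] h] := riesz_case phi2 phi0 uM mU c2 hf A0 AB fPsi perAB.
split; first by exists fx; apply/(series_toE M phi2 mU).
by move=> gx /(series_toE M phi2 mU) /h.
Qed.
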